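(* Let $k\ge 3$, $0<\epsilon<1$, and let $\lambda$ satisfy $$1>\lambda>\frac12+\frac{2+\epsilon}{2k}.$$ Let the coarse mesh size be $H=h^\lambda$. Let $u_h\in B_h$ be the solution of the discrete problem on the fine mesh, and let $u^h$ be the output of the two-grid algorithm: 1. $u_H\in V_H$ is the solution in $B_H$ of: $u_H=g_H$ on $\partial\Omega$ and $A(u_H,\chi)=0$ for all $\chi\in V_H\cap H_0^1(\Omega)$; 2. $u^h\in V_h$ satisfies $u^h=g_h$ on $\partial\Omega$ and $A'(u_H;u^h-u_H,\phi)=-A(u_H,\phi)$ for all $\phi\in V_h\cap H_0^1(\Omega)$. Then there exist $h_0>0$ and a constant $C>0$ independent of $h$ such that for all $h\le h_0$, $$\|u^h-u_h\|_{H^1(\Omega)}\le C h^k .$$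
   Context: Continuous problem. $\Omega\subset\mathbb{R}^2$ is a convex polygonal domain, $f\in C^1(\overline\Omega)$ with $f\ge c_0$ for a constant $c_0>0$, and $g\in C(\partial\Omega)$ extends to a function $G\in C^3(\overline\Omega)$. The problem $\det(D^2u)=f$ in $\Omega$, $u=g$ on $\partial\Omega$, is assumed to have a strictly convex solution $u\in C^3(\overline\Omega)$, so that the cofactor matrix $\operatorname{cof} D^2u$ of the Hessian is uniformly positive definite: $\alpha_0|r|^2\le r^T(\operatorname{cof} D^2u(x))r\le\alpha_1|r|^2$ for all $x\in\overline\Omega$, $r\in\mathbb{R}^2$, with constants $\alpha_0,\alpha_1>0$. Moreover $u, G\in W^{k+1,\infty}(\Omega)$. Discretization. $\{\mathcal{T}_h\}$ is a family of conforming, shape regular, quasi-uniform triangulations of $\Omega$ into triangles $K$, $h=\max_K \operatorname{diam}K\le 1$; $\mathcal{E}_h^i$ is the set of interior edges. $V_h$ is the Lagrange finite element space of degree $k$ on $\mathcal{T}_h$ (continuous functions on $\overline{\Omega}$ that are polynomials of degree $\le k$ on each $K$), $I_h$ is the canonical Lagrange interpolant into $V_h$, and $g_h$ is the canonical interpolant in $V_h$ of a continuous extension of $g$ (only its values on $\partial\Omega$ matter, so $g_h=I_hG=I_hu$ on $\partial\Omega$). Derivatives of piecewise smooth functions are taken element by element. For an interior edge $e=K^+\cap K^-$ with outward unit normals $n_{K^\pm}$: for a vector field $v$, $[\![v]\!]=v|_{K^+}\cdot n_{K^+}+v|_{K^-}\cdot n_{K^-}$; for a matrix field $E$, $[\![E]\!]=n_{K^+}^TE|_{K^+}+n_{K^-}^TE|_{K^-}$;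 averages are $\{\!\{v\}\!\}=\tfrac12(v|_{K^+}+v|_{K^-})$, $\{\!\{E\}\!\}=\tfrac12(E|_{K^+}+E|_{K^-})$. Define $$A(v,\phi)=\sum_{K\in\mathcal{T}_h}\int_K (f-\det D^2v)\,\phi\,dx+\sum_{e\in\mathcal{E}_h^i}\int_e[\![\{\!\{\operatorname{cof}D^2v\}\!\}Dv]\!]\,\phi\,ds ,$$ and let $A'(w;v,\phi)$ be the Fréchet derivative at $w$, in direction $v$, of $A(\cdot,\phi)$; explicitly $$A'(w;v,\phi)=\sum_K\int_K\big((\operatorname{cof}D^2w)Dv\big)\cdot D\phi\,dx-\sum_{e\in\mathcal{E}_h^i}\int_e[\![\operatorname{cof}D^2w]\!]\{\!\{Dv\}\!\}\phi\,ds+\sum_{e\in\mathcal{E}_h^i}\int_e[\![\{\!\{\operatorname{cof}D^2v\}\!\}Dw]\!]\phi\,ds .$$ In particular $A'(u;v,\phi)=\int_\Omega\big((\operatorname{cof}D^2u)Dv\big)\cdot D\phi\,dx$. The discrete problem on a mesh of size $h$ is: find $u_h\in V_h$, $u_h=g_h$ on $\partial\Omega$, $A(u_h,\phi)=0$ for all $\phi\in V_h\cap H^1_0(\Omega)$; for $k\ge3$ and $h$ sufficiently small it has a unique solution in the set $B_h$ below. The coarse mesh $\mathcal{T}_H$ (size $H$) and fine mesh $\mathcal{T}_h$ (size $h$) belong to the family, $\mathcal{T}_h$ is a refinement of $\mathcal{T}_H$ (so $V_H\subset V_h$), and $V_H,g_H,B_H$ denote the objects above for the mesh size $H$. The set $B_h$.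 Let $\hat P_h:H_0^1(\Omega)\to V_h\cap H_0^1(\Omega)$ be the projection with respect to $A'(u;\cdot,\cdot)$, i.e. $A'(u;\hat P_hv-v,\phi)=0$ for all $\phi\in V_h\cap H_0^1(\Omega)$, and set $P_hu=\hat P_h(u-G)+I_hG$. For $z\in\Omega\setminus\bigcup_K\partial K$ let $g^z_{h,i}$ ($i=1,2$) and $G^z_h$ in $V_h\cap H_0^1(\Omega)$ be the discrete Green's functions defined by $A'(u;g^z_{h,i},\phi)=\frac{\partial\phi}{\partial x_i}(z)$ and $A'(u;G^z_h,\phi)=\phi(z)$ for all $\phi\in V_h\cap H_0^1(\Omega)$. For $h$ sufficiently small there are positive constants $C_1,C_2,C_3$, independent of $h$ and $z$, with $\|u-P_hu\|_{W^{1,\infty}}\le C_1h^k$, $|A'(u;I_hG-G,G^z_h)|\le C_2h^k|\ln h|$ and $|A'(u;I_hG-G,g^z_{h,i})|\le C_3h^k|\ln h|$; fix such constants and let $C_4=\max\{C_1,C_2,C_3\}$. Then $$B_h=\{v\in V_h:\ v=g_h\text{ on }\partial\Omega,\ \|v-u\|_{W^{1,\infty}(\Omega)}\le 3C_4h^k|\ln h|\}.$$ *)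

(* Defs.v *)
From HB Require Import structures.
From mathcomp Require Import all_boot all_order all_algebra.
From mathcomp Require Import all_classical all_reals all_analysis.

Set Implicit Arguments.
Unset Strict Implicit.
Unset Printing Implicit Defensive.

Import Order.TTheory GRing.Theory Num.Theory.
Import numFieldNormedType.Exports.

Local Open Scope classical_set_scope.
Local Open Scope ring_scope.

(* [pt R] carries the library's product topology and max norm; Euclidean
   lengths are written with [eucl]. *)
Notation pt R := (R * R)%type (only parsing).

Section Plane.
Context {R : realType}.
Implicit Types (x y z p q : pt R) (A Omega : set (pt R)).

Definition pt_coord (i : 'I_2) x : R := if i == ord0 then x.1 else x.2.

Definition basis_vec (i : 'I_2) : pt R :=
  if i == ord0 then (1, 0) else (0, 1).

Definition vec x : 'cV[R]_2 := \col_i pt_coord i x.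

Definition eucl x : R := Num.sqrt (x.1 ^+ 2 + x.2 ^+ 2).

Definition lincomb n (w : 'I_n -> R) (p : 'I_n -> pt R) : pt R :=
  (\sum_(i < n) w i * (p i).1, \sum_(i < n) w i * (p i).2).

Definition edist x y : R := eucl (x.1 - y.1, x.2 - y.2).

Definition segpt p q (t : R) : pt R :=
  ((1 - t) * p.1 + t * q.1, (1 - t) * p.2 + t * q.2).

Definition segment p q : set (pt R) :=
  [set x | exists2 t, 0 <= t <= 1 & x = segpt p q t].

Definition hull n (p : 'I_n -> pt R) : set (pt R) :=
  [set x | exists w : 'I_n -> R,
    [/\ forall i, 0 <= w i, \sum_(i < n) w i = 1 & x = lincomb w p]].

Definition bdry A : set (pt R) := closure A `\` A°.

Definition convex_polygonal_domain Omega : Prop :=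
  Omega !=set0 /\ exists n (p : 'I_n -> pt R), Omega = (hull p)°.

Definition diam A : R :=
  sup [set r | exists x y, [/\ A x, A y & r = edist x y]].

Definition inradius A : R :=
  sup [set r | 0 <= r /\ exists c, [set x | edist x c <= r] `<=` A].

Definition strictly_convex Omega (u : pt R -> R) : Prop :=
  forall x y (t : R), Omega x -> Omega y -> x <> y -> 0 < t < 1 ->
    u (segpt x y t) < (1 - t) * u x + t * u y.

End Plane.

Section Spaces.
Context {R : realType}.
Implicit Types (U Omega : set (pt R)) (s : seq 'I_2) (v w : pt R -> R).

Definition leb2 := (@lebesgue_measure R \x @lebesgue_measure R)%E.

(* The word [:: i; j] stands for d/dx_i d/dx_j. *)
Definition dpar s v : pt R -> R :=
  foldr (fun i (w : pt R -> R) => 'D_(basis_vec i) w) v s.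

(* Value at x \in closure U of the continuous extension from U (open) to the
   closure of U of the partial derivative of v|_U. With U the interior of an
   element K this is the elementwise derivative on K, including its one-sided
   trace on the edges of K. *)
Definition dpar_on U s v (x : pt R) : R :=
  lim (dpar s v @ within U (nbhs x)).

Definition grad U v (x : pt R) : 'cV[R]_2 := \col_i dpar_on U [:: i] v x.

Definition hess U v (x : pt R) : 'M[R]_2 :=
  \matrix_(i, j) dpar_on U [:: i; j] v x.

Definition cof n (M : 'M[R]_n) : 'M[R]_n := \matrix_(i, j) cofactor M i j.

Definition C_bar m Omega v : Prop :=
  {within closure Omega, continuous v} /\
  forall s, (size s <= m)%N ->
    ((size s < m)%N -> forall x i, Omega x ->
       derivable (dpar s v) x (basis_vec i)) /\
    exists2 F : pt R -> R, {within closure Omega, continuous F} &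
      forall x, Omega x -> F x = dpar s v x.

Definition test_function Omega (phi : pt R -> R) : Prop :=
  (forall s x, differentiable (dpar s phi) x) /\
  exists Z : set (pt R),
    [/\ compact Z, Z `<=` Omega & forall x, ~ Z x -> phi x = 0].

Definition Linf_norm Omega v : \bar R :=
  Lnorm leb2 +oo%E (EFin \o (v \_ Omega)).

Definition in_Linf Omega v : Prop :=
  measurable_fun Omega v /\
  (Linf_norm Omega v < +oo)%E.

Definition weak_derivative Omega s v w : Prop :=
  forall phi, test_function Omega phi ->
    \int[leb2]_(x in Omega) (v x * dpar s phi x) =
    (-1) ^+ size s * \int[leb2]_(x in Omega) (w x * phi x).

Definition in_Winf m Omega v : Prop :=
  in_Linf Omega v /\
  forall s, (size s <= m)%N ->
    exists2 w, in_Linf Omega w & weak_derivative Omega s v w.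

(* Both norms are applied to continuous functions that are C^1 on each element,
   whose weak gradient is the elementwise one, i.e. the pointwise one off the
   null set of the element boundaries. Values are extended reals. *)
Definition W1inf_norm Omega v : \bar R :=
  maxe (Linf_norm Omega v)
    (maxe (Linf_norm Omega (dpar [:: ord0] v))
          (Linf_norm Omega (dpar [:: ord_max] v))).

Definition H1_norm Omega v : \bar R :=
  sqrte (\int[leb2]_(x in Omega)
    (v x ^+ 2 + \sum_(i < 2) dpar [:: i] v x ^+ 2)%:E).

End Spaces.

Record mesh (R : realType) := Mesh {
  ntri : nat;
  vtx : 'I_ntri -> 'I_3 -> pt R
}.

Section Meshes.
Context {R : realType}.
Implicit Types (T : mesh R) (Omega : set (pt R)) (Th : set (mesh R)).

Definition cell T (i : 'I_(ntri T)) : set (pt R) := hull (vtx i).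

(* Edge [a] of a triangle is the one opposite to vertex [a]. *)
Definition edge_src T (i : 'I_(ntri T)) (a : 'I_3) : pt R := vtx i (ordS a).
Definition edge_tgt T (i : 'I_(ntri T)) (a : 'I_3) : pt R := vtx i (ord_pred a).

Definition edge T (i : 'I_(ntri T)) (a : 'I_3) : set (pt R) :=
  segment (edge_src i a) (edge_tgt i a).

Definition same_edge T (i : 'I_(ntri T)) (a : 'I_3) (j : 'I_(ntri T))
    (b : 'I_3) : bool :=
  (edge_src i a == edge_src j b) &&
  (edge_tgt i a == edge_tgt j b) ||
  (edge_src i a == edge_tgt j b) &&
  (edge_tgt i a == edge_src j b).

Definition edge_length T (i : 'I_(ntri T)) (a : 'I_3) : R :=
  edist (edge_src i a) (edge_tgt i a).

Definition outward_normal T (i : 'I_(ntri T)) (a : 'I_3) : 'cV[R]_2 :=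
  let p := edge_src i a in
  let q := edge_tgt i a in
  let r := vtx i a in
  let nu : pt R := (q.2 - p.2, p.1 - q.1) in
  let side := nu.1 * (r.1 - p.1) + nu.2 * (r.2 - p.2) in
  (- Num.sg side / edge_length i a) *: vec nu.

Definition nondegenerate (p : 'I_3 -> pt R) : Prop :=
  let a := p ord0 in let b := p (inord 1) in let c := p (inord 2) in
  (b.1 - a.1) * (c.2 - a.2) - (b.2 - a.2) * (c.1 - a.1) != 0.

Definition conforming_triangulation Omega T : Prop :=
  [/\ forall i : 'I_(ntri T), nondegenerate (vtx i),
      closure Omega = \bigcup_(i in setT) @cell T i &
      forall i j : 'I_(ntri T), i != j ->
        [\/ cell i `&` cell j = set0,
            exists a b, vtx i a = vtx j b /\ cell i `&` cell j = [set vtx i a] |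
            exists a b, same_edge i a j b /\ cell i `&` cell j = edge i a]].

Definition mesh_size T : R := \big[Num.max/0]_(i < ntri T) diam (cell i).

Definition shape_regular Th : Prop :=
  exists2 sigma : R, 0 < sigma &
    forall T, Th T -> forall i : 'I_(ntri T),
      diam (cell i) <= sigma * inradius (cell i).

Definition quasi_uniform Th : Prop :=
  exists2 tau : R, 0 < tau &
    forall T, Th T -> forall i : 'I_(ntri T),
      mesh_size T <= tau * diam (cell i).

Definition refines T TH : Prop :=
  forall i : 'I_(ntri T), exists j : 'I_(ntri TH), cell i `<=` cell j.

(* Sum over the interior edges e of the integral over e; an interior edge is an
   edge shared by two triangles, K^+ = K_i and K^- = K_j with i < j. *)
Definition sum_interior_edges T
    (F : 'I_(ntri T) -> 'I_3 -> 'I_(ntri T) -> 'I_3 -> pt R -> R) : R :=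
  \sum_(i < ntri T) \sum_(j < ntri T | (i < j)%N)
  \sum_(a < 3) \sum_(b < 3 | same_edge i a j b)
    edge_length i a *
    \int[@lebesgue_measure R]_(t in `[0, 1])
      F i a j b (segpt (edge_src i a) (edge_tgt i a) t).

End Meshes.

Section Traces.
Context {R : realType}.

Definition average m n (Ep Em : 'M[R]_(m, n)) : 'M[R]_(m, n) :=
  2^-1 *: (Ep + Em).

(* For a column vector field the result is the 1 x 1 matrix of the scalar jump;
   for a 2 x 2 matrix field it is a row vector. *)
Definition jump n (np nm : 'cV[R]_2) (Ep Em : 'M[R]_(2, n)) : 'rV[R]_n :=
  np^T *m Ep + nm^T *m Em.

Definition scal (M : 'M[R]_1) : R := M ord0 ord0.

End Traces.

Section FEM.
Context {R : realType}.
Implicit Types (T : mesh R) (Omega : set (pt R)) (f g u G v w phi uH : pt R -> R).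

Definition poly_deg_le (k : nat) (p : pt R -> R) : Prop :=
  exists c : nat -> nat -> R, forall x, p x =
    \sum_(i < k.+1) \sum_(j < k.+1 | (i + j <= k)%N)
      c i j * x.1 ^+ i * x.2 ^+ j.

(* Elements of V_h are functions on the closure of Omega; their values
   elsewhere are irrelevant to everything below. *)
Definition Vh k Omega T v : Prop :=
  {within closure Omega, continuous v} /\
  forall i : 'I_(ntri T), exists2 p, poly_deg_le k p &
    forall x, cell i x -> v x = p x.

(* V_h \cap H^1_0(Omega): zero trace on the boundary. *)
Definition Vh0 k Omega T v : Prop :=
  Vh k Omega T v /\ forall x, bdry Omega x -> v x = 0.

Definition is_interpolant k Omega T w v : Prop :=
  Vh k Omega T v /\
  forall (i : 'I_(ntri T)) (al : 'I_3 -> nat), (\sum_(a < 3) al a = k)%N ->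
    let z := lincomb (fun a => (al a)%:R / k%:R) (vtx i) in v z = w z.

Definition Ih k Omega T w : pt R -> R :=
  xget (fun=> 0) [set v | is_interpolant k Omega T w v].

Definition MAform T f v phi : R :=
  \sum_(i < ntri T)
    \int[leb2]_(x in cell i) ((f x - \det (hess (cell i)° v x)) * phi x)
  + sum_interior_edges (fun i a j b x =>
      let Kp := (@cell _ T i)° in let Km := (@cell _ T j)° in
      let cv := average (cof (hess Kp v x)) (cof (hess Km v x)) in
      scal (jump (outward_normal i a) (outward_normal j b)
              (cv *m grad Kp v x) (cv *m grad Km v x)) * phi x).

(* Frechet derivative at w, in direction v, of [MAform T f ^~ phi], after
   elementwise integration by parts (cofactor matrices are divergence free). *)
Definition dMAform T w v phi : R :=
  \sum_(i < ntri T)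
    \int[leb2]_(x in cell i)
      scal ((cof (hess (cell i)° w x) *m grad (cell i)° v x)^T
              *m grad (cell i)° phi x)
  - sum_interior_edges (fun i a j b x =>
      let Kp := (@cell _ T i)° in let Km := (@cell _ T j)° in
      scal (jump (outward_normal i a) (outward_normal j b)
              (cof (hess Kp w x)) (cof (hess Km w x))
            *m average (grad Kp v x) (grad Km v x)) * phi x)
  + sum_interior_edges (fun i a j b x =>
      let Kp := (@cell _ T i)° in let Km := (@cell _ T j)° in
      let cv := average (cof (hess Kp v x)) (cof (hess Km v x)) in
      scal (jump (outward_normal i a) (outward_normal j b)
              (cv *m grad Kp w x) (cv *m grad Km w x)) * phi x).

Definition Phat k Omega T u v : pt R -> R :=
  xget (fun=> 0) [set q | Vh0 k Omega T q /\
    forall phi, Vh0 k Omega T phi -> dMAform T u (fun x => q x - v x) phi = 0].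

Definition Ph k Omega T u G : pt R -> R :=
  fun x => Phat k Omega T u (fun y => u y - G y) x + Ih k Omega T G x.

Definition green_deriv k Omega T u (z : pt R) (i : 'I_2) : pt R -> R :=
  xget (fun=> 0) [set q | Vh0 k Omega T q /\
    forall phi, Vh0 k Omega T phi -> dMAform T u q phi = dpar [:: i] phi z].

Definition green k Omega T u (z : pt R) : pt R -> R :=
  xget (fun=> 0) [set q | Vh0 k Omega T q /\
    forall phi, Vh0 k Omega T phi -> dMAform T u q phi = phi z].

Definition stability_bounds k Omega u G (C1 C2 C3 : R) T : Prop :=
  let h := mesh_size T in
  let eG := fun x => Ih k Omega T G x - G x in
  (W1inf_norm Omega (fun x => u x - Ph k Omega T u G x)%R
     <= (C1 * h ^+ k)%:E)%E /\
  forall z, Omega z -> (forall i : 'I_(ntri T), ~ bdry (cell i) z) ->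
    `|dMAform T u eG (green k Omega T u z)| <= C2 * h ^+ k * `|ln h| /\
    forall i, `|dMAform T u eG (green_deriv k Omega T u z i)|
                <= C3 * h ^+ k * `|ln h|.

(* As only the boundary values of g_h matter, g_h is taken to be I_h G, where
   G is a continuous extension of g. *)
Definition boundary_match k Omega T G v : Prop :=
  forall x, bdry Omega x -> v x = Ih k Omega T G x.

Definition Bh k Omega T u G (C4 : R) v : Prop :=
  [/\ Vh k Omega T v,
      boundary_match k Omega T G v &
      (W1inf_norm Omega (fun x => v x - u x)%R
         <= (3 * C4 * mesh_size T ^+ k * `|ln (mesh_size T)|)%:E)%E].

Definition discrete_solution k Omega T f G v : Prop :=
  [/\ Vh k Omega T v,
      boundary_match k Omega T G v &
      forall phi, Vh0 k Omega T phi -> MAform T f v phi = 0].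

(* Newton correction on the mesh T of the coarse approximation uH. *)
Definition newton_step k Omega T f G uH v : Prop :=
  [/\ Vh k Omega T v,
      boundary_match k Omega T G v &
      forall phi, Vh0 k Omega T phi ->
        dMAform T uH (fun x => v x - uH x) phi = - MAform T f uH phi].

End FEM.

(* Main.v *)
(* Put e = u_h - u_H and w = u^h - u_h. On piecewise polynomials the elementwise
   divergence theorem and the identity div cof D^2 v = 0 give
   A(u_H + e, phi) = A(u_H, phi) + A'(u_H; e, phi) + Q(e, phi) with Q quadratic,
   hence A'(u_H; w, phi) = Q(e, phi); the estimate follows by taking phi = w.
   Let delta bound u_H - u and u_h - u in W^{1,oo}. Inverse inequalities on
   squares inscribed in the fine cells make D^2 u_H uniformly close to D^2 u, so
   the volume part of A'(u_H; w, w) is coercive, and its edge terms are at most a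
   multiple of delta h^-2 |w|_1^2. Since Q(e, w) is at most a multiple of
   delta^2 times the sum over the cells of max |w|, this yields
   |w|_1 <= C delta^2 / h^2, and the condition on lambda is what makes
   delta = O(H^k |ln H|) at most of order h^(k/2 + 1). *)

(* The factor h^-2 in front of delta^2 has two sources. An inverse inequality bounds max |w| on a
   cell by C/h times the H^1 norm of w there, and Cauchy-Schwarz over the O(h^-2) cells costs
   another 1/h. The assumption on lambda says lambda k > k/2 + 1 + eps/2, and the surplus h^(eps/2)
   absorbs the logarithm. The edge terms of A'(u_H; w, w) have no sign, so coercivity must dominate
   them. Their relative size is delta h^-2 = O(h^(k/2 - 1)), and k >= 3 makes this O(h^(1/2)), which
   is what fixes h_0. Finite element functions are replaced by one algebraic polynomial per cell, so
   that derivatives, jumps and the expansion of A become ring identities; the limits by which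
   elementwise derivatives are defined are compared with these polynomials once. The W^{1,oo} bounds
   hold only almost everywhere. They become pointwise because the gradients compared are continuous
   on each closed cell. *)
From HB Require Import structures.
Require Import Defs.
From mathcomp Require Import all_boot all_order all_algebra.
From mathcomp Require Import all_classical all_reals all_analysis.
From mathcomp Require Import measurable_realfun ess_sup_inf.
From mathcomp Require Import ring lra.

Set Implicit Arguments.
Unset Strict Implicit.
Unset Printing Implicit Defensive.

Import Order.TTheory GRing.Theory Num.Theory.
Import numFieldNormedType.Exports.

Local Open Scope classical_set_scope.
Local Open Scope ring_scope.

(** * Bivariate polynomials and inverse inequalities *)

Section BivariatePolynomials.
Context {R : realType}.
Implicit Types (P Q : {poly {poly R}}) (p q : {poly R}) (x c : pt R).

(* A polynomial in (x.1, x.2) is a polynomial in x.2 with coefficients in the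
   polynomials in x.1; [bsize n] bounds its degree in each variable by n - 1. *)
Definition ev P x : R := P.[x.2%:P].[x.1].
Definition dX P : {poly {poly R}} := map_poly (fun p : {poly R} => p^`()) P.
Definition dY P : {poly {poly R}} := P^`().
Definition dpoly (i : 'I_2) P := if i == ord0 then dX P else dY P.

Definition bsize n P := (size P <= n)%N /\ forall i, (size (P`_i)%R <= n)%N.

Lemma evD P Q x : ev (P + Q) x = ev P x + ev Q x.
Proof. by rewrite /ev !hornerD. Qed.
Lemma evN P x : ev (- P) x = - ev P x.
Proof. by rewrite /ev !hornerN. Qed.
Lemma evB P Q x : ev (P - Q) x = ev P x - ev Q x.
Proof. by rewrite evD evN. Qed.
Lemma evM P Q x : ev (P * Q) x = ev P x * ev Q x.
Proof. by rewrite /ev !hornerM. Qed.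
Lemma evC (a : R) x : ev a%:P%:P x = a.
Proof. by rewrite /ev !hornerC. Qed.
Lemma ev0 x : ev 0 x = 0.
Proof. by rewrite /ev !horner0. Qed.
Lemma evX1 x : ev 'X%:P x = x.1.
Proof. by rewrite /ev hornerC hornerX. Qed.
Lemma evX2 x : ev 'X x = x.2.
Proof. by rewrite /ev hornerX hornerC. Qed.
Lemma evX P n x : ev (P ^+ n) x = ev P x ^+ n.
Proof. by rewrite /ev !horner_exp. Qed.
Lemma ev_sum I (s : seq I) (A : pred I) (F : I -> {poly {poly R}}) x :
  ev (\sum_(i <- s | A i) F i) x = \sum_(i <- s | A i) ev (F i) x.
Proof. by rewrite /ev !horner_sum. Qed.

Definition evE := (evX1, evX2, evC, ev0, evX, evM, evB, evD, evN).

Lemma coef_dX P i : (dX P)`_i = (P`_i)^`().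
Proof. by rewrite coef_map_id0 ?deriv0. Qed.

Lemma dXD P Q : dX (P + Q) = dX P + dX Q.
Proof. by apply/polyP => i; rewrite !(coef_dX, coefD) derivD. Qed.
Lemma dXN P : dX (- P) = - dX P.
Proof. by apply/polyP => i; rewrite !(coef_dX, coefN) derivN. Qed.
Lemma dXB P Q : dX (P - Q) = dX P - dX Q.
Proof. by rewrite dXD dXN. Qed.
Lemma dXM P Q : dX (P * Q) = dX P * Q + P * dX Q.
Proof.
apply/polyP => i; rewrite coef_dX coefD !coefM raddf_sum -big_split /=.
by apply: eq_bigr => j _; rewrite derivM !coef_dX.
Qed.
Lemma dXC p : dX p%:P = p^`()%:P.
Proof. by apply/polyP => i; rewrite coef_dX !coefC; case: eqP => // _; rewrite deriv0. Qed.
Lemma dXX : dX 'X = 0.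
Proof.
by apply/polyP => i; rewrite coef_dX coefX coef0; case: eqP => //=;
  rewrite ?mulr1n ?mulr0n ?derivC ?deriv0 // -?polyC1 ?derivC.
Qed.

Lemma dYD P Q : dY (P + Q) = dY P + dY Q. Proof. exact: derivD. Qed.
Lemma dYB P Q : dY (P - Q) = dY P - dY Q. Proof. exact: derivB. Qed.
Lemma dYM P Q : dY (P * Q) = dY P * Q + P * dY Q. Proof. exact: derivM. Qed.
Lemma dYX : dY 'X = 1. Proof. exact: derivX. Qed.
Lemma dX0 : dX 0 = 0. Proof. by rewrite -polyC0 dXC deriv0. Qed.
Lemma dY0 : dY 0 = 0. Proof. exact: deriv0. Qed.
Lemma dYC p : dY p%:P = 0. Proof. exact: derivC. Qed.

Lemma dXY P : dX (dY P) = dY (dX P).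
Proof. by apply/polyP => i; rewrite coef_dX !coef_deriv coef_dX derivMn. Qed.

Lemma bsizeW m n P : (m <= n)%N -> bsize m P -> bsize n P.
Proof. by move=> mn [h1 h2]; split=> [|i]; exact: leq_trans mn. Qed.
Lemma bsizeD n P Q : bsize n P -> bsize n Q -> bsize n (P + Q).
Proof.
move=> [P1 P2] [Q1 Q2]; split=> [|i]; rewrite ?coefD (leq_trans (size_polyD _ _))//;
 by rewrite geq_max ?P1 ?Q1 ?P2 ?Q2.
Qed.
Lemma bsizeN n P : bsize n P -> bsize n (- P).
Proof. by move=> [P1 P2]; split=> [|i]; rewrite ?coefN size_polyN. Qed.
Lemma bsizeB n P Q : bsize n P -> bsize n Q -> bsize n (P - Q).
Proof. by move=> hP hQ; apply: bsizeD hP (bsizeN hQ). Qed.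
Lemma bsize_sum n I (s : seq I) (A : pred I) (F : I -> {poly {poly R}}) :
  (forall i, A i -> bsize n (F i)) -> bsize n (\sum_(i <- s | A i) F i).
Proof.
move=> h; elim/big_ind : _ => //; last exact: bsizeD.
by split=> [|i]; rewrite ?coef0 size_poly0.
Qed.
Lemma bsizeM m n P Q : bsize m P -> bsize n Q -> bsize (m + n) (P * Q).
Proof.
move=> [P1 P2] [Q1 Q2]; split=> [|i].
  by rewrite (leq_trans (size_polyMleq _ _))// (leq_trans (leq_pred _))// leq_add.
rewrite coefM (leq_trans (size_sum _ _ _))//; apply/bigmax_leqP => j _.
by rewrite (leq_trans (size_polyMleq _ _))// (leq_trans (leq_pred _))// leq_add.
Qed.
Lemma bsize_dX n P : bsize n P -> bsize n (dX P).
Proof.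
move=> [P1 P2]; split=> [|i].
  by rewrite (leq_trans (size_poly _ _)).
by rewrite coef_dX (leq_trans (leq_trans (size_poly _ _) (leq_pred _))).
Qed.
Lemma bsize_dY n P : bsize n P -> bsize n (dY P).
Proof.
move=> [P1 P2]; split=> [|i].
  by rewrite (leq_trans (leq_trans (size_poly _ _) (leq_pred _))).
by rewrite coef_deriv -mulr_natl (leq_trans _ (P2 i.+1))// mulr_natl -scaler_nat size_scale_leq.
Qed.
Lemma bsize_dpoly n i P : bsize n P -> bsize n (dpoly i P).
Proof. by rewrite /dpoly; case: ifP => _; [exact: bsize_dX|exact: bsize_dY]. Qed.

Lemma poly_deg_leP k (p : pt R -> R) : poly_deg_le k p ->
  exists2 P, bsize k.+1 P & forall x, p x = ev P x.
Proof.
move=> [c pE]; exists (\sum_(i < k.+1) \sum_(j < k.+1 | (i + j <= k)%N)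
   (c i j *: 'X^i)%:P * 'X^j).
  apply: bsize_sum => i _; apply: bsize_sum => j _; split=> [|l].
    by rewrite mul_polyC (leq_trans (size_scale_leq _ _))// size_polyXn.
  rewrite coefCM coefXn; case: (_ == _); rewrite ?mulr1 ?mulr0 ?size_poly0//.
  by rewrite (leq_trans (size_scale_leq _ _))// size_polyXn.
move=> x; rewrite pE ev_sum; apply: eq_bigr => i _; rewrite ev_sum.
apply: eq_bigr => j _; rewrite evM evX evX2 /ev hornerC hornerZ hornerXn.
by rewrite -!mulrA.
Qed.

Lemma ev_row P (x2 : R) n : bsize n P -> exists2 q : {poly R}, (size q <= n)%N &
  (forall t, ev P (t, x2) = q.[t]) /\ (forall t, ev (dX P) (t, x2) = q^`().[t]).
Proof.
move=> [P1 P2]; exists P.[x2%:P].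
  rewrite horner_coef (leq_trans (size_sum _ _ _))//; apply/bigmax_leqP => j _.
  by rewrite -polyC_exp mulrC mul_polyC (leq_trans (size_scale_leq _ _)).
split=> // t; rewrite /ev /=; congr (_.[_]).
rewrite !horner_coef raddf_sum /= (@big_ord_widen _ _ _ (size (dX P)) (size P)
  (fun i => (dX P)`_i * x2%:P ^+ i)) ?size_poly//.
rewrite big_mkcond /=; apply: eq_bigr => i _.
rewrite -polyC_exp derivM derivC mulr0 addr0 coef_dX.
case: ltnP => // h; have := nth_default 0 h; rewrite coef_dX => ->.
by rewrite mul0r.
Qed.

Lemma ev_col P (x1 : R) n : bsize n P -> exists2 q : {poly R}, (size q <= n)%N &
  (forall t, ev P (x1, t) = q.[t]) /\ (forall t, ev (dY P) (x1, t) = q^`().[t]).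
Proof.
move=> [P1 P2]; exists (map_poly (horner_eval x1) P).
  by rewrite (leq_trans (size_poly _ _)).
have E Q t : ev Q (x1, t) = (map_poly (horner_eval x1) Q).[t].
  by have := horner_map (horner_eval x1) Q t%:P; rewrite /= /horner_eval hornerC.
by split=> t; rewrite E // /dY deriv_map.
Qed.

(** The values at the n distinct nodes j/n determine a polynomial of size at most n, and the inverse
    Vandermonde matrix recovers its coefficients linearly from them. *)
Lemma poly_coef_bound n : exists2 C : R, 0 < C & forall q (M : R),
  (size q <= n)%N -> (forall t, 0 <= t <= 1 -> `|q.[t]| <= M) ->
  forall i, `|q`_i| <= C * M.
Proof.
pose a : 'rV[R]_n := \row_j (j%:R / n%:R).
pose V := Vandermonde n a.
have Vu : V \in unitmx.
  rewrite unitmxE det_Vandermonde unitfE; apply/prodf_neq0 => i _.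
  apply/prodf_neq0 => j ij; rewrite !mxE subr_eq0.
  have n0 : n%:R != 0 :> R by rewrite pnatr_eq0 -lt0n (leq_ltn_trans _ (ltn_ord i)).
  by rewrite (inj_eq (mulIf _)) ?invr_eq0// eqr_nat gt_eqF.
(* The summand 1 keeps the constant positive when n = 0. *)
exists (1 + \sum_j \sum_i `|invmx V j i|).
  by rewrite ltr_pwDl// sumr_ge0// => j _; rewrite sumr_ge0.
move=> q M sq hM i.
have M0 : 0 <= M by apply: le_trans (hM 0 _); rewrite ?lexx ?ler01.
have C0 j : 0 <= \sum_i `|invmx V j i| by rewrite sumr_ge0.
have [ni|ni] := leqP n i.
  by rewrite nth_default ?normr0 ?mulr_ge0 ?addr_ge0 ?sumr_ge0// (leq_trans sq).
pose co : 'rV[R]_n := \row_l q`_l.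
pose va : 'rV[R]_n := \row_l q.[a 0 l].
have E : co *m V = va.
  apply/rowP => l; rewrite !mxE (horner_coef_wide _ sq).
  by apply: eq_bigr => m _; rewrite !mxE.
have -> : q`_i = (va *m invmx V) 0 (Ordinal ni) by rewrite -E mulmxK// !mxE.
rewrite mxE (le_trans (ler_norm_sum _ _ _))// mulrDl mul1r mulr_suml ler_wpDl//.
apply: ler_sum => j _; rewrite normrM mulrC ler_pM//.
  by rewrite (bigD1 (Ordinal ni))//= lerDl sumr_ge0.
rewrite mxE; apply: hM; rewrite mxE divr_ge0 ?ler0n//=.
by rewrite ler_pdivrMr ?mul1r ?ler_nat ?(ltnW (ltn_ord _))// ltr0n (leq_ltn_trans _ ni).
Qed.

(** Bounded coefficients control the values and the derivative on any fixed interval. Allowing L > 1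
    is what later carries a bound from an inscribed square to the whole cell. *)
Lemma poly_extension_bound n (L : R) : 0 <= L -> exists2 C : R, 0 < C & forall q (M : R),
  (size q <= n)%N -> (forall t, 0 <= t <= 1 -> `|q.[t]| <= M) ->
  forall t, `|t| <= L -> `|q.[t]| <= C * M /\ `|q^`().[t]| <= C * M.
Proof.
move=> L0; have [C C0 hC] := poly_coef_bound n.
pose S := 1 + \sum_(i < n) L ^+ i *+ i.+1 + \sum_(i < n) L ^+ i.-1 *+ i.
have S1 : 0 <= \sum_(i < n) L ^+ i *+ i.+1 by rewrite sumr_ge0// => i _; rewrite mulrn_wge0 ?exprn_ge0.
have S2 : 0 <= \sum_(i < n) L ^+ i.-1 *+ i by rewrite sumr_ge0// => i _; rewrite mulrn_wge0 ?exprn_ge0.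
exists (C * S); first by rewrite mulr_gt0// /S; lra.
move=> q M sq hM t tL.
have M0 : 0 <= M by apply: le_trans (hM 0 _); rewrite ?lexx ?ler01.
have CM0 : 0 <= C * M by rewrite mulr_ge0 ?(ltW C0).
have hc := hC q M sq hM.
split.
  rewrite (horner_coef_wide _ sq) (le_trans (ler_norm_sum _ _ _))//.
  apply: (@le_trans _ _ (\sum_(i < n) (C * M) * (L ^+ i *+ i.+1))); last first.
    by rewrite -mulr_sumr [leRHS]mulrAC ler_wpM2l// /S; lra.
  apply: ler_sum => i _; rewrite normrM ler_pM// normrX.
  apply: (@le_trans _ _ (L ^+ i)); first by rewrite lerXn2r// nnegrE.
  by rewrite mulrS lerDl mulrn_wge0 ?exprn_ge0.
have sq' : (size q^`() <= n)%N by rewrite (leq_trans (leq_trans (size_poly _ _) (leq_pred _))).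
have -> : q^`().[t] = \sum_(i < n) q`_i * (t ^+ i.-1 *+ i).
  rewrite (horner_coef_wide _ (leq_trans sq' (leqnSn _))).
  case: (n) sq => [|m] sq.
    by rewrite big_ord0 big_ord1 coef_deriv nth_default ?mul0rn ?mul0r// (leq_trans sq).
  rewrite big_ord_recr /= coef_deriv nth_default ?(leq_trans sq)// mul0rn mul0r addr0.
  rewrite big_ord_recr /= coef_deriv nth_default ?(leq_trans sq)// mul0rn mul0r addr0.
  rewrite big_ord_recl /= mulr0n mulr0 add0r; apply: eq_bigr => i _.
  by rewrite coef_deriv /bump /= add1n mulrnAl mulrnAr.
rewrite (le_trans (ler_norm_sum _ _ _))//.
apply: (@le_trans _ _ (\sum_(i < n) (C * M) * (L ^+ i.-1 *+ i))); last first.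
  by rewrite -mulr_sumr [leRHS]mulrAC ler_wpM2l// /S; lra.
apply: ler_sum => i _; rewrite normrM ler_pM// normrMn normrX.
by rewrite ler_wMn2r// lerXn2r// nnegrE.
Qed.

Lemma poly_interval_bound n (L : R) : 0 <= L -> exists2 C : R, 0 < C & forall q (M c r : R),
  (size q <= n)%N -> 0 < r -> (forall t, `|t - c| <= r -> `|q.[t]| <= M) ->
  forall t, `|t - c| <= L * r -> `|q.[t]| <= C * M /\ `|q^`().[t]| <= C / r * M.
Proof.
(* The affine map [l] below sends [0, 1] to [c - r, c + r]; under it |t - c| <= L r becomes |s| <=
   (L + 1)/2. *)
move=> L0; have [|C C0 hC] := @poly_extension_bound n ((L + 1) / 2); first by lra.
exists C => // q M c r sq r0 hM t tL.
pose l : {poly R} := (2 * r)%:P * 'X + (c - r)%:P.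
have lE s : l.[s] = 2 * r * s + (c - r) by rewrite /l !hornerE.
have sl : (size l <= 2)%N.
  rewrite (leq_trans (size_polyD _ _))// geq_max (leq_trans (size_polyC_leq1 _))// andbT.
  by rewrite mul_polyC (leq_trans (size_scale_leq _ _))// size_polyX.
have sq' : (size (q \Po l) <= n)%N.
  have [->|q0] := eqVneq q 0; first by rewrite comp_poly0 size_poly0.
  rewrite (leq_trans (size_comp_poly_leq _ _))// (leq_trans _ sq)//.
  have := size_poly_gt0 q; rewrite q0; case: (size q) => // m _ /=.
  by rewrite ltnS -[leqRHS]muln1 leq_mul2l; case: (size l) sl => [|[|[|]]]//; rewrite orbT.
pose s := (t - c + r) / (2 * r).
have r2 : 2 * r != 0 by rewrite gt_eqF// mulr_gt0.
have ls : l.[s] = t by rewrite lE /s; field; rewrite gt_eqF.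
have [||] := hC _ M sq' _ s.
- move=> y /andP[y0 y1]; rewrite horner_comp; apply: hM; rewrite lE.
  rewrite ler_norml; apply/andP; split; nra.
- rewrite /s normrM normfV (gtr0_norm (x := 2 * r)) ?mulr_gt0// ler_pdivrMr ?mulr_gt0//.
  rewrite (le_trans (ler_normD _ _))// (gtr0_norm r0); lra.
rewrite deriv_comp hornerM !horner_comp ls => h1 h2; split=> //.
have dl : l^`() = (2 * r)%:P by rewrite /l derivD derivM !derivC derivX; ring.
move: h2; rewrite dl hornerC normrM (gtr0_norm (x := 2 * r)) ?mulr_gt0// => h2.
rewrite mulrAC ler_pdivlMr//; apply: le_trans h2.
by rewrite ler_wpM2l//; lra.
Qed.

Definition sq c (r : R) : set (pt R) := [set x | `|x.1 - c.1| <= r /\ `|x.2 - c.2| <= r].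

(** The one-dimensional bound is used once per variable, hence the constant C * C: to differentiate
    in one variable on the larger square, first extrapolate in the other one. *)
Lemma bernstein_square n (L : R) : 1 <= L -> exists2 C : R, 0 < C & forall P (M : R) c (r : R),
  bsize n P -> 0 < r -> (forall x, sq c r x -> `|ev P x| <= M) ->
  forall x, sq c (L * r) x -> [/\ `|ev P x| <= C * M, `|ev (dX P) x| <= C / r * M
     & `|ev (dY P) x| <= C / r * M].
Proof.
move=> L1; have L0 : 0 <= L by lra.
have [C C0 hC] := @poly_interval_bound n _ L0.
exists (C * C); first exact: mulr_gt0.
move=> P M c r sP r0 hM.
have rL : r <= L * r by rewrite ler_peMl ?(ltW r0).
have H1 (x1 x2 : R) : `|x1 - c.1| <= L * r -> `|x2 - c.2| <= r ->
    `|ev P (x1, x2)| <= C * M /\ `|ev (dX P) (x1, x2)| <= C / r * M.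
  move=> h1 h2; have [q qs [qE qE']] := @ev_row P x2 n sP.
  rewrite qE qE'; apply: hC h1 => // t ht; rewrite -qE; exact: hM.
have H2 (x1 x2 : R) : `|x1 - c.1| <= r -> `|x2 - c.2| <= L * r ->
    `|ev P (x1, x2)| <= C * M /\ `|ev (dY P) (x1, x2)| <= C / r * M.
  move=> h1 h2; have [q qs [qE qE']] := @ev_col P x1 n sP.
  rewrite qE qE'; apply: hC h2 => // t ht; rewrite -qE; exact: hM.
move=> [x1 x2] [/= h1 h2].
have [q qs [qE qE']] := @ev_col P x1 n sP.
have [|A B] := hC q (C * M) c.2 r qs r0 _ x2 h2.
  by move=> t ht; rewrite -qE; apply: (H1 _ _ h1 ht).1.
have [q1 qs1 [qE1 qE1']] := @ev_row P x2 n sP.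
have [|A1 B1] := hC q1 (C * M) c.1 r qs1 r0 _ x1 h1.
  by move=> t ht; rewrite -qE1; apply: (H2 _ _ ht h2).1.
have E : C * C / r * M = C / r * (C * M) by ring.
by rewrite qE' qE1' qE E -mulrA; split.
Qed.

End BivariatePolynomials.

(** * Polynomials as functions on the plane *)

Section PolynomialAnalysis.
Context {R : realType}.
Implicit Types (P Q : {poly {poly R}}).

Lemma evMXaddC P (q : {poly R}) (x : pt R) : ev (P * 'X + q%:P) x = ev P x * x.2 + q.[x.1].
Proof. by rewrite evD evM evX2 /ev hornerC. Qed.

Lemma continuous_ev P : continuous (ev P : R * R -> R).
Proof.
elim/poly_ind: P => [|P q IH] x.
  by rewrite (_ : ev 0 = cst 0); [exact: cvg_cst|apply/funext => y; rewrite ev0].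
rewrite (_ : ev _ = fun y => ev P y * y.2 + q.[y.1]); last by apply/funext => y; rewrite evMXaddC.
apply: cvgD; first by apply: cvgM; [exact: IH|exact: cvg_snd].
by apply: continuous_comp; [exact: cvg_fst|exact: continuous_horner].
Qed.

Lemma measurable_ev P : measurable_fun [set: R * R] (ev P : R * R -> R).
Proof.
elim/poly_ind: P => [|P q IH].
  by rewrite (_ : ev 0 = cst 0); [exact: measurable_cst|apply/funext => y; rewrite ev0].
rewrite (_ : ev _ = fun y => ev P y * y.2 + q.[y.1]); last by apply/funext => y; rewrite evMXaddC.
apply: measurable_funD; first by apply: measurable_funM => //; exact: measurable_snd.
apply: (measurableT_comp (f := horner q)); last exact: measurable_fst.
by apply: continuous_measurable_fun; exact: continuous_horner.
Qed.

Definition line (a b c d t : R) : R * R := (a + b * t, c + d * t).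

Lemma is_derive_line P (a b c d t : R) : is_derive t (1 : R) (fun t => ev P (line a b c d t))
  (b * ev (dX P) (line a b c d t) + d * ev (dY P) (line a b c d t)).
Proof.
have dl (u v : R) : is_derive t (1 : R) (fun s => u + v * s) v.
  have : is_derive t (1 : R) (cst u + (v \*: id)) (0 + v *: 1).
    by apply: is_deriveD; apply: is_deriveZ.
  by rewrite add0r [v *: 1]mulr1.
elim/poly_ind: P => [|P q IH].
  rewrite (_ : (fun _ => _) = cst 0); last by apply/funext => y; rewrite ev0.
  apply: is_derive_eq.
  by rewrite dY0 dX0 !ev0 !mulr0 addr0.
rewrite (_ : (fun _ => _) = (fun s => ev P (line a b c d s)) * (fun s => c + d * s)
    + (horner q \o (fun s => a + b * s))); last by apply/funext => y; rewrite evMXaddC.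
have dq : is_derive (a + b * t) (1 : R) (horner q) q^`().[a + b * t].
  by apply: DeriveDef; [exact: derivable_horner|rewrite -derive1E -derivE].
apply: is_derive_eq.
rewrite dXD dYD dXM dYM dXX dXC dYC dYX !mulr0 !addr0 !mulr1 !evD !evM !evX2 /=.
by rewrite /ev hornerC /GRing.scale /=; ring.
Qed.

End PolynomialAnalysis.

(** * Integration over triangles *)

Section AffineMap.
Context {R : realType}.
Definition affine (a b : R) (x : measurableTypeR R) : measurableTypeR R := a * x + b.

Lemma measurable_affine a b : measurable_fun setT (affine a b).
Proof.
apply: (@measurable_funD _ _ R _ (fun x => a * x) (cst b)) => //.
exact: mulrl_measurable.
Qed.

Local Notation mu := (@lebesgue_measure R).
Local Open Scope ereal_scope.

(** Uniqueness of Lebesgue measure: the image of [mu] under x |-> a x + b, scaled by |a|, gives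
    every half-open interval its length. *)
Lemma ge0_integral_affine (g : R -> \bar R) (a b : R) : a != 0%R ->
  measurable_fun setT g -> (forall x, 0 <= g x) ->
  \int[mu]_x g x = `|a|%:E * \int[mu]_x g (a * x + b)%R.
Proof.
move=> a0 mg g0.
have ap : (0 <= `|a|)%R by [].
pose m : {measure set (measurableTypeR R) -> \bar R} :=
  measure_function_pushforward__canonical__measure_function_Measure mu
    (measurable_affine a b).
transitivity (\int[mscale (NngNum ap) m]_x g x); last first.
  by rewrite ge0_integral_mscale//= /m (ge0_integral_pushforward (measurable_affine a b)).
apply: eq_measure_integral => A mA _; apply: lebesgue_measure_unique => //.
move=> X [[p q]] _ <-.
transitivity (`|a|%:E * mu (affine a b @^-1` `]p, q]%classic)); last by [].
rewrite lebesgue_measure_itv /= lte_fin.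
have [a1|a1|a1] := ltgtP a 0%R; last by rewrite a1 eqxx in a0.
(* A negative slope exchanges the open and the closed end of the interval. *)
- rewrite (_ : _ @^-1` _ = `[((q - b) / a), ((p - b) / a)[%classic)%R; last first.
    apply/seteqP; split=> x; rewrite /= /affine !in_itv /= ler_ndivrMr// ltr_ndivlMr//.
      by rewrite lerBrDr ltrBlDr mulrC => /andP[-> ->].
    by rewrite lerBrDr ltrBlDr mulrC => /andP[-> ->].
  rewrite lebesgue_measure_itv /= lte_fin ltr_ndivrMr// divfK// ltrD2r.
  case: ifP => _; last by rewrite mule0.
  by rewrite ltr0_norm// -!EFinD -EFinM; congr EFin; field.
- rewrite (_ : _ @^-1` _ = `]((p - b) / a), ((q - b) / a)]%classic)%R; last first.
    apply/seteqP; split=> x; rewrite /= /affine !in_itv /= ltr_pdivrMr// ler_pdivlMr//.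
      by rewrite lerBrDr ltrBlDr mulrC => /andP[-> ->].
    by rewrite lerBrDr ltrBlDr mulrC => /andP[-> ->].
  rewrite lebesgue_measure_itv /= lte_fin ltr_pdivrMr// divfK// ltrD2r.
  case: ifP => _; last by rewrite mule0.
  by rewrite gtr0_norm// -!EFinD -EFinM; congr EFin; field.
Qed.

Definition affine2 (v e f : R * R) (x : R * R) : R * R :=
  (v.1 + x.1 * e.1 + x.2 * f.1, v.2 + x.1 * e.2 + x.2 * f.2)%R.

Definition det2 (e f : R * R) : R := (e.1 * f.2 - e.2 * f.1)%R.

Lemma measurable_affine2 v e f : measurable_fun setT (affine2 v e f).
Proof.
apply: measurable_fun_pair.
  apply: measurable_funD; first apply: measurable_funD; first exact: measurable_cst.
    by apply: measurable_funM; [exact: measurable_fst|exact: measurable_cst].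
  by apply: measurable_funM; [exact: measurable_snd|exact: measurable_cst].
apply: measurable_funD; first apply: measurable_funD; first exact: measurable_cst.
  by apply: measurable_funM; [exact: measurable_fst|exact: measurable_cst].
by apply: measurable_funM; [exact: measurable_snd|exact: measurable_cst].
Qed.

(** Gaussian elimination with pivot [e.1]: the substitution splits into one in the second variable
    with slope k, the Schur complement, and one in the first with slope [e.1]. Tonelli exchanges the
    integrals in between, and the product of the slopes is the determinant. *)
Let ge0_integral_affine2_aux (g : R * R -> \bar R) (v e f : R * R) :
  e.1 != 0%R -> det2 e f != 0%R -> measurable_fun setT g -> (forall x, 0 <= g x) ->
  \int[mu]_x \int[mu]_y g (x, y) =
  `|det2 e f|%:E * \int[mu]_t \int[mu]_s g (affine2 v e f (s, t)).
Proof.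
case: v e f => [v1 v2] [a c] [b d] /=; rewrite /det2 /= => a0 J0 mg g0.
pose k := (d - b * c / a)%R.
have kJ : (a * k = a * d - c * b)%R by rewrite /k; field.
have k0 : k != 0%R by apply: contra_neq J0; rewrite -kJ => ->; rewrite mulr0.
pose h (z : R * R) := g (z.1, k * z.2 + (c / a * (z.1 - v1) + v2))%R.
have mh : measurable_fun setT h.
  apply: measurableT_comp => //; apply: measurable_fun_pair; first exact: measurable_fst.
  apply: measurable_funD.
    by apply: measurable_funM; [exact: measurable_cst|exact: measurable_snd].
  apply: measurable_funD; last exact: measurable_cst.
  apply: measurable_funM; first exact: measurable_cst.
  by apply: measurable_funB; [exact: measurable_fst|exact: measurable_cst].
have mg2 x : measurable_fun setT (fun y => g (x, y)).
  by apply: measurableT_comp => //.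
transitivity (\int[mu]_x (`|k|%:E * \int[mu]_t h (x, t))).
  by apply: eq_integral => x _; rewrite /h /=; exact: (ge0_integral_affine (c / a * (x - v1) + v2)%R k0 (mg2 x)).
have mF : measurable_fun setT (fun x => \int[mu]_t h (x, t)).
  by apply: (@measurable_fun_fubini_tonelli_F _ _ _ _ _ mu h mh) => z; exact: g0.
rewrite (ge0_integralZl mu measurableT mF); last 2 first.
- by move=> x _; apply: integral_ge0 => y _; exact: g0.
- by rewrite lee_fin.
rewrite (@fubini_tonelli _ _ _ _ _ mu mu h mh); last by move=> x; exact: g0.
rewrite -kJ normrM mulrC EFinM -muleA; congr (_ * _).
have mga : measurable_fun setT (g \o affine2 (v1, v2) (a, c) (b, d)).
  by apply: measurableT_comp => //; exact: measurable_affine2.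
have mG : measurable_fun setT (fun t => \int[mu]_s g (affine2 (v1, v2) (a, c) (b, d) (s, t))).
  by apply: (@measurable_fun_fubini_tonelli_G _ _ _ _ _ mu _ mga) => z; exact: g0.
rewrite -(ge0_integralZl mu measurableT mG); last 2 first.
- by move=> x _; apply: integral_ge0 => y _; exact: g0.
- by rewrite lee_fin.
apply: eq_integral => t _.
have mh1 : measurable_fun setT (fun x => h (x, t)) by apply: measurableT_comp => //.
rewrite (ge0_integral_affine (v1 + t * b)%R a0 mh1); last by move=> x; exact: g0.
congr (_ * _); apply: eq_integral => s _; rewrite /h /affine2 /=; congr g.
by congr pair; rewrite /k; field.
Qed.

Lemma ge0_integral_affine2 (g : R * R -> \bar R) (v e f : R * R) :
  det2 e f != 0%R -> measurable_fun setT g -> (forall x, 0 <= g x) ->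
  \int[leb2]_x g x = `|det2 e f|%:E * \int[leb2]_x g (affine2 v e f x).
Proof.
move=> J0 mg g0.
have mga : measurable_fun setT (g \o affine2 v e f).
  by apply: measurableT_comp => //; exact: measurable_affine2.
have mga0 z : 0 <= (g \o affine2 v e f) z by exact: g0.
rewrite /leb2 (@fubini_tonelli1 _ _ _ _ _ mu mu _ mg g0).
have [e0|e0] := eqVneq e.1 0%R; last first.
  rewrite (ge0_integral_affine2_aux v e0 J0)//; congr (_ * _).
  by rewrite (@fubini_tonelli2 _ _ _ _ _ mu mu _ mga mga0).
(* A vanishing pivot is avoided by exchanging the two edge vectors, which only flips the sign of the
   determinant. *)
have f0 : f.1 != 0%R.
  by apply: contra_neq J0 => f0; rewrite /det2 e0 f0 mul0r mulr0 subr0.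
have JN : det2 f e = (- det2 e f)%R by rewrite /det2; ring.
rewrite (@ge0_integral_affine2_aux _ v f e)// ?JN ?oppr_eq0// normrN; congr (_ * _).
rewrite (@fubini_tonelli1 _ _ _ _ _ mu mu _ mga mga0); apply: eq_integral => x _.
apply: eq_integral => y _; rewrite /= /affine2 /=; congr g.
by congr pair; ring.
Qed.

Lemma integral_affine2 (g : R * R -> \bar R) (v e f : R * R) :
  det2 e f != 0%R -> measurable_fun setT g ->
  \int[leb2]_x g x = `|det2 e f|%:E * \int[leb2]_x g (affine2 v e f x).
Proof.
move=> J0 mg; have J1 : (0 < `|det2 e f|)%R by rewrite normr_gt0.
have E (x y : \bar R) : `|det2 e f|%:E * (x - y) = `|det2 e f|%:E * x - `|det2 e f|%:E * y.
  by case: x y => [x| |] [y| |] //=; rewrite ?gt0_muley ?gt0_muleNy// -!EFinM -EFinB mulrBr.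
rewrite integralE [in RHS]integralE E.
have mp : measurable_fun setT g^\+ by exact: measurable_funepos.
have mn : measurable_fun setT g^\- by exact: measurable_funeneg.
congr (_ - _).
  rewrite (ge0_integral_affine2 v J0 mp) => [|x]; last exact: funepos_ge0.
  by congr (_ * _); apply: eq_integral => x _; rewrite !funeposE.
rewrite (ge0_integral_affine2 v J0 mn) => [|x]; last exact: funeneg_ge0.
by congr (_ * _); apply: eq_integral => x _; rewrite !funenegE.
Qed.
End AffineMap.

Section Triangle.
Context {R : realType}.
Implicit Types (P Q : {poly {poly R}}) (x y v e f : pt R).
Local Notation mu := (@lebesgue_measure R).

Lemma continuous_line a b c d : continuous (line a b c d : R -> R * R).
Proof.
have E (u w t : R) : (u + w * s @[s --> t]) --> u + w * t.
  by apply: cvgD; [exact: cvg_cst|apply: cvgM; [exact: cvg_cst|exact: cvg_id]].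
by move=> t; apply: (cvg_pair (E a b t) (E c d t)).
Qed.

Lemma continuous_ev_line P a b c d : continuous (fun t : R => ev P (line a b c d t)).
Proof.
move=> t; apply: (@continuous_comp _ _ _ (line a b c d) (ev P)).
  exact: continuous_line.
exact: continuous_ev.
Qed.

Lemma integral_derive_line P (a b c d l r : R) : l <= r ->
  (\int[mu]_(t in `[l, r]) (b * ev (dX P) (line a b c d t) +
     d * ev (dY P) (line a b c d t))%:E =
  (ev P (line a b c d r))%:E - (ev P (line a b c d l))%:E)%E.
Proof.
rewrite le_eqVlt => /predU1P[->|lr].
  by rewrite set_itv1 integral_set1 -EFinB subrr.
have D t := is_derive_line P a b c d t.
apply: (continuous_FTC2 (F := fun t => ev P (line a b c d t))) => //.
- apply: continuous_subspaceT => t.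
  by apply: cvgD; (apply: cvgM; [exact: cvg_cst|exact: continuous_ev_line]).
- split; first by move=> t _; have [] := D t.
    by apply: cvg_at_right_filter; exact: continuous_ev_line.
  by apply: cvg_at_left_filter; exact: continuous_ev_line.
- by move=> t _; rewrite derive1E; exact: (@derive_val _ _ _ _ _ _ _ (D t)).
Qed.

Definition box (M : R) : set (R * R) := `[- M, M]%classic `*` `[- M, M]%classic.

Lemma measurable_box (M : R) : measurable (box M).
Proof. by apply: measurableX; exact: measurable_itv. Qed.

Lemma boxP (M : R) x : box M x <-> (`|x.1| <= M /\ `|x.2| <= M).
Proof. by rewrite /box /= !in_itv /= -!ler_norml. Qed.

Lemma leb2_box (M : R) : 0 <= M -> (leb2 (box M) = (4 * M ^+ 2)%:E)%E.
Proof.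
pose I : set R := `[- M, M]%classic.
move=> M0; have -> : leb2 (box M) = (mu I * mu I)%E.
  by rewrite /leb2 product_measure1E.
rewrite !lebesgue_measure_itv /= lte_fin.
have [M1|M1|M1] := ltgtP M 0; first by rewrite ltNge M0 in M1.
  by rewrite gtrN// -!EFinB -EFinM; congr EFin; ring.
by rewrite M1 oppr0 ltxx mule0 expr0n mulr0.
Qed.

Lemma ev_bounded P (M : R) : exists2 B : R, 0 <= B & forall x, box M x -> `|ev P x| <= B.
Proof.
have [M0|M0] := leP 0 M; last first.
  exists 0 => // x /boxP[h _]; exfalso.
  by have := le_lt_trans (le_trans (normr_ge0 _) h) M0; rewrite ltxx.
elim/poly_ind: P => [|P q [B B0 hB]]; first by exists 0 => // x _; rewrite ev0 normr0.
have [C C0 hC] : exists2 C : R, 0 <= C & forall t, `|t| <= M -> `|q.[t]| <= C.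
  elim/poly_ind: q => [|q c [C C0 hC]]; first by exists 0 => // t _; rewrite horner0 normr0.
  exists (C * M + `|c|); first by rewrite addr_ge0 ?mulr_ge0.
  move=> t tM; rewrite hornerMXaddC (le_trans (ler_normD _ _))// lerD2r normrM.
  by rewrite ler_pM// hC.
exists (B * M + C); first by rewrite addr_ge0 ?mulr_ge0.
move=> x bx; have /boxP[h1 h2] := bx.
rewrite evMXaddC (le_trans (ler_normD _ _))// lerD ?hC// normrM ler_pM// hB//.
Qed.

Lemma bounded_integrable (K : set (R * R)) (g : R * R -> R) (M B : R) :
  measurable K -> K `<=` box M -> measurable_fun K g ->
  (forall x, K x -> `|g x| <= B) -> leb2.-integrable K (EFin \o g).
Proof.
move=> mK KM mg gB.
have [[x Kx]|K0] := pselect (K !=set0); last first.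
  have -> : K = set0 by apply/seteqP; split=> // x Kx; apply: K0; exists x.
  exact: integrable_set0.
have M0 : 0 <= M by have /boxP[h _] := KM _ Kx; exact: le_trans h.
apply: measurable_bounded_integrable => //.
- apply: (@le_lt_trans _ _ (leb2 (box M))).
    by apply: le_measure; rewrite ?inE//; exact: measurable_box.
  by rewrite leb2_box// ltry.
- exists B; split; first exact: num_real.
  by move=> y By z Kz; apply: le_trans (gB _ Kz) _; exact: ltW.
Qed.

Lemma ev_integrable K P (M : R) : measurable K -> K `<=` box M ->
  leb2.-integrable K (EFin \o ev P).
Proof.
move=> mK KM; have [B _ hB] := ev_bounded P M.
apply: (@bounded_integrable K (ev P) M B) => //.
  by apply: measurable_funTS; exact: measurable_ev.
by move=> x Kx; apply: hB; exact: KM.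
Qed.

(** The reference triangle; every cell is an affine image of it. *)
Definition reft : set (R * R) := [set x | [/\ 0 <= x.1, 0 <= x.2 & x.1 + x.2 <= 1]].

Lemma measurable_reft : measurable reft.
Proof.
have -> : reft = [set x | 0 <= x.1] `&` [set x | 0 <= x.2] `&` [set x | x.1 + x.2 <= 1].
  by apply/seteqP; split=> x /=; [case|case=> -[]].
apply: measurableI; first apply: measurableI.
- have -> : [set x : R * R | 0 <= x.1] = fst @^-1` `[0, +oo[%classic.
    by apply/seteqP; split=> x /=; rewrite in_itv /= andbT.
  by rewrite -[X in measurable X]setTI; apply: measurable_fst => //; exact: measurable_itv.
- have -> : [set x : R * R | 0 <= x.2] = snd @^-1` `[0, +oo[%classic.
    by apply/seteqP; split=> x /=; rewrite in_itv /= andbT.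
  by rewrite -[X in measurable X]setTI; apply: measurable_snd => //; exact: measurable_itv.
- have -> : [set x : R * R | x.1 + x.2 <= 1] = (fun x => x.1 + x.2) @^-1` `]-oo, 1]%classic.
    by apply/seteqP; split=> x /=; rewrite in_itv /=.
  rewrite -[X in measurable X]setTI.
  have : measurable_fun setT (fun x : R * R => x.1 + x.2).
    by apply: measurable_funD; [exact: measurable_fst|exact: measurable_snd].
  by apply => //; exact: measurable_itv.
Qed.

Lemma reft_box : reft `<=` box 1.
Proof.
move=> x [h1 h2 h3]; apply/boxP; rewrite !ger0_norm//; split; lra.
Qed.

Lemma reft_patch (f : R * R -> R) (s t : R) : (f \_ reft) (s, t) =
  if (0 <= s) && (0 <= t) && (s + t <= 1) then f (s, t) else 0.
Proof.
rewrite patchE; case: ifPn => [|h].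
  by rewrite inE => -[/= -> -> ->].
case: ifPn => // /andP[/andP[h1 h2] h3]; exfalso; move/negP: h; apply.
by rewrite inE.
Qed.

Lemma measurable_ev_affine2 P v e f : measurable_fun setT (ev P \o affine2 v e f).
Proof.
by apply: measurableT_comp; [exact: measurable_ev|exact: measurable_affine2].
Qed.

Lemma affine2_line_t v e f s t :
  affine2 v e f (s, t) = line (v.1 + s * e.1) f.1 (v.2 + s * e.2) f.2 t.
Proof. by rewrite /affine2 /line /=; congr pair; ring. Qed.

Lemma affine2_line_s v e f s t :
  affine2 v e f (s, t) = line (v.1 + t * f.1) e.1 (v.2 + t * f.2) e.2 s.
Proof. by rewrite /affine2 /line /=; congr pair; ring. Qed.

Definition dvec e P : {poly {poly R}} := e.1%:P%:P * dX P + e.2%:P%:P * dY P.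

Lemma affine2_bounded P v e f : exists2 B : R, 0 <= B & forall x, box 1 x ->
  `|ev P (affine2 v e f x)| <= B.
Proof.
pose M := `|v.1| + `|v.2| + `|e.1| + `|e.2| + `|f.1| + `|f.2|.
have [B B0 hB] := ev_bounded P M.
exists B => // x /boxP[x1 x2]; apply: hB; apply/boxP; rewrite /affine2 /=.
have E (a b c : R) : `|a + x.1 * b + x.2 * c| <= `|a| + `|b| + `|c|.
  rewrite (le_trans (ler_normD _ _))// lerD//; last by rewrite normrM ler_piMl.
  by rewrite (le_trans (ler_normD _ _))// lerD// normrM ler_piMl.
have := (normr_ge0 v.1, normr_ge0 v.2, normr_ge0 e.1, normr_ge0 e.2, normr_ge0 f.1, normr_ge0 f.2).
move=> [[[[[h1 h2] h3] h4] h5] h6]; rewrite /M.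
split; [have := E v.1 e.1 f.1|have := E v.2 e.2 f.2]; lra.
Qed.

Lemma integrable_on_reft P v e f : leb2.-integrable reft (EFin \o (ev P \o affine2 v e f)).
Proof.
have [B _ hB] := affine2_bounded P v e f.
apply: (@bounded_integrable _ _ 1 B); [exact: measurable_reft|exact: reft_box| |].
  by apply: measurable_funTS; exact: measurable_ev_affine2.
by move=> x rx; exact/hB/reft_box.
Qed.

Lemma integrable_reft P v e f : leb2.-integrable setT (EFin \o ((ev P \o affine2 v e f) \_ reft)).
Proof.
rewrite -restrict_EFin; apply: (@integrable_mkcond _ _ R (mu \x mu)%E reft
  (EFin \o (ev P \o affine2 v e f)) measurable_reft).1.
exact: integrable_on_reft.
Qed.

(** Fubini with inner variable t: on the slice 0 <= t <= 1 - s the derivative along [f] is a total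
    derivative in t, which leaves the hypotenuse and the leg t = 0. *)
Lemma reft_dt P v e f :
  \int[leb2]_(x in reft) ev (dvec f P) (affine2 v e f x) =
  \int[mu]_(s in `[0, 1]) (ev P (affine2 v e f (s, 1 - s)) - ev P (affine2 v e f (s, 0))).
Proof.
rewrite /Rintegral; congr fine.
rewrite integral_mkcond restrict_EFin -integral12_prod_meas1; last exact: integrable_reft.
rewrite [RHS]integral_mkcond; apply: eq_integral => s _.
rewrite /fubini_F patchE; case: ifPn => [|hs].
  rewrite inE /= in_itv /= => /andP[s0 s1].
  transitivity (\int[mu]_(t in `[0%R, (1 - s)%R]) (ev (dvec f P) (affine2 v e f (s, t)))%:E)%E.
    rewrite [RHS]integral_mkcond; apply: eq_integral => t _.
    rewrite /= reft_patch patchE s0 /=.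
    have -> : (s + t <= 1) = (t <= 1 - s) by rewrite lerBrDl.
    by rewrite mem_setE in_itv /=; case: ifP.
  under eq_integral => t _ do rewrite affine2_line_t /dvec !evE.
  by rewrite integral_derive_line ?subr_ge0// -!affine2_line_t EFinB.
rewrite [LHS]integral0_eq// => t _.
rewrite /= reft_patch; case: ifPn => // /andP[/andP[h1 h2] h3]; exfalso.
by move/negP: hs; apply; rewrite inE /= in_itv /= h1 /=; lra.
Qed.

Lemma reft_ds P v e f :
  \int[leb2]_(x in reft) ev (dvec e P) (affine2 v e f x) =
  \int[mu]_(t in `[0, 1]) (ev P (affine2 v e f (1 - t, t)) - ev P (affine2 v e f (0, t))).
Proof.
rewrite /Rintegral; congr fine.
rewrite integral_mkcond restrict_EFin -integral21_prod_meas1; last exact: integrable_reft.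
rewrite [RHS]integral_mkcond; apply: eq_integral => t _.
rewrite /fubini_G patchE; case: ifPn => [|ht].
  rewrite inE /= in_itv /= => /andP[t0 t1].
  transitivity (\int[mu]_(s in `[0%R, (1 - t)%R]) (ev (dvec e P) (affine2 v e f (s, t)))%:E)%E.
    rewrite [RHS]integral_mkcond; apply: eq_integral => s _.
    rewrite /= reft_patch patchE t0 andbT.
    have -> : (s + t <= 1) = (s <= 1 - t) by rewrite lerBrDr.
    by rewrite mem_setE in_itv /=; case: ifP.
  under eq_integral => s _ do rewrite affine2_line_s /dvec !evE.
  by rewrite integral_derive_line ?subr_ge0// -!affine2_line_s EFinB.
rewrite [LHS]integral0_eq// => s _.
rewrite /= reft_patch; case: ifPn => // /andP[/andP[h1 h2] h3]; exfalso.
by move/negP: ht; apply; rewrite inE /= in_itv /= h2 /=; lra.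
Qed.

End Triangle.

Section Barycentric.
Context {R : realType}.
Implicit Types (P Q : {poly {poly R}}) (x y z : pt R) (p : 'I_3 -> pt R) (a b : 'I_3).
Local Notation o1 := (inord 1 : 'I_3).
Local Notation o2 := (inord 2 : 'I_3).

Lemma ord3P a : [\/ a = ord0, a = o1 | a = o2].
Proof.
by case: a => [[|[|[|//]]] h]; [constructor 1|constructor 2|constructor 3];
  apply: val_inj => //=; rewrite inordK.
Qed.

Lemma sum3 (V : nmodType) (F : 'I_3 -> V) : \sum_(a < 3) F a = F ord0 + F o1 + F o2.
Proof.
rewrite !big_ord_recl big_ord0 addr0 addrA; congr (_ + F _ + F _);
  by apply: val_inj; rewrite /= inordK.
Qed.

Lemma ordS0 : ordS ord0 = o1 :> 'I_3. Proof. by apply: val_inj; rewrite /= inordK. Qed.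
Lemma ordS1 : ordS o1 = o2. Proof. by apply: val_inj; rewrite /= !inordK. Qed.
Lemma ordS2 : ordS o2 = ord0. Proof. by apply: val_inj; rewrite /= !inordK. Qed.
Lemma ord_pred0 : ord_pred ord0 = o2 :> 'I_3. Proof. by apply: val_inj; rewrite /= inordK. Qed.
Lemma ord_pred1 : ord_pred o1 = ord0. Proof. by apply: val_inj; rewrite /= !inordK. Qed.
Lemma ord_pred2 : ord_pred o2 = o1. Proof. by apply: val_inj; rewrite /= !inordK. Qed.
Definition ord3E := (ordS0, ordS1, ordS2, ord_pred0, ord_pred1, ord_pred2).

(** Twice the signed area. Its sign is the orientation of the vertex list, which a mesh leaves
    arbitrary. *)
Definition area2 p : R := det2 (p o1 - p ord0) (p o2 - p ord0).

Lemma area2_rot p a : det2 (p (ordS a) - p a) (p (ord_pred a) - p a) = area2 p.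
Proof.
by case: (ord3P a) => ->; rewrite !ord3E /area2 /det2 /=; ring.
Qed.

Lemma nondegenerateE p : Defs.nondegenerate p -> area2 p != 0.
Proof. by []. Qed.

(** Barycentric coordinate by Cramer's rule; the quotient of signed areas does not depend on the
    orientation. *)
Definition bary p a x : R := det2 (p (ordS a) - x) (p (ord_pred a) - x) / area2 p.

Lemma bary_sum p x : Defs.nondegenerate p -> \sum_a bary p a x = 1.
Proof.
move=> /nondegenerateE p0; rewrite sum3 /bary -!mulrDl !ord3E.
by rewrite -(divff p0); congr (_ / _); rewrite /area2 /det2 /=; ring.
Qed.

Lemma bary_lincomb p x : Defs.nondegenerate p -> lincomb (bary p ^~ x) p = x.
Proof.
move=> /nondegenerateE p0; case: x => x1 x2; rewrite /lincomb !sum3 /bary !ord3E.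
congr pair.
  rewrite -[RHS](mulfK p0) !(mulrAC _ (area2 p)^-1) -!mulrDl; congr (_ / _).
  by rewrite /area2 /det2 /=; ring.
rewrite -[RHS](mulfK p0) !(mulrAC _ (area2 p)^-1) -!mulrDl; congr (_ / _).
by rewrite /area2 /det2 /=; ring.
Qed.

Lemma bary_uniq p (w : 'I_3 -> R) a : Defs.nondegenerate p -> \sum_b w b = 1 ->
  bary p a (lincomb w p) = w a.
Proof.
move=> /nondegenerateE p0; rewrite sum3 => w1.
have w0 : w ord0 = 1 - w o1 - w o2 by rewrite -w1; ring.
apply: (mulIf p0); rewrite divfK //.
rewrite /lincomb !sum3 /area2 /det2.
by case: (ord3P a) => ->; rewrite !ord3E /= w0; ring.
Qed.

Lemma bary_affine p a x y (t : R) :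
  bary p a (x.1 + t * (y.1 - x.1), x.2 + t * (y.2 - x.2)) =
  bary p a x + t * (bary p a y - bary p a x).
Proof.
rewrite /bary -mulrBl mulrA -mulrDl; congr (_ / _); rewrite /det2 /=; ring.
Qed.

Lemma hullP p x : Defs.nondegenerate p -> hull p x <-> forall a, 0 <= bary p a x.
Proof.
move=> p0; split=> [[w [w0 w1 ->]] a|h]; first by rewrite bary_uniq.
by exists (bary p ^~ x); rewrite bary_sum// bary_lincomb.
Qed.

Lemma bary_vertex p a b : Defs.nondegenerate p -> bary p a (p b) = (a == b)%:R.
Proof.
move=> p0; have -> : p b = lincomb (fun c => (c == b)%:R) p.
  rewrite /lincomb; case E : (p b) => [b1 b2].
  congr pair; rewrite (bigD1 b)//= eqxx mul1r big1 ?addr0 ?E//;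
    by move=> c /negbTE ->; rewrite mul0r.
rewrite bary_uniq// (bigD1 b)//= eqxx big1 ?addr0//.
by move=> c /negbTE ->.
Qed.

Lemma continuous_bary p a : continuous (bary p a : R * R -> R).
Proof.
have -> : bary p a = ev ((((p (ordS a)).1%:P%:P - 'X%:P) * ((p (ord_pred a)).2%:P%:P - 'X) -
   ((p (ordS a)).2%:P%:P - 'X) * ((p (ord_pred a)).1%:P%:P - 'X%:P)) * (area2 p)^-1%:P%:P).
  by apply/funext => x; rewrite !evE /bary /det2.
exact: continuous_ev.
Qed.

Lemma closed_hull p : Defs.nondegenerate p -> closed (hull p).
Proof.
move=> p0; have -> : hull p = \bigcap_(a in [set: 'I_3]) (bary p a @^-1` [set t | 0 <= t]).
  apply/seteqP; split=> x; first by move=> /(hullP _ p0) h a _; exact: h.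
  by move=> h; apply/(hullP _ p0) => a; exact: h.
apply: closed_bigI => a _; apply: closed_comp; last exact: closed_ge.
by move=> x _; exact: continuous_bary.
Qed.

Lemma line_cvg x (d : R * R) : (fun t : R => (x.1 + t * d.1, x.2 + t * d.2)) @ (0 : R) --> x.
Proof.
have E (u w : R) : (u + s * w @[s --> (0:R)]) --> u.
  rewrite -[X in _ --> X]addr0 -[X in _ --> u + X](mul0r w).
  by apply: cvgD; [exact: cvg_cst|apply: cvgM; [exact: cvg_id|exact: cvg_cst]].
by case: x => x1 x2; apply: (cvg_pair (E x1 d.1) (E x2 d.2)).
Qed.

Lemma interior_hullP p x : Defs.nondegenerate p -> (hull p)° x <-> forall a, 0 < bary p a x.
Proof.
move=> p0; split=> [hx a|h]; last first.
  suff : \forall y \near x, forall a, 0 < bary p a y.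
    by apply: filterS => y Uy; apply/(hullP _ p0) => a; exact/ltW/Uy.
  apply: (@filter_forall (R * R)%type 'I_3 _ (nbhs x) (nbhs_filter x)) => a.
  have N : nbhs (bary p a x) [set t | 0 < t].
    by apply: open_nbhs_nbhs; split; [exact: open_gt|exact: h].
  exact: (@continuous_bary p a x _ N).
have ha := (hullP x p0).1 (interior_subset hx) a.
rewrite lt_neqAle ha andbT; apply/eqP => ax0.
(* Were the coordinate of vertex [a] zero at x, the points slightly beyond x on the ray from that
   vertex would lie in the hull with a negative coordinate. *)
have : nbhs (0 : R) [set t | hull p (x.1 + t * (x.1 - (p a).1), x.2 + t * (x.2 - (p a).2))].
  exact: (@line_cvg x (x - p a) _ hx).
move/nbhs_ballP => [e /= e0 he].
have := he (e / 2); rewrite /ball /= sub0r normrN gtr0_norm ?divr_gt0// => /(_ _) [].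
  by lra.
move=> w [w0 w1 wE].
have : 0 <= bary p a (lincomb w p) by rewrite bary_uniq.
have -> : lincomb w p = (x.1 + (- (e / 2)) * ((p a).1 - x.1), x.2 + (- (e / 2)) * ((p a).2 - x.2)).
  by rewrite -wE; congr pair; ring.
rewrite bary_affine bary_vertex// eqxx -ax0 subr0 mulr1 add0r; lra.
Qed.

Lemma segmentP p a x : Defs.nondegenerate p ->
  segment (p (ordS a)) (p (ord_pred a)) x <-> hull p x /\ bary p a x = 0.
Proof.
move=> p0; split=> [[t /andP[t0 t1] ->]|[/(hullP _ p0) h ax]].
  have E b : bary p b (segpt (p (ordS a)) (p (ord_pred a)) t) =
      (1 - t) * (b == ordS a)%:R + t * (b == ord_pred a)%:R.
    have -> : segpt (p (ordS a)) (p (ord_pred a)) t =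
        ((p (ordS a)).1 + t * ((p (ord_pred a)).1 - (p (ordS a)).1),
         (p (ordS a)).2 + t * ((p (ord_pred a)).2 - (p (ordS a)).2)).
      by rewrite /segpt; congr pair; ring.
    by rewrite bary_affine !bary_vertex//; ring.
  split.
    by apply/(hullP _ p0) => b; rewrite E addr_ge0// mulr_ge0 ?ler0n// subr_ge0.
  by rewrite E; case: (ord3P a) => ->; rewrite !ord3E -!val_eqE /= ?inordK//= !mulr0 addr0.
have := bary_sum x p0; have := bary_lincomb x p0.
rewrite /lincomb !sum3 => E S.
exists (bary p (ord_pred a) x).
  rewrite h /=; move: ax (h ord0) (h o1) (h o2) S.
  by case: (ord3P a) => ->; rewrite !ord3E => *; lra.
rewrite -[LHS]E /segpt; case: (ord3P a) ax S => ->; rewrite !ord3E => A S.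
- have -> : bary p o1 x = 1 - bary p o2 x by lra.
  by rewrite A; congr pair; ring.
- have -> : bary p o2 x = 1 - bary p ord0 x by lra.
  by rewrite A; congr pair; ring.
- have -> : bary p ord0 x = 1 - bary p o1 x by lra.
  by rewrite A; congr pair; ring.
Qed.

Definition centroid p := lincomb (fun=> 3^-1) p.

Lemma bary_centroid p a : Defs.nondegenerate p -> bary p a (centroid p) = 3^-1.
Proof. by move=> p0; rewrite bary_uniq// sum3; field. Qed.

(** An arbitrarily small step towards the centroid makes all barycentric coordinates positive. *)
Lemma closure_interior_hull p x : Defs.nondegenerate p -> hull p x -> closure (hull p)° x.
Proof.
move=> p0 /(hullP _ p0) hx U Ux.
have := @line_cvg x (centroid p - x) _ Ux; move/nbhs_ballP => [e /= e0 he].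
pose t := Num.min (e / 2) 2^-1.
have t0 : 0 < t by rewrite lt_min divr_gt0//= invr_gt0.
have t1 : t <= 2^-1 by rewrite ge_min lexx orbT.
have te : t < e by rewrite gt_min; apply/orP; left; lra.
exists (x.1 + t * ((centroid p).1 - x.1), x.2 + t * ((centroid p).2 - x.2)); split.
  apply/(interior_hullP _ p0) => a; rewrite bary_affine bary_centroid//.
  have := hx a; have : t * bary p a x <= 2^-1 * bary p a x by rewrite ler_wpM2r.
  nra.
by apply: he; rewrite /ball /= sub0r normrN gtr0_norm.
Qed.

End Barycentric.

(** * The divergence theorem on a triangle *)

Section TriangleIntegrals.
Context {R : realType}.
Implicit Types (P Q : {poly {poly R}}) (x y z : pt R) (p : 'I_3 -> pt R) (a b : 'I_3).
Local Notation mu := (@lebesgue_measure R).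
Local Notation o1 := (inord 1 : 'I_3).
Local Notation o2 := (inord 2 : 'I_3).

Lemma hull_affine2 p z : Defs.nondegenerate p ->
  hull p (affine2 (p ord0) (p o1 - p ord0) (p o2 - p ord0) z) <-> reft z.
Proof.
move=> p0; pose w a := if a == ord0 then 1 - z.1 - z.2 else if a == o1 then z.1 else z.2.
have e10 : (o1 == ord0 :> 'I_3) = false by rewrite -val_eqE /= inordK.
have e20 : (o2 == ord0 :> 'I_3) = false by rewrite -val_eqE /= inordK.
have e21 : (o2 == o1 :> 'I_3) = false by rewrite -val_eqE /= !inordK.
have w0 : w ord0 = 1 - z.1 - z.2 by rewrite /w eqxx.
have w1 : w o1 = z.1 by rewrite /w e10 eqxx.
have w2 : w o2 = z.2 by rewrite /w e20 e21.
have sw : \sum_a w a = 1 by rewrite sum3 w0 w1 w2; ring.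
have -> : affine2 (p ord0) (p o1 - p ord0) (p o2 - p ord0) z = lincomb w p.
  by rewrite /lincomb !sum3 w0 w1 w2 /affine2 /=; congr pair; ring.
split=> [/(hullP _ p0) h|[h1 h2 h3]].
  have := h ord0; have := h o1; have := h o2; rewrite !bary_uniq// w0 w1 w2.
  by split=> //; lra.
apply/(hullP _ p0) => a; rewrite bary_uniq//.
by case: (ord3P a) => ->; rewrite ?w0 ?w1 ?w2//; lra.
Qed.

Lemma measurable_bary p a : measurable_fun setT (bary p a : R * R -> R).
Proof.
have -> : bary p a = ev ((((p (ordS a)).1%:P%:P - 'X%:P) * ((p (ord_pred a)).2%:P%:P - 'X) -
   ((p (ordS a)).2%:P%:P - 'X) * ((p (ord_pred a)).1%:P%:P - 'X%:P)) * (area2 p)^-1%:P%:P).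
  by apply/funext => x; rewrite !evE /bary /det2.
exact: measurable_ev.
Qed.

Lemma measurable_bary_ge0 p a : measurable [set x : R * R | 0 <= bary p a x].
Proof.
have -> : [set x : R * R | 0 <= bary p a x] = bary p a @^-1` `[0, +oo[%classic.
  by apply/seteqP; split=> x /=; rewrite in_itv /= andbT.
by rewrite -[X in measurable X]setTI; apply: measurable_bary => //; exact: measurable_itv.
Qed.

Lemma measurable_bary_gt0 p a : measurable [set x : R * R | 0 < bary p a x].
Proof.
have -> : [set x : R * R | 0 < bary p a x] = bary p a @^-1` `]0, +oo[%classic.
  by apply/seteqP; split=> x /=; rewrite in_itv /= andbT.
by rewrite -[X in measurable X]setTI; apply: measurable_bary => //; exact: measurable_itv.
Qed.

Lemma measurable_hull p : Defs.nondegenerate p -> measurable (hull p).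
Proof.
move=> p0; have -> : hull p = [set x | 0 <= bary p ord0 x] `&` [set x | 0 <= bary p o1 x]
    `&` [set x | 0 <= bary p o2 x].
  apply/seteqP; split=> x; first by move=> /(hullP _ p0) h; split; [split|]; exact: h.
  by move=> [[h0 h1] h2]; apply/(hullP _ p0) => a; case: (ord3P a) => ->.
by apply: measurableI; first apply: measurableI; exact: measurable_bary_ge0.
Qed.

Lemma measurable_interior_hull p : Defs.nondegenerate p -> measurable (hull p)°.
Proof.
move=> p0; have -> : (hull p)° = [set x | 0 < bary p ord0 x] `&` [set x | 0 < bary p o1 x]
    `&` [set x | 0 < bary p o2 x].
  apply/seteqP; split=> x; first by move=> /(interior_hullP _ p0) h; split; [split|]; exact: h.
  by move=> [[h0 h1] h2]; apply/(interior_hullP _ p0) => a; case: (ord3P a) => ->.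
by apply: measurableI; first apply: measurableI; exact: measurable_bary_gt0.
Qed.

Lemma hull_box n (p : 'I_n -> pt R) :
  hull p `<=` box (\sum_i (`|(p i).1| + `|(p i).2|)).
Proof.
move=> x [w [w0 w1 ->]]; apply/boxP; rewrite /lincomb /=.
have E i : w i <= 1 by rewrite -w1 (bigD1 i)//= lerDl sumr_ge0.
split; rewrite (le_trans (ler_norm_sum _ _ _))//; apply: ler_sum => i _;
  rewrite normrM (ger0_norm (w0 i)).
  by rewrite (le_trans (y := `|(p i).1|)) ?ler_piMl// lerDl.
by rewrite (le_trans (y := `|(p i).2|)) ?ler_piMl// lerDr.
Qed.

Lemma integral_hull P p : Defs.nondegenerate p ->
  \int[leb2]_(x in hull p) ev P x = `|area2 p| *
  \int[leb2]_(x in reft) ev P (affine2 (p ord0) (p o1 - p ord0) (p o2 - p ord0) x).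
Proof.
move=> p0; have J0 : area2 p != 0 by exact: nondegenerateE.
set aff := affine2 _ _ _.
rewrite /Rintegral integral_mkcond restrict_EFin.
have mg : measurable_fun setT (EFin \o (ev P \_ (hull p))).
  have m1 : measurable_fun (hull p) (ev P) by apply: measurable_funTS; exact: measurable_ev.
  exact/measurable_EFinP/(measurable_restrictT _ (measurable_hull p0)).
rewrite (integral_affine2 (p ord0) J0 mg) -/aff.
have E x : (EFin \o (ev P \_ (hull p))) (aff x) = (EFin \o ((ev P \o aff) \_ reft)) x.
  rewrite /= !patchE; congr EFin; have [h|h] := pselect (reft x).
    by rewrite !mem_set//; exact/(hull_affine2 x p0).
  by rewrite !memNset// => /(hull_affine2 x p0).
have EI : (\int[leb2]_x (EFin \o (ev P \_ (hull p))) (aff x) =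
    \int[leb2]_x (EFin \o ((ev P \o aff) \_ reft)) x)%E.
  by apply: eq_integral => x _; exact: E.
rewrite EI -restrict_EFin -integral_mkcond fineM//.
apply: integrable_fin_num; first exact: measurable_reft.
exact: integrable_on_reft.
Qed.

(** The mean over the segment: the edge length is carried by the unnormalised normal in [nupoly],
    not by this integral. *)
Definition eint x y P : R := \int[mu]_(t in `[0, 1]) ev P (segpt x y t).

Lemma segpt_line x y t : segpt x y t = line x.1 (y.1 - x.1) x.2 (y.2 - x.2) t.
Proof. by rewrite /segpt /line; congr pair; ring. Qed.

Lemma continuous_ev_segpt P x y : continuous (fun t => ev P (segpt x y t)).
Proof.
by under eq_fun do rewrite segpt_line; exact: continuous_ev_line.
Qed.

Lemma integrable_ev_segpt P x y : mu.-integrable `[0, 1] (EFin \o (fun t => ev P (segpt x y t))).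
Proof.
apply: continuous_compact_integrable; first exact: segment_compact.
by apply: continuous_subspaceT; exact: continuous_ev_segpt.
Qed.

Lemma eintD x y P Q : eint x y (P + Q) = eint x y P + eint x y Q.
Proof.
rewrite /eint -RintegralD//; try exact: integrable_ev_segpt.
by apply: eq_Rintegral => t _; rewrite evD.
Qed.

Lemma eintZ x y c P : eint x y (c%:P%:P * P) = c * eint x y P.
Proof.
rewrite /eint -RintegralZl//; last exact: integrable_ev_segpt.
by apply: eq_Rintegral => t _; rewrite evM evC.
Qed.

Lemma eintN x y P : eint x y (- P) = - eint x y P.
Proof. by rewrite -mulN1r -[-1 in LHS]/(- 1) -!polyC1 -!polyCN eintZ mulN1r. Qed.

Lemma eint_rev x y P : eint x y P = eint y x P.
Proof.
rewrite /eint (@Rintegration_by_substitution_onem _ _ 1) ?lexx ?ler01//; last first.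
  by apply: continuous_subspaceT; exact: continuous_ev_segpt.
rewrite /unstable.onem subrr; apply: eq_Rintegral => t _; congr ev.
by rewrite /segpt; congr pair; ring.
Qed.

Lemma eint_le x y P (B : R) : (forall t, 0 <= t <= 1 -> `|ev P (segpt x y t)| <= B) ->
  `|eint x y P| <= B.
Proof.
move=> h; apply: (le_trans (le_normr_Rintegral _ _)) => //.
  exact: integrable_ev_segpt.
apply: (@le_trans _ _ (\int[mu]_(t in `[0, 1]) cst B t)).
  apply: le_Rintegral => //.
  - by apply: integrable_norm; exact: integrable_ev_segpt.
  - apply: continuous_compact_integrable; first exact: segment_compact.
    by apply: continuous_subspaceT => t; exact: cvg_cst.
rewrite Rintegral_cst// /= lebesgue_measure_itv /= lte_fin ltr01 oppr0 adde0 /=.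
by rewrite mulr1.
Qed.

Lemma eint_eq x y P Q : (forall t, 0 <= t <= 1 -> ev P (segpt x y t) = ev Q (segpt x y t)) ->
  eint x y P = eint x y Q.
Proof.
by move=> h; apply: eq_Rintegral => t; rewrite inE /= in_itv /=; exact: h.
Qed.

(* On the edge from x to y of a counterclockwise triangle this is the edge length
   times the outward normal component of the field (P, Q). *)
Definition nupoly x y P Q : {poly {poly R}} :=
  (y.2 - x.2)%:P%:P * P + (x.1 - y.1)%:P%:P * Q.

(** The Piola transform: the adjugate of the affine map applied to (P, Q) has as reference
    divergence the determinant times the original divergence. *)
Lemma dvec_piola (e f : R * R) P Q :
  dvec e (f.2%:P%:P * P - f.1%:P%:P * Q) + dvec f (e.1%:P%:P * Q - e.2%:P%:P * P) =
  (det2 e f)%:P%:P * (dX P + dY Q).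
Proof.
rewrite /dvec !dXB !dYB !dXM !dYM !dXC !dYC !derivC /det2.
by rewrite !polyCB !polyCM ?polyC0; ring.
Qed.

(** The Piola transform reduces this to [reft_ds] and [reft_dt] on the reference triangle. The
    normal in [nupoly] is outward only for counterclockwise vertices, and the sign of [area2]
    corrects this. *)
Lemma divergence_triangle p P Q : Defs.nondegenerate p ->
  \int[leb2]_(x in hull p) ev (dX P + dY Q) x =
  Num.sg (area2 p) * \sum_a eint (p (ordS a)) (p (ord_pred a))
     (nupoly (p (ordS a)) (p (ord_pred a)) P Q).
Proof.
move=> p0; have J0 : area2 p != 0 by exact: nondegenerateE.
rewrite integral_hull//.
set e := p o1 - p ord0; set f := p o2 - p ord0; set A := affine2 _ e f.
pose S : {poly {poly R}} := f.2%:P%:P * P - f.1%:P%:P * Q.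
pose T : {poly {poly R}} := e.1%:P%:P * Q - e.2%:P%:P * P.
have D : dvec e S + dvec f T = (area2 p)%:P%:P * (dX P + dY Q).
  exact: dvec_piola.
have iA U : leb2.-integrable reft (EFin \o (fun x => ev U (A x))) by exact: integrable_on_reft.
have E : area2 p * \int[leb2]_(x in reft) ev (dX P + dY Q) (A x) =
    eint (p o1) (p o2) S - eint (p ord0) (p o2) S +
    (eint (p o2) (p o1) T - eint (p ord0) (p o1) T).
  rewrite -RintegralZl; [|exact: measurable_reft|exact: iA].
  transitivity (\int[leb2]_(x in reft) (ev (dvec e S) (A x) + ev (dvec f T) (A x))).
    by apply: eq_Rintegral => x _; rewrite -evD D evM evC.
  rewrite RintegralD; [|exact: measurable_reft|exact: iA|exact: iA].
  rewrite reft_ds reft_dt /eint; congr (_ + _).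
    rewrite -RintegralB//; [|exact: integrable_ev_segpt|exact: integrable_ev_segpt].
    apply: eq_Rintegral => t _; congr (ev _ _ - ev _ _).
      by rewrite /affine2 /segpt /e /f /=; congr pair; ring.
    by rewrite /affine2 /segpt /e /f /=; congr pair; ring.
  rewrite -RintegralB//; [|exact: integrable_ev_segpt|exact: integrable_ev_segpt].
  apply: eq_Rintegral => t _; congr (ev _ _ - ev _ _).
    by rewrite /affine2 /segpt /e /f /=; congr pair; ring.
  by rewrite /affine2 /segpt /e /f /=; congr pair; ring.
rewrite normrEsg -mulrA E; congr (_ * _).
rewrite sum3 !ord3E.
have -> : nupoly (p o1) (p o2) P Q = S + T.
  by rewrite /nupoly /S /T /e /f /= !polyCB; ring.
have -> : nupoly (p o2) (p ord0) P Q = - S.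
  by rewrite /nupoly /S /T /e /f /= !polyCB; ring.
have -> : nupoly (p ord0) (p o1) P Q = - T.
  by rewrite /nupoly /S /T /e /f /= !polyCB; ring.
rewrite eintD !eintN (eint_rev (p o2) (p ord0)) (eint_rev (p o2) (p o1)); ring.
Qed.

End TriangleIntegrals.

(** * Interior edges *)

Section MeshGeometry.
Context {R : realType} (Omega : set (pt R)) (T : mesh R).
Context (hT : conforming_triangulation Omega T).
Implicit Types (x y : pt R) (i j : 'I_(ntri T)) (a b : 'I_3).

Lemma cell_nondegenerate i : Defs.nondegenerate (vtx i).
Proof. by have [] := hT. Qed.
Hint Resolve cell_nondegenerate : core.

Lemma ordS_neq a : (ordS a == a) = false.
Proof. by case: (ord3P a) => ->; rewrite ?ord3E -val_eqE /= ?inordK. Qed.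
Lemma ord_pred_neq a : (ord_pred a == a) = false.
Proof. by case: (ord3P a) => ->; rewrite ?ord3E -val_eqE /= ?inordK. Qed.
Lemma ordS_pred_neq a : (ordS a == ord_pred a) = false.
Proof. by case: (ord3P a) => ->; rewrite ?ord3E -val_eqE /= ?inordK. Qed.
Lemma ord3_cases a b : [\/ b = a, b = ordS a | b = ord_pred a].
Proof.
by case: (ord3P a) => ->; case: (ord3P b) => ->; rewrite ?ord3E;
  (constructor 1; reflexivity) || (constructor 2; reflexivity) || (constructor 3; reflexivity).
Qed.

(** At an interior point of cell i all barycentric coordinates are positive, whereas on a common
    vertex or a common edge one of them vanishes. *)
Lemma cell_interior_disjoint i j x : i != j -> (cell i)° x -> ~ cell j x.
Proof.
move=> ij /interior_hullP hx cjx; have cix : cell i x.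
  by apply/hullP => // a; apply/ltW/hx.
have [_ _ /(_ i j ij)] := hT; case=> [E|[a [b [_ E]]]|[a [b [_ E]]]].
- by have : set0 x by rewrite -E.
- have : [set vtx i a] x by rewrite -E.
  move=> /= xE; have := hx (cell_nondegenerate i) (ordS a).
  by rewrite xE bary_vertex// ordS_neq ltxx.
- have : edge i a x by rewrite -E.
  move/segmentP => /(_ (cell_nondegenerate i)) [_ E0].
  by have := hx (cell_nondegenerate i) a; rewrite E0 ltxx.
Qed.

(** [s] tells whether both cells run through the common edge in the same direction; without a
    consistent orientation of the cells either may happen. *)
Definition oriented (s : bool) i a j b := if s then
  edge_src i a = edge_src j b /\ edge_tgt i a = edge_tgt j b else
  edge_src i a = edge_tgt j b /\ edge_tgt i a = edge_src j b.

Lemma same_edgeP i a j b : same_edge i a j b -> exists s, oriented s i a j b.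
Proof.
by move=> /orP[] /andP[/eqP h1 /eqP h2]; [exists true|exists false].
Qed.

Lemma oriented_same s i a j b : oriented s i a j b -> same_edge i a j b.
Proof. by rewrite /same_edge; case: s => /= -[-> ->]; rewrite !eqxx ?orbT. Qed.

Lemma oriented_sym s i a j b : oriented s i a j b -> oriented s j b i a.
Proof. by case: s => /= -[-> ->]. Qed.

Lemma same_edge_sym i a j b : same_edge i a j b = same_edge j b i a.
Proof.
by apply/idP/idP => /same_edgeP [s /oriented_sym /oriented_same].
Qed.

Lemma oriented_trans s t i a j b i' a' : oriented s i a j b -> oriented t j b i' a' ->
  oriented (s == t) i a i' a'.
Proof. by case: s; case: t => /= -[-> ->] [-> ->]. Qed.

Definition edge_det i a x := det2 (edge_tgt i a - edge_src i a) (x - edge_src i a).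

Lemma edge_detE i a x : edge_det i a x = area2 (vtx i) * bary (vtx i) a x.
Proof.
rewrite /bary mulrCA mulfV ?mulr1; last exact: nondegenerateE.
by rewrite /edge_det /edge_tgt /edge_src /det2 /=; ring.
Qed.

Lemma oriented_edge_det s i a j b x : oriented s i a j b ->
  edge_det j b x = (if s then 1 else -1) * edge_det i a x.
Proof. by rewrite /edge_det; case: s => /= -[-> ->]; rewrite /det2 /=; ring. Qed.

Lemma midpoint_bary i a (t : R) c :
  bary (vtx i) c (segpt (edge_src i a) (edge_tgt i a) t) =
  (1 - t) * (c == ordS a)%:R + t * (c == ord_pred a)%:R.
Proof.
have -> : segpt (edge_src i a) (edge_tgt i a) t =
    ((edge_src i a).1 + t * ((edge_tgt i a).1 - (edge_src i a).1),
     (edge_src i a).2 + t * ((edge_tgt i a).2 - (edge_src i a).2)).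
  by rewrite /segpt; congr pair; ring.
by rewrite bary_affine !bary_vertex//; ring.
Qed.

(** Two cells with a common edge lie on opposite sides of it, expressed through the signs of their
    areas. On the same side their interiors would overlap near the midpoint of the edge. *)
Lemma opposite_sides s i a j b : i != j -> oriented s i a j b ->
  (if s then 1 else -1) * (area2 (vtx i) * area2 (vtx j)) < 0.
Proof.
move=> ij o; pose k : R := if s then 1 else -1; rewrite -/k.
have Ji := nondegenerateE (cell_nondegenerate i).
have Jj := nondegenerateE (cell_nondegenerate j).
have kk : k * k = 1 by rewrite /k; case: (s); ring.
have k0 : k != 0 by apply/eqP => k0; move: kk; rewrite k0 mul0r => /esym/eqP; rewrite oner_eq0.
rewrite lt_neqAle; apply/andP; split; first by rewrite !mulf_neq0.
rewrite leNgt; apply/negP => pos.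
have E x : bary (vtx j) b x = k * area2 (vtx i) / area2 (vtx j) * bary (vtx i) a x.
  have := oriented_edge_det x o; rewrite !edge_detE -/k => /(congr1 (fun z => z / area2 (vtx j))).
  by rewrite mulrC mulKf// => ->; ring.
have kpos : 0 < k * area2 (vtx i) / area2 (vtx j).
  have -> : k * area2 (vtx i) / area2 (vtx j) = k * (area2 (vtx i) * area2 (vtx j)) / area2 (vtx j) ^+ 2.
    by field.
  by rewrite divr_gt0// exprn_even_gt0.
(* A point slightly inside cell i, close to the midpoint of the edge, is also in cell j. *)
pose m := segpt (edge_src i a) (edge_tgt i a) 2^-1.
have mi c : bary (vtx i) c m = 2^-1 * (c != a)%:R.
  rewrite midpoint_bary; case: (ord3_cases a c) => ->.
  - by rewrite eqxx !(eq_sym a) ordS_neq ord_pred_neq /= !mulr0 addr0.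
  - by rewrite eqxx ordS_pred_neq ordS_neq /= mulr0 addr0 !mulr1; field.
  - by rewrite eqxx (eq_sym (ord_pred a)) ordS_pred_neq ord_pred_neq /= mulr0 add0r.
have mj c : bary (vtx j) c m = 2^-1 * (c != b)%:R.
  have -> : m = segpt (edge_src j b) (edge_tgt j b) 2^-1.
    by rewrite /m; case: (s) o => /= -[-> ->] //; rewrite /segpt; congr pair; field.
  rewrite midpoint_bary; case: (ord3_cases b c) => ->.
  - by rewrite eqxx !(eq_sym b) ordS_neq ord_pred_neq /= !mulr0 addr0.
  - by rewrite eqxx ordS_pred_neq ordS_neq /= mulr0 addr0 !mulr1; field.
  - by rewrite eqxx (eq_sym (ord_pred b)) ordS_pred_neq ord_pred_neq /= mulr0 add0r.
pose r := vtx i a.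
(* [B] dominates the coordinates in cell j of the vertex [r] of cell i. Moving by t = 1/(4B) towards
   [r] keeps the coordinates that equal 1/2 at the midpoint positive. *)
pose B := 1 + \sum_c `|bary (vtx j) c r|.
have Bp c : `|bary (vtx j) c r| <= B.
  by rewrite /B (bigD1 c)//= addrCA lerDl addr_ge0// sumr_ge0.
have B1 : 1 <= B by rewrite /B lerDl sumr_ge0.
pose t := 4^-1 / B.
have t0 : 0 < t by rewrite divr_gt0// ?(lt_le_trans _ B1).
have tB : t * B = 4^-1 by rewrite divfK// gt_eqF// (lt_le_trans _ B1).
have t1 : t <= 4^-1 by nra.
pose y : pt R := (m.1 + t * (r.1 - m.1), m.2 + t * (r.2 - m.2)).
apply: (@cell_interior_disjoint i j y ij).
  apply/interior_hullP => // c; rewrite bary_affine mi bary_vertex//.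
  by case: eqP => _ /=; lra.
apply/hullP => // c; rewrite bary_affine mj.
have [->|cb] := eqVneq c b; rewrite ?eqxx /=.
  by rewrite E bary_vertex// eqxx mulr0 add0r subr0 mulr1 mulr_ge0 ?ltW.
have := Bp c; rewrite ler_norml => /andP[b1 b2].
have := ler_wpM2l (ltW t0) b1; rewrite mulrN tB mulr1; lra.
Qed.

(** With three cells at one edge, two would lie on the same side of it. Inside one cell, an edge is
    determined by its endpoints because the vertices are distinct. *)
Lemma partner_unique i a j b j' b' : i != j -> i != j' ->
  same_edge i a j b -> same_edge i a j' b' -> j = j' /\ b = b'.
Proof.
move=> ij ij' /same_edgeP [s o] /same_edgeP [t o'].
have o2 := oriented_trans (oriented_sym o) o'.
have [jj'|jj'] := eqVneq j j'; last first.
  exfalso; have := opposite_sides ij o; have := opposite_sides ij' o'.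
  have := opposite_sides jj' o2.
  by case: s {o o2} => /=; case: t {o'} => /=; nra.
subst j'; split=> //; apply/eqP/negP => /negP bb.
have V c : c != b -> vtx j c = edge_src j b \/ vtx j c = edge_tgt j b.
  by case: (ord3_cases b c) => ->; rewrite ?eqxx; [|left|right].
have V' c : vtx j c = edge_src j b' \/ vtx j c = edge_tgt j b' -> c != b'.
  move=> h; apply/eqP => cb'.
  have : bary (vtx j) b' (vtx j c) = 0.
    by case: h => ->; rewrite bary_vertex//  (eq_sym b') ?ordS_neq ?ord_pred_neq.
  by rewrite cb' bary_vertex// eqxx => /eqP; rewrite oner_eq0.
have : b' != b' by apply: V'; have := V b'; rewrite eq_sym bb => /(_ isT); case: (s == t) o2 => /= -[-> ->] [->|->]; auto.
by rewrite eqxx.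
Qed.

Lemma edge_bary i a x (t : R) : 0 < t < 1 -> x = segpt (edge_src i a) (edge_tgt i a) t ->
  bary (vtx i) a x = 0 /\ forall c, c != a -> 0 < bary (vtx i) c x.
Proof.
move=> /andP[t0 t1] ->; split.
  by rewrite midpoint_bary !(eq_sym a) ordS_neq ord_pred_neq /= !mulr0 addr0.
move=> c ca; rewrite midpoint_bary; case: (ord3_cases a c) ca => ->; rewrite ?eqxx// => _.
  by rewrite ordS_pred_neq /= mulr0 addr0 mulr1 subr_gt0.
by rewrite (eq_sym (ord_pred a)) ordS_pred_neq /= mulr0 add0r mulr1.
Qed.

(** Such a point lies in no other cell, so near it the closure of the domain coincides with cell i,
    and crossing the edge leaves it. *)
Lemma boundary_edge_interior i a (t : R) :
  (forall j b, i != j -> ~~ same_edge i a j b) -> 0 < t < 1 ->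
  bdry Omega (segpt (edge_src i a) (edge_tgt i a) t).
Proof.
move=> alone ht; set x := segpt _ _ _.
have [x0 xp] := edge_bary ht (erefl x).
have [_ cover conf] := hT.
have cix : cell i x.
  apply/hullP => // c; have [->|/xp /ltW //] := eqVneq c a.
  by rewrite x0.
have clx : closure Omega x by rewrite cover; exists i.
split=> // Ox.
have hx : nbhs x (closure Omega).
  by apply: filterS Ox; exact: subset_closure.
have other j : i != j -> ~ cell j x.
  move=> ij cjx; have [E|[a' [b [_ E]]]|[a' [b [same E]]]] := conf i j ij.
  - by have : set0 x by rewrite -E.
  - have : [set vtx i a'] x by rewrite -E.
    (* At the vertex [a'] the coordinate of an index [d] different from both vanishes, while on the
       open edge every coordinate except that of [a] is positive. *)
    move=> /= xE; have [d [da da']] : exists d, d != a /\ d != a'.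
      by case: (ord3P a) => ->; case: (ord3P a') => ->;
        ((exists (ord0 : 'I_3); by rewrite -!val_eqE /= ?inordK) ||
        (exists (inord 1 : 'I_3); by rewrite -!val_eqE /= ?inordK) ||
        (exists (inord 2 : 'I_3); by rewrite -!val_eqE /= ?inordK)).
    by have := xp d da; rewrite xE bary_vertex// (negbTE da') ltxx.
  - have : edge i a' x by rewrite -E.
    move/segmentP => /(_ (cell_nondegenerate i)) [_ E0].
    have [aa|aa] := eqVneq a' a; last by have := xp _ aa; rewrite E0 ltxx.
    by have := alone j b ij; rewrite -aa same.
have N j : i != j -> nbhs x (~` cell j).
  move=> ij; apply: open_nbhs_nbhs; split; last exact: other.
  by apply: closed_openC; exact: closed_hull.
have : nbhs x (fun y => closure Omega y /\ forall j, i != j -> ~ cell j y).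
  apply: filterI => //.
  apply: (@filter_forall (R * R)%type _ (fun j y => i != j -> ~ cell j y) (nbhs x) (nbhs_filter x)) => j.
  have [ij|ij] := boolP (i == j).
    by apply: filterS (filterT : nbhs x setT) => y _.
  by apply: filterS (N j ij) => y cy _.
move=> /(@line_cvg _ x (x - vtx i a)) /nbhs_ballP [e /= e0 he].
have [|y1 y2] := he (e / 2); first by rewrite /ball /= sub0r normrN gtr0_norm ?divr_gt0//; lra.
move: y1; rewrite cover => -[j _]; have [<-|ij] := eqVneq i j; last exact: y2.
move/hullP => /(_ (cell_nondegenerate i) a).
have -> : (x.1 + e / 2 * (x - vtx i a).1, x.2 + e / 2 * (x - vtx i a).2) =
    (x.1 + (- (e / 2)) * ((vtx i a).1 - x.1), x.2 + (- (e / 2)) * ((vtx i a).2 - x.2)).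
  by congr pair; rewrite /=; ring.
rewrite bary_affine bary_vertex// eqxx x0 subr0 mulr1 add0r; lra.
Qed.

(** The endpoints follow from the open edge: the interior of the domain is open, so an endpoint in
    it would bring nearby points of the open edge with it. The parameter [s] is shifted towards the
    middle to stay strictly between 0 and 1. *)
Lemma boundary_edge i a (t : R) :
  (forall j b, i != j -> ~~ same_edge i a j b) -> 0 <= t <= 1 ->
  bdry Omega (segpt (edge_src i a) (edge_tgt i a) t).
Proof.
move=> alone t01; have [_ cover _] := hT.
have clx : closure Omega (segpt (edge_src i a) (edge_tgt i a) t).
  rewrite cover; exists i => //.
  suff [] : hull (vtx i) (segpt (edge_src i a) (edge_tgt i a) t) /\
     bary (vtx i) a (segpt (edge_src i a) (edge_tgt i a) t) = 0 by [].
  by apply/segmentP => //; exists t.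
split=> // Ox.
have : nbhs t (fun s => Omega° (segpt (edge_src i a) (edge_tgt i a) s)).
  have O2 : nbhs (segpt (edge_src i a) (edge_tgt i a) t) Omega°.
    by apply: open_nbhs_nbhs; split => //; exact: open_interior.
  rewrite segpt_line in O2; have O3 := @continuous_line R _ _ _ _ t _ O2.
  have := @filterS R (nbhs t) (nbhs_filter t) _ (fun s => Omega° (segpt (edge_src i a) (edge_tgt i a) s)) _ O3.
  by apply => s; rewrite /= -segpt_line.
move=> /nbhs_ballP [e /= e0 he].
pose d := Num.min (e / 2) 4^-1.
have d0 : 0 < d by rewrite lt_min divr_gt0//= invr_gt0.
have d1 : d <= 4^-1 by rewrite ge_min lexx orbT.
have de : d < e by rewrite gt_min; apply/orP; left; lra.
move/andP: t01 => [t0 t1].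
pose s := if t <= 2^-1 then t + d else t - d.
have s01 : 0 < s < 1 by rewrite /s; case: ifPn; rewrite -?ltNge => ?; apply/andP; split; lra.
have sO : Omega° (segpt (edge_src i a) (edge_tgt i a) s).
  apply: he; rewrite /ball /= /s; case: ifPn => _.
    by rewrite opprD addNKr normrN gtr0_norm.
  by rewrite opprB addrC subrK gtr0_norm.
by have [_] := boundary_edge_interior alone s01.
Qed.

End MeshGeometry.

(** * Regrouping cell contributions by interior edges *)

Section EdgeSums.
Context {R : realType} (Omega : set (pt R)) (T : mesh R).
Context (hT : conforming_triangulation Omega T).
Implicit Types (x y : pt R) (i j : 'I_(ntri T)) (a b : 'I_3) (P Q : {poly {poly R}}).

Definition shared i a := [exists j, exists b, (i != j) && same_edge i a j b].

Lemma sharedP i a : reflect (exists j b, i != j /\ same_edge i a j b) (shared i a).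
Proof.
apply: (iffP existsP) => [[j /existsP[b /andP[ij s]]]|[j [b [ij s]]]].
  by exists j, b.
by exists j; apply/existsP; exists b; rewrite ij.
Qed.

Lemma not_shared i a : ~~ shared i a -> forall j b, i != j -> ~~ same_edge i a j b.
Proof. by move=> /sharedP h j b ij; apply/negP => s; apply: h; exists j, b. Qed.

Definition sum_edges (F : 'I_(ntri T) -> 'I_3 -> 'I_(ntri T) -> 'I_3 -> R) : R :=
  \sum_(i < ntri T) \sum_(j < ntri T | (i < j)%N) \sum_a \sum_(b | same_edge i a j b) F i a j b.

Lemma eq_sum_edges F G : (forall i a j b, i != j -> same_edge i a j b -> F i a j b = G i a j b) ->
  sum_edges F = sum_edges G.
Proof.
move=> h; apply: eq_bigr => i _; apply: eq_bigr => j ij; apply: eq_bigr => a _.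
apply: eq_bigr => b s; apply: h => //.
by apply/eqP => ij'; rewrite ij' ltnn in ij.
Qed.

Lemma le_sum_edges F G : (forall i a j b, i != j -> same_edge i a j b -> F i a j b <= G i a j b) ->
  sum_edges F <= sum_edges G.
Proof.
move=> h; apply: ler_sum => i _; apply: ler_sum => j ij; apply: ler_sum => a _.
apply: ler_sum => b s; apply: h => //.
by apply/eqP => ij'; rewrite ij' ltnn in ij.
Qed.

Lemma sum_edgesD F G : sum_edges (fun i a j b => F i a j b + G i a j b) = sum_edges F + sum_edges G.
Proof.
rewrite /sum_edges -big_split; apply: eq_bigr => i _; rewrite -big_split; apply: eq_bigr => j _.
rewrite -big_split; apply: eq_bigr => a _; rewrite -big_split; exact: eq_bigr.
Qed.

Lemma sum_edgesZ (c : R) F : sum_edges (fun i a j b => c * F i a j b) = c * sum_edges F.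
Proof.
rewrite /sum_edges mulr_sumr; apply: eq_bigr => i _; rewrite mulr_sumr; apply: eq_bigr => j _.
rewrite mulr_sumr; apply: eq_bigr => a _; rewrite mulr_sumr; exact: eq_bigr.
Qed.

Lemma sum_edgesN F : sum_edges (fun i a j b => - F i a j b) = - sum_edges F.
Proof.
by rewrite -mulN1r -sum_edgesZ; apply: eq_sum_edges => i a j b _ _; rewrite mulN1r.
Qed.

Lemma norm_sum_edges F : `|sum_edges F| <= sum_edges (fun i a j b => `|F i a j b|).
Proof.
rewrite (le_trans (ler_norm_sum _ _ _))//; apply: ler_sum => i _.
rewrite (le_trans (ler_norm_sum _ _ _))//; apply: ler_sum => j _.
rewrite (le_trans (ler_norm_sum _ _ _))//; apply: ler_sum => a _.
exact: ler_norm_sum.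
Qed.

(** Double counting: by uniqueness of the partner, each pair (cell, shared edge) occurs in exactly
    one term on the right, as the smaller or as the larger of the two cells. *)
Lemma sum_over_edges (w : 'I_(ntri T) -> 'I_3 -> R) :
  (forall i a, ~~ shared i a -> w i a = 0) ->
  \sum_i \sum_a w i a = sum_edges (fun i a j b => w i a + w j b).
Proof.
move=> w0; pose H i j := \sum_a \sum_(b | same_edge i a j b) w i a.
have E i a : w i a = \sum_(j | i != j) \sum_(b | same_edge i a j b) w i a.
  have [/sharedP[j [b [ij s]]]|ns] := boolP (shared i a).
    rewrite (bigD1 j)//= [X in _ + X]big1 ?addr0; last first.
      move=> j' /andP[ij' jj']; rewrite big1// => b' s'.
      by have [E _] := partner_unique hT ij ij' s s'; rewrite E eqxx in jj'.
    rewrite (bigD1 b)//= big1 ?addr0// => b' /andP[s' bb'].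
    by have [_ E] := partner_unique hT ij ij s s'; rewrite E eqxx in bb'.
  rewrite big1 ?(w0 _ _ ns) // => j ij; apply: big1 => b s; by have := not_shared ns b ij; rewrite s.
transitivity (\sum_i \sum_(j | i != j) H i j).
  apply: eq_bigr => i _; rewrite /H exchange_big /=; apply: eq_bigr => a _; exact: E.
transitivity (\sum_(i < ntri T) (\sum_(j < ntri T | (i < j)%N) H i j + \sum_(j < ntri T | (j < i)%N) H i j)).
  apply: eq_bigr => i _; rewrite (bigID (fun j : 'I_(ntri T) => (i < j)%N)) /=; congr (_ + _).
    by apply: eq_bigl => j; rewrite -val_eqE /=; case: ltngtP.
  by apply: eq_bigl => j; rewrite -val_eqE /=; case: ltngtP.
rewrite big_split /= [X in _ + X](exchange_big_dep predT) //= -big_split.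
apply: eq_bigr => i _; rewrite -big_split /=; apply: eq_bigr => j ij.
rewrite /H [X in _ + X](exchange_big_dep predT) //= -big_split; apply: eq_bigr => a _ /=.
rewrite big_split /=; congr (_ + _).
by apply: eq_bigl => b; rewrite same_edge_sym.
Qed.

(** A cell has at most three shared edges. *)
Lemma sum_edges_cells (m : 'I_(ntri T) -> R) : (forall i, 0 <= m i) ->
  sum_edges (fun i a j b => m i + m j) <= 3 * \sum_i m i.
Proof.
move=> m0; pose w i a := if shared i a then m i else 0.
have -> : sum_edges (fun i a j b => m i + m j) = sum_edges (fun i a j b => w i a + w j b).
  apply: eq_sum_edges => i a j b ij s; rewrite /w.
  have -> : shared i a by apply/sharedP; exists j, b.
  have -> : shared j b by apply/sharedP; exists i, a; rewrite eq_sym same_edge_sym.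
  by [].
rewrite -sum_over_edges; last by move=> i a /negbTE ns; rewrite /w ns.
rewrite mulr_sumr; apply: ler_sum => i _.
apply: (@le_trans _ _ (\sum_(a < 3) m i)).
  by apply: ler_sum => a _; rewrite /w; case: ifP.
by rewrite sumr_const card_ord mulr_natl.
Qed.

Definition enormal i a : pt R :=
  ((edge_tgt i a).2 - (edge_src i a).2, (edge_src i a).1 - (edge_tgt i a).1).

Lemma edge_length_gt0 i a : 0 < edge_length i a.
Proof.
rewrite /edge_length /Defs.edist /eucl sqrtr_gt0 lt_neqAle addr_ge0 ?sqr_ge0// andbT eq_sym.
apply/negP; rewrite paddr_eq0 ?sqr_ge0// !sqrf_eq0 !subr_eq0 /= => /andP[/eqP h1 /eqP h2].
have : edge_src i a = edge_tgt i a.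
  by move: h1 h2; case: (edge_src i a) => ? ?; case: (edge_tgt i a) => ? ? /= -> ->.
move=> /(congr1 (bary (vtx i) (ordS a))).
have n0 := cell_nondegenerate hT i.
rewrite !bary_vertex// eqxx ordS_pred_neq => /eqP.
by rewrite oner_eq0.
Qed.

Lemma scaled_normal i a : edge_length i a *: outward_normal i a =
  Num.sg (area2 (vtx i)) *: vec (enormal i a).
Proof.
rewrite /outward_normal scalerA; congr (_ *: vec _).
rewrite mulrC divfK ?gt_eqF ?edge_length_gt0// -sgrN; congr Num.sg.
rewrite -(area2_rot (vtx i) a) /edge_src /edge_tgt /det2 /=; ring.
Qed.

Lemma partner_length i a j b : same_edge i a j b -> edge_length j b = edge_length i a.
Proof.
move=> /same_edgeP[s o]; rewrite /edge_length; case: s o => /= -[-> ->] //.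
by rewrite /Defs.edist /eucl /=; congr Num.sqrt; ring.
Qed.

Lemma partner_scaled_normal i a j b : i != j -> same_edge i a j b ->
  Num.sg (area2 (vtx j)) *: vec (enormal j b) = - (Num.sg (area2 (vtx i)) *: vec (enormal i a)).
Proof.
move=> ij /same_edgeP[s o]; have := opposite_sides hT ij o.
have -> : enormal j b = if s then enormal i a else (- (enormal i a).1, - (enormal i a).2).
  by rewrite /enormal; case: s o => /= -[-> ->] //; congr pair; ring.
rewrite -sgr_cp0 !sgrM.
have Ji := nondegenerateE (cell_nondegenerate hT i).
have Jj := nondegenerateE (cell_nondegenerate hT j).
case: s {o} => /eqP h; apply/matrixP => k l; rewrite !mxE /pt_coord /=.
  by move: h; rewrite sgr1 mul1r; case: sgrP Ji => //; case: sgrP Jj => // _ _ _ _; case: ifP => _; lra.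
by move: h; rewrite sgrN sgr1; case: sgrP Ji => //; case: sgrP Jj => // _ _ _ _; case: ifP => _ /=; lra.
Qed.

Lemma partner_normal i a j b : i != j -> same_edge i a j b ->
  outward_normal j b = - outward_normal i a.
Proof.
move=> ij s; have l0 := lt0r_neq0 (edge_length_gt0 i a).
apply: (scalerI l0); rewrite -{1}(partner_length s) scaled_normal scalerN scaled_normal.
exact: partner_scaled_normal.
Qed.

(** The outward flux of the field (P, Q) through the edge, with respect to arc length: the length of
    the unnormalised normal compensates the parametrisation by [0, 1]. *)
Definition eflux i a P Q : R := Num.sg (area2 (vtx i)) *
  eint (edge_src i a) (edge_tgt i a) (nupoly (edge_src i a) (edge_tgt i a) P Q).

Lemma eflux_lin i a (c : R) P Q P' Q' :
  eflux i a (c%:P%:P * P + P') (c%:P%:P * Q + Q') = c * eflux i a P Q + eflux i a P' Q'.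
Proof.
rewrite /eflux mulrCA -mulrDr -(eintZ _ _ c) -eintD; congr (_ * eint _ _ _).
by rewrite /nupoly; ring.
Qed.

Lemma efluxD i a P Q P' Q' : eflux i a (P + P') (Q + Q') = eflux i a P Q + eflux i a P' Q'.
Proof. by rewrite -[eflux i a P Q]mul1r -eflux_lin !mul1r. Qed.

Lemma efluxN i a P Q : eflux i a (- P) (- Q) = - eflux i a P Q.
Proof.
rewrite /eflux -mulrN -eintN; congr (_ * eint _ _ _).
by rewrite /nupoly; ring.
Qed.

Lemma efluxB i a P Q P' Q' : eflux i a (P - P') (Q - Q') = eflux i a P Q - eflux i a P' Q'.
Proof. by rewrite efluxD efluxN. Qed.

Lemma edge_cell i a (t : R) : 0 <= t <= 1 -> cell i (segpt (edge_src i a) (edge_tgt i a) t).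
Proof.
move=> h; suff [] : hull (vtx i) (segpt (edge_src i a) (edge_tgt i a) t) /\
    bary (vtx i) a (segpt (edge_src i a) (edge_tgt i a) t) = 0 by [].
by apply/segmentP; [exact: (cell_nondegenerate hT)|exists t].
Qed.

Lemma partner_cell i a j b (t : R) : same_edge i a j b -> 0 <= t <= 1 ->
  cell j (segpt (edge_src i a) (edge_tgt i a) t).
Proof.
move=> /same_edgeP[s o] h; case: s o => /= -[-> ->]; first exact: edge_cell.
have -> : segpt (edge_tgt j b) (edge_src j b) t = segpt (edge_src j b) (edge_tgt j b) (1 - t).
  by rewrite /segpt; congr pair; ring.
by apply: edge_cell; move/andP: h => [? ?]; apply/andP; split; lra.
Qed.

Lemma eflux_eq i a P Q P' Q' :
  (forall t, 0 <= t <= 1 -> let x := segpt (edge_src i a) (edge_tgt i a) t in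
     ev P x = ev P' x /\ ev Q x = ev Q' x) ->
  eflux i a P Q = eflux i a P' Q'.
Proof.
move=> h; rewrite /eflux; congr (_ * _); apply: eint_eq => t ht.
by have [h1 h2] := h t ht; rewrite /nupoly !evE h1 h2.
Qed.

Lemma eflux0 i a : eflux i a 0 0 = 0.
Proof. by rewrite -(subrr (0 : {poly {poly R}})) efluxB subrr. Qed.

Lemma eflux_partner i a j b P Q : i != j -> same_edge i a j b ->
  eflux j b P Q = - eflux i a P Q.
Proof.
move=> ij s; have := partner_scaled_normal ij s.
move=> /matrixP N; have := N ord0 ord0; have := N ord_max ord0.
rewrite !mxE /pt_coord /= => N2 N1.
rewrite /eflux -!eintZ -eintN; case/same_edgeP : s => o so.
have -> : eint (edge_src j b) (edge_tgt j b) = eint (edge_src i a) (edge_tgt i a).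
  by apply/funext => X; case: o so => /= -[-> ->] //; rewrite eint_rev.
congr eint; rewrite /nupoly !mulrDr !mulrA -!polyCM.
rewrite -/(enormal j b).1 -/(enormal j b).2 N1 N2 !polyCN; ring.
Qed.

(** Unshared edges lie on the boundary, where the field vanishes; on a shared edge the outward
    normals are opposite, so the two fluxes combine into the flux of the jump. *)
Lemma divergence_mesh (P Q : 'I_(ntri T) -> {poly {poly R}}) :
  (forall i x, cell i x -> bdry Omega x -> ev (P i) x = 0 /\ ev (Q i) x = 0) ->
  \sum_i \int[leb2]_(x in cell i) ev (dX (P i) + dY (Q i)) x =
  sum_edges (fun i a j b => eflux i a (P i - P j) (Q i - Q j)).
Proof.
move=> h0; rewrite (eq_bigr (fun i => \sum_a eflux i a (P i) (Q i))); last first.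
  by move=> i _; rewrite divergence_triangle ?mulr_sumr//; exact: (cell_nondegenerate hT).
rewrite sum_over_edges.
  by apply: eq_sum_edges => i a j b ij s; rewrite (eflux_partner _ _ ij s) efluxB.
move=> i a ns; rewrite -(eflux0 i a); apply: eflux_eq => t t01 /=.
rewrite !ev0; apply: h0; first exact: edge_cell.
by apply: boundary_edge => //; exact: not_shared.
Qed.

End EdgeSums.

(** * The discrete Monge-Ampere forms *)

Section MongeAmpereForms.
Context {R : realType} (Omega : set (pt R)) (T : mesh R).
Context (hT : conforming_triangulation Omega T).
Implicit Types (x y : pt R) (i j : 'I_(ntri T)) (a b : 'I_3) (P Q X Y : {poly {poly R}}).

(* The components of (cof D^2 X) DY; [cross] is the polarisation of [detH]. *)
Definition cof1 X Y := dY (dY X) * dX Y - dX (dY X) * dY Y.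
Definition cof2 X Y := dX (dX X) * dY Y - dX (dY X) * dX Y.
Definition detH X := dX (dX X) * dY (dY X) - dX (dY X) * dX (dY X).
Definition cross X Y := dY (dY X) * dX (dX Y) + dX (dX X) * dY (dY Y)
  - dX (dY X) * dX (dY Y) - dX (dY X) * dX (dY Y).

Lemma detHD X Y : detH (X + Y) = detH X + cross X Y + detH Y.
Proof. by rewrite /detH /cross !(dXD, dYD); ring. Qed.

(** The product rule for ((cof D^2 X) DY) P. No third derivatives of X remain, because the rows of
    cof D^2 X are divergence free. *)
Lemma div_cof X Y P : dX (cof1 X Y * P) + dY (cof2 X Y * P) =
  cross X Y * P + (cof1 X Y * dX P + cof2 X Y * dY P).
Proof.
rewrite /cof1 /cof2 /cross !(dXM, dYM, dXB, dYB) !dXY; ring.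
Qed.

Definition halfp : {poly {poly R}} := 2^-1%:P%:P.
Lemma halfp2 : halfp + halfp = 1.
Proof. by rewrite /halfp -!polyCD -!polyC1; congr (_%:P%:P); field. Qed.
Lemma dX_half P : dX (halfp * P) = halfp * dX P.
Proof. by rewrite dXM dXC derivC polyC0 mul0r add0r. Qed.
Lemma dY_half P : dY (halfp * P) = halfp * dY P.
Proof. by rewrite dYM dYC mul0r add0r. Qed.
Lemma ev_half P x : ev (halfp * P) x = ev P x / 2.
Proof. by rewrite evM evC mulrC. Qed.

(** Bilinear expansion of mean times jump for X + Y, in which the mean of cof D^2 X times the jump
    of DY is rewritten by the rule: jump of a product = mean times jump + jump times mean. *)
Lemma cof1_jump X X' Y Y' :
  cof1 (halfp * (X + Y + (X' + Y'))) (X + Y - (X' + Y')) =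
  cof1 (halfp * (X + X')) (X - X') + (cof1 X Y - cof1 X' Y') -
  cof1 (X - X') (halfp * (Y + Y')) + cof1 (halfp * (Y + Y')) (X - X') +
  cof1 (halfp * (Y + Y')) (Y - Y').
Proof.
rewrite -[cof1 X Y]mul1r -[cof1 X' Y']mul1r -halfp2.
by rewrite /cof1 !(dX_half, dY_half, dXB, dXD, dYB, dYD); ring.
Qed.

Lemma cof2_jump X X' Y Y' :
  cof2 (halfp * (X + Y + (X' + Y'))) (X + Y - (X' + Y')) =
  cof2 (halfp * (X + X')) (X - X') + (cof2 X Y - cof2 X' Y') -
  cof2 (X - X') (halfp * (Y + Y')) + cof2 (halfp * (Y + Y')) (X - X') +
  cof2 (halfp * (Y + Y')) (Y - Y').
Proof.
rewrite -[cof2 X Y]mul1r -[cof2 X' Y']mul1r -halfp2.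
by rewrite /cof2 !(dX_half, dY_half, dXB, dXD, dYB, dYD); ring.
Qed.

Definition cell_box i : R := \sum_a (`|(vtx i a).1| + `|(vtx i a).2|).
Lemma cell_boxP i : cell i `<=` box (cell_box i).
Proof. exact: hull_box. Qed.
Lemma measurable_cell i : measurable (cell i).
Proof. exact: measurable_hull (cell_nondegenerate hT i). Qed.

Lemma cell_integrable i P : leb2.-integrable (cell i) (EFin \o ev P).
Proof. exact: (ev_integrable _ (measurable_cell i) (@cell_boxP i)). Qed.

Definition cint i P : R := \int[leb2]_(x in cell i) ev P x.

Lemma cintD i P Q : cint i (P + Q) = cint i P + cint i Q.
Proof.
rewrite /cint -RintegralD; [|exact: measurable_cell|exact: cell_integrable|exact: cell_integrable].
by apply: eq_Rintegral => x _; rewrite evD.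
Qed.

Lemma cintZ i (c : R) P : cint i (c%:P%:P * P) = c * cint i P.
Proof.
rewrite /cint -RintegralZl; [|exact: measurable_cell|exact: cell_integrable].
by apply: eq_Rintegral => x _; rewrite evM evC.
Qed.

Lemma cintN i P : cint i (- P) = - cint i P.
Proof. by rewrite -[RHS]mulN1r -cintZ !polyCN !polyC1 mulN1r. Qed.

Lemma le_cint i P Q : (forall x, cell i x -> ev P x <= ev Q x) -> cint i P <= cint i Q.
Proof.
move=> h; apply: le_Rintegral => //; [exact: measurable_cell|exact: cell_integrable|exact: cell_integrable].
Qed.

Lemma cint_ge0 i P : (forall x, cell i x -> 0 <= ev P x) -> 0 <= cint i P.
Proof. by move=> h; apply: Rintegral_ge0. Qed.

Definition MAvol (f : pt R -> R) i X P : R :=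
  \int[leb2]_(x in cell i) ((f x - ev (detH X) x) * ev P x).

Lemma MAvolE f i X P : leb2.-integrable (cell i) (EFin \o (fun x => f x * ev P x)) ->
  MAvol f i X P = \int[leb2]_(x in cell i) (f x * ev P x) - cint i (detH X * P).
Proof.
move=> fi; rewrite /MAvol /cint -RintegralB; [|exact: measurable_cell|exact: fi|exact: cell_integrable].
by apply: eq_Rintegral => x _; rewrite evM mulrBl.
Qed.

Definition eterm i a X Y P := eflux i a (cof1 X Y * P) (cof2 X Y * P).

(** This and [dMApoly] are the forms A and A' on cell polynomials. As the two unit normals on an
    edge are opposite, every jump becomes the flux of a difference seen from cell i. *)
Definition MApoly f (A F : 'I_(ntri T) -> {poly {poly R}}) : R :=
  \sum_i MAvol f i (A i) (F i) +
  sum_edges (fun i a j b => eterm i a (halfp * (A i + A j)) (A i - A j) (F i)).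

Definition dMApoly (W V F : 'I_(ntri T) -> {poly {poly R}}) : R :=
  \sum_i cint i (cof1 (W i) (V i) * dX (F i) + cof2 (W i) (V i) * dY (F i)) -
  sum_edges (fun i a j b => eterm i a (W i - W j) (halfp * (V i + V j)) (F i)) +
  sum_edges (fun i a j b => eterm i a (halfp * (V i + V j)) (W i - W j) (F i)).

Definition MAremainder (E F : 'I_(ntri T) -> {poly {poly R}}) : R :=
  sum_edges (fun i a j b => eterm i a (halfp * (E i + E j)) (E i - E j) (F i)) -
  \sum_i cint i (detH (E i) * F i).

Lemma eflux_mulr_sum i a P1 P2 P3 P4 P5 Q1 Q2 Q3 Q4 Q5 F :
  eflux i a ((P1 + P2 - P3 + P4 + P5) * F) ((Q1 + Q2 - Q3 + Q4 + Q5) * F) =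
  eflux i a (P1 * F) (Q1 * F) + eflux i a (P2 * F) (Q2 * F) - eflux i a (P3 * F) (Q3 * F) +
  eflux i a (P4 * F) (Q4 * F) + eflux i a (P5 * F) (Q5 * F).
Proof. by rewrite !mulrDl !mulNr !efluxD efluxN. Qed.

(** In two dimensions both the determinant and the edge flux are quadratic, so the expansion stops
    at second order. The linear volume term - [cross] A E * F is turned by the divergence theorem
    into the volume term of A' minus a jump flux, which cancels the jump of the product produced by
    [cof1_jump] and [cof2_jump]. *)
Lemma MApoly_expansion f (A E F : 'I_(ntri T) -> {poly {poly R}}) :
  (forall i, leb2.-integrable (cell i) (EFin \o (fun x => f x * ev (F i) x))) ->
  (forall i j x, cell i x -> cell j x -> ev (F i) x = ev (F j) x) ->
  (forall i x, cell i x -> bdry Omega x -> ev (F i) x = 0) ->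
  MApoly f (fun i => A i + E i) F = MApoly f A F + dMApoly A E F + MAremainder E F.
Proof.
move=> fi Fc F0.
have D := @divergence_mesh R Omega T hT (fun i => cof1 (A i) (E i) * F i) (fun i => cof2 (A i) (E i) * F i).
have {}D : \sum_i cint i (cross (A i) (E i) * F i + (cof1 (A i) (E i) * dX (F i) +
    cof2 (A i) (E i) * dY (F i))) = sum_edges (fun i a j b =>
    eflux i a (cof1 (A i) (E i) * F i - cof1 (A j) (E j) * F j) (cof2 (A i) (E i) * F i - cof2 (A j) (E j) * F j)).
  rewrite -D; last by move=> i x cix bx; rewrite !evM (F0 i x)// !mulr0.
  by apply: eq_bigr => i _; rewrite div_cof.
have ED : sum_edges (fun i a j b =>
     eterm i a (halfp * (A i + E i + (A j + E j))) (A i + E i - (A j + E j)) (F i)) =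
   sum_edges (fun i a j b => eterm i a (halfp * (A i + A j)) (A i - A j) (F i)) +
   sum_edges (fun i a j b => eflux i a (cof1 (A i) (E i) * F i - cof1 (A j) (E j) * F j)
         (cof2 (A i) (E i) * F i - cof2 (A j) (E j) * F j)) -
   sum_edges (fun i a j b => eterm i a (A i - A j) (halfp * (E i + E j)) (F i)) +
   sum_edges (fun i a j b => eterm i a (halfp * (E i + E j)) (A i - A j) (F i)) +
   sum_edges (fun i a j b => eterm i a (halfp * (E i + E j)) (E i - E j) (F i)).
  rewrite -sum_edgesN -!sum_edgesD; apply: eq_sum_edges => i a j b ij s.
  rewrite /eterm cof1_jump cof2_jump.
  (* The test function is single-valued on the edge and can be factored out of the jump. *)
  have -> : eflux i a (cof1 (A i) (E i) * F i - cof1 (A j) (E j) * F j)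
         (cof2 (A i) (E i) * F i - cof2 (A j) (E j) * F j) =
      eflux i a ((cof1 (A i) (E i) - cof1 (A j) (E j)) * F i)
         ((cof2 (A i) (E i) - cof2 (A j) (E j)) * F i).
    apply: (eflux_eq) => t t01 /=; rewrite !evE.
    have -> : ev (F j) (segpt (edge_src i a) (edge_tgt i a) t) =
       ev (F i) (segpt (edge_src i a) (edge_tgt i a) t).
      by apply: Fc; [exact: (partner_cell hT s)|exact: (edge_cell hT)].
    by split; ring.
  exact: eflux_mulr_sum.
rewrite /MApoly /dMApoly /MAremainder ED -D.
have V : \sum_i MAvol f i (A i + E i) (F i) = \sum_i MAvol f i (A i) (F i) -
    \sum_i cint i (cross (A i) (E i) * F i) - \sum_i cint i (detH (E i) * F i).
  rewrite -!sumrB; apply: eq_bigr => i _.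
  rewrite (MAvolE (A i + E i) (fi i)) (MAvolE (A i) (fi i)) detHD !mulrDl !cintD.
  have arith (m p q r : R) : m - (p + q + r) = m - p - q - r by ring.
  exact: arith.
have S : \sum_i cint i (cross (A i) (E i) * F i + (cof1 (A i) (E i) * dX (F i) +
    cof2 (A i) (E i) * dY (F i))) = \sum_i cint i (cross (A i) (E i) * F i) +
    \sum_i cint i (cof1 (A i) (E i) * dX (F i) + cof2 (A i) (E i) * dY (F i)).
  by rewrite -big_split; apply: eq_bigr => i _; rewrite cintD.
have arith (v c d m e1 e3 e4 e5 : R) : v - c - d + (e1 + (c + m) - e3 + e4 + e5) =
    v + e1 + (m - e3 + e4) + (e5 - d) by ring.
by rewrite [X in X + _ = _]V S; exact: arith.
Qed.

End MongeAmpereForms.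

(** * Elementwise derivatives and their one-sided traces *)

Section Traces.
Context {R : realType}.
Implicit Types (x y e : pt R) (P Q : {poly {poly R}}) (v w : pt R -> R).

Definition shift_pt x e (t : R) : R * R := (x.1 + t * e.1, x.2 + t * e.2).

Lemma derive_shift_pt v x e (t : R) :
  (fun h : R => h^-1 *: ((v \o shift (shift_pt x e t)) (h *: e) - v (shift_pt x e t))) =
  (fun h : R => h^-1 *: (((fun s => v (shift_pt x e s)) \o shift t) (h *: (1 : R)) - v (shift_pt x e t))).
Proof.
apply/funext => h; rewrite /= /shift_pt /=; congr (_ *: (v _ - _)).
have -> : h *: e = (h * e.1, h * e.2) by [].
by rewrite [h *: 1]mulr1 /shift /=; congr pair; rewrite /=; ring.
Qed.

(** Exchanges directional derivatives in the plane with derivatives in one variable along a line,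
    where [is_derive_line] and the mean value theorem apply. *)
Lemma is_derive_shift_pt v x e (t d : R) :
  is_derive t (1 : R) (fun s => v (shift_pt x e s)) d <-> is_derive (shift_pt x e t) e v d.
Proof.
split=> -[h1 h2]; split.
- by rewrite /derivable derive_shift_pt.
- by rewrite /derive derive_shift_pt.
- by rewrite /derivable -derive_shift_pt.
- by rewrite /derive -derive_shift_pt.
Qed.

Lemma shift_pt0 x e : shift_pt x e 0 = x.
Proof. by case: x => x1 x2; rewrite /shift_pt /= !mul0r !addr0. Qed.

Lemma is_derive_ev P x (i : 'I_2) : is_derive x (basis_vec i) (ev P) (ev (dpoly i P) x).
Proof.
rewrite -[x in is_derive x](shift_pt0 x (basis_vec i)); apply/is_derive_shift_pt.
have := is_derive_line P x.1 (basis_vec i).1 x.2 (basis_vec i).2 0.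
have -> : (fun s => ev P (line x.1 (basis_vec i).1 x.2 (basis_vec i).2 s)) =
    (fun s => ev P (shift_pt x (basis_vec i) s)).
  by apply/funext => s; rewrite /line /shift_pt; congr (ev P (_, _)); rewrite mulrC.
rewrite /line !mulr0 !addr0 -surjective_pairing /dpoly /basis_vec.
by case: ifP => _ /=; rewrite !(mul1r, mul0r, addr0, add0r).
Qed.

Definition dwords s P := foldr dpoly P s.

Lemma dpar_ev (U : set (pt R)) v P s x : open U -> (forall y, U y -> v y = ev P y) -> U x ->
  dpar s v x = ev (dwords s P) x.
Proof.
move=> oU; elim: s v P x => [|i s IH] v P x vP Ux; first exact: vP.
rewrite /= (@near_eq_derive _ _ _ _ (ev (dwords s P))).
  by have [_ ->] := is_derive_ev (dwords s P) x i.
have : nbhs x U by exact: open_nbhs_nbhs.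
by apply: filterS => y Uy; exact: IH vP Uy.
Qed.

(** A continuous extension of the derivative identifies the limit defining [dpar_on]; x lies in the
    closure of U, so the filter is proper and the limit unique. *)
Lemma dpar_on_cvg (U : set (pt R)) s v (F : R * R -> R) x : open U -> closure U x ->
  {within closure U, continuous F} -> (forall y, U y -> dpar s v y = F y) ->
  dpar_on U s v x = F x.
Proof.
move=> oU Ux cF E; rewrite /dpar_on.
have PF : ProperFilter (within U (nbhs x)) by exact: within_nbhs_proper.
apply: cvg_lim => //.
have /subspace_continuousP /(_ x Ux) c := cF.
move=> A nA; have := @filterS _ (nbhs x) (nbhs_filter x) (fun y => closure U y -> A (F y))
  (fun y => U y -> A (dpar s v y)) _ (c A nA).
by apply => y h Uy; rewrite E//; apply: h; exact: subset_closure.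
Qed.

Lemma dpar_on_ev (U : set (pt R)) s v P x : open U -> closure U x ->
  (forall y, U y -> v y = ev P y) -> dpar_on U s v x = ev (dwords s P) x.
Proof.
move=> oU Ux vP; apply: dpar_on_cvg => //; last by move=> y; exact: dpar_ev.
by apply: continuous_subspaceT; exact: continuous_ev.
Qed.

End Traces.

Section DiscreteForms.
Context {R : realType} (Omega : set (pt R)) (T : mesh R).
Context (hT : conforming_triangulation Omega T).
Implicit Types (x y : pt R) (i j : 'I_(ntri T)) (a b : 'I_3) (P Q X Y : {poly {poly R}}).
Implicit Types (v w phi : pt R -> R) (A B V W F : 'I_(ntri T) -> {poly {poly R}}).
Local Notation i0 := (ord0 : 'I_2).
Local Notation i1 := (ord_max : 'I_2).

Definition represents v A := forall i x, cell i x -> v x = ev (A i) x.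

Lemma representsB v w A B : represents v A -> represents w B ->
  represents (fun x => v x - w x) (fun i => A i - B i).
Proof. by move=> h1 h2 i x cx; rewrite evB (h1 i) // (h2 i). Qed.

Lemma Vh_represents k v : Vh k Omega T v ->
  exists2 A, (forall i, bsize k.+1 (A i)) & represents v A.
Proof.
move=> [_ h].
have /choice [A hA] : forall i, exists P, bsize k.+1 P /\ forall x, cell i x -> v x = ev P x.
  by move=> i; have [p /poly_deg_leP [P sP pE] vp] := h i; exists P; split=> // x /vp ->.
by exists A; move=> i; have [] := hA i.
Qed.

Lemma cell_closure i x : cell i x -> closure (cell i)° x.
Proof. exact: closure_interior_hull (cell_nondegenerate hT i). Qed.

Lemma grad_ev v A i x : represents v A -> cell i x ->
  grad (cell i)° v x = \col_k ev (dpoly k (A i)) x.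
Proof.
move=> vA cx; apply/matrixP => k l; rewrite !mxE.
rewrite (@dpar_on_ev _ _ _ _ (A i))//; [exact: open_interior|exact: cell_closure|].
by move=> y /interior_subset; exact: vA.
Qed.

Lemma hess_ev v A i x : represents v A -> cell i x ->
  hess (cell i)° v x = \matrix_(k, l) ev (dpoly k (dpoly l (A i))) x.
Proof.
move=> vA cx; apply/matrixP => k l; rewrite !mxE.
rewrite (@dpar_on_ev _ _ _ _ (A i))//; [exact: open_interior|exact: cell_closure|].
by move=> y /interior_subset; exact: vA.
Qed.

Lemma sum2 (V' : nmodType) (f : 'I_2 -> V') : \sum_k f k = f i0 + f i1.
Proof.
by rewrite !big_ord_recl big_ord0 addr0; congr (_ + f _); apply: val_inj.
Qed.

Lemma ord2P (k : 'I_2) : k = i0 \/ k = i1.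
Proof. by case: k => [[|[|//]] h]; [left|right]; apply: val_inj. Qed.

Lemma det_2 (M : 'M[R]_2) : \det M = M i0 i0 * M i1 i1 - M i0 i1 * M i1 i0.
Proof.
rewrite (expand_det_row _ i0) sum2 /cofactor !det_mx11 !mxE /= expr0 expr1 mul1r mulN1r mulrN.
by congr (_ * M _ _ - _ * M _ _); apply: val_inj.
Qed.

Lemma cof_2 (M : 'M[R]_2) : [/\ cof M i0 i0 = M i1 i1, cof M i0 i1 = - M i1 i0,
  cof M i1 i0 = - M i0 i1 & cof M i1 i1 = M i0 i0].
Proof.
by rewrite !mxE /cofactor !det_mx11 !mxE /= expr0 !expr1 -signr_odd /= expr0 !mul1r !mulN1r;
  split; congr (_ (M _ _)) || congr (M _ _); apply: val_inj.
Qed.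

Lemma mulmx2 m n (A : 'M[R]_(m, 2)) (B : 'M[R]_(2, n)) k l :
  (A *m B) k l = A k i0 * B i0 l + A k i1 * B i1 l.
Proof. by rewrite mxE sum2. Qed.

(** The edge length times the unit normal is the signed polynomial normal of [eflux], so the square
    root in the edge length disappears. *)
Lemma edge_term i a (g : pt R -> R) P Q :
  (forall t, 0 <= t <= 1 -> let x := segpt (edge_src i a) (edge_tgt i a) t in
     g x = outward_normal i a i0 0 * ev P x + outward_normal i a i1 0 * ev Q x) ->
  edge_length i a * \int[@lebesgue_measure R]_(t in `[0, 1])
      g (segpt (edge_src i a) (edge_tgt i a) t) = eflux i a P Q.
Proof.
move=> h; have l0 := edge_length_gt0 hT i a.
have N := scaled_normal hT i a.
have N1 : edge_length i a * outward_normal i a i0 0 = Num.sg (area2 (vtx i)) * (enormal i a).1.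
  by move/matrixP: N => /(_ i0 0); rewrite !mxE.
have N2 : edge_length i a * outward_normal i a i1 0 = Num.sg (area2 (vtx i)) * (enormal i a).2.
  by move/matrixP: N => /(_ i1 0); rewrite !mxE.
pose nP := (outward_normal i a i0 0)%:P%:P * P + (outward_normal i a i1 0)%:P%:P * Q.
transitivity (edge_length i a * eint (edge_src i a) (edge_tgt i a) nP).
  congr (_ * _); apply: eq_Rintegral => t; rewrite inE /= in_itv /= => t01.
  by rewrite h// /nP !evE.
rewrite /eflux -!eintZ; congr eint.
rewrite /nP mulrDr !mulrA -!polyCM N1 N2 /nupoly /enormal /= !polyCM; ring.
Qed.

Lemma cof_hess v A i x : represents v A -> cell i x ->
  [/\ cof (hess (cell i)° v x) i0 i0 = ev (dY (dY (A i))) x,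
      cof (hess (cell i)° v x) i0 i1 = - ev (dX (dY (A i))) x,
      cof (hess (cell i)° v x) i1 i0 = - ev (dX (dY (A i))) x &
      cof (hess (cell i)° v x) i1 i1 = ev (dX (dX (A i))) x].
Proof.
move=> vA cx; have [-> -> -> ->] := cof_2 (hess (cell i)° v x).
by rewrite (hess_ev vA cx) !mxE /dpoly /= dXY.
Qed.

Lemma averageE m n (E E' : 'M[R]_(m, n)) k l : average E E' k l = 2^-1 * (E k l + E' k l).
Proof. by rewrite !mxE. Qed.

Lemma average_cof_hess v A i j x : represents v A -> cell i x -> cell j x ->
  let cv := average (cof (hess (cell i)° v x)) (cof (hess (cell j)° v x)) in
  let X := halfp * (A i + A j) in
  [/\ cv i0 i0 = ev (dY (dY X)) x, cv i0 i1 = - ev (dX (dY X)) x,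
      cv i1 i0 = - ev (dX (dY X)) x & cv i1 i1 = ev (dX (dX X)) x].
Proof.
move=> vA ci cj cv X; rewrite /cv.
rewrite (averageE _ _ i0 i0) (averageE _ _ i0 i1) (averageE _ _ i1 i0) (averageE _ _ i1 i1).
have [-> -> -> ->] := cof_hess vA ci; have [-> -> -> ->] := cof_hess vA cj.
rewrite /X !(dX_half, dY_half, dXD, dYD) !(evM, evD) /halfp !evC !dXY.
by split; rewrite ?mulrDr ?mulrN; ring.
Qed.

Lemma jump_opp n (N : 'cV[R]_2) (E E' : 'M[R]_(2, n)) k :
  jump N (- N) E E' 0 k = N i0 0 * (E i0 k - E' i0 k) + N i1 0 * (E i1 k - E' i1 k).
Proof. by rewrite /jump mxE !mulmx2 !mxE; ring. Qed.

Lemma MAformE f v phi A F : represents v A -> represents phi F ->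
  MAform T f v phi = MApoly f A F.
Proof.
move=> vA pF; rewrite /MAform /MApoly; congr (_ + _).
  apply: eq_bigr => i _; rewrite /MAvol; apply: eq_Rintegral => x; rewrite inE => cx.
  by rewrite (hess_ev vA cx) det_2 !mxE /dpoly /= (pF _ _ cx) /detH !(evM, evB) -!dXY.
apply: eq_sum_edges => i a j b ij s; rewrite /eterm.
apply: (@edge_term i a (fun x =>
      let cv := average (cof (hess (cell i)° v x)) (cof (hess (cell j)° v x)) in
      scal (jump (outward_normal i a) (outward_normal j b)
        (cv *m grad (cell i)° v x) (cv *m grad (cell j)° v x)) * phi x)) => t t01.
set x := segpt _ _ _.
have ci : cell i x := edge_cell hT i a t01.
have cj : cell j x := partner_cell hT s t01.
move=> /=; rewrite (partner_normal hT ij s) /scal jump_opp !mulmx2.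
have [-> -> -> ->] := average_cof_hess vA ci cj.
rewrite (grad_ev vA ci) (grad_ev vA cj) !mxE /dpoly /= (pF _ _ ci).
rewrite /cof1 /cof2 !(evM, evB, dXB, dYB); ring.
Qed.

Lemma dMAformE w v phi W V F : represents w W -> represents v V -> represents phi F ->
  dMAform T w v phi = dMApoly W V F.
Proof.
move=> wW vV pF; rewrite /dMAform /dMApoly; congr (_ - _ + _).
- apply: eq_bigr => i _; apply: eq_Rintegral => x; rewrite inE => cx.
  rewrite (hess_ev wW cx) (grad_ev vV cx) (grad_ev pF cx).
  set H := \matrix_(k, l) _; have [c1 c2 c3 c4] := cof_2 H.
  rewrite /scal mulmx2 ![(_^T) _ _]mxE !mulmx2 c1 c2 c3 c4 !mxE /dpoly /=.
  rewrite /cof1 /cof2 !(evM, evB, evD) -!dXY; ring.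
- apply: eq_sum_edges => i a j b ij s; rewrite /eterm.
  apply: (@edge_term i a (fun x =>
      scal (jump (outward_normal i a) (outward_normal j b)
              (cof (hess (cell i)° w x)) (cof (hess (cell j)° w x))
            *m average (grad (cell i)° v x) (grad (cell j)° v x)) * phi x)) => t t01.
  set x := segpt _ _ _.
  have ci : cell i x := edge_cell hT i a t01.
  have cj : cell j x := partner_cell hT s t01.
  move=> /=; rewrite (partner_normal hT ij s) /scal mulmx2 !jump_opp.
  have [-> -> -> ->] := cof_hess wW ci; have [-> -> -> ->] := cof_hess wW cj.
  rewrite (grad_ev vV ci) (grad_ev vV cj).
  rewrite !averageE !mxE /dpoly /= (pF _ _ ci).
  rewrite /cof1 /cof2 !(dX_half, dY_half, dXB, dYB, dXD, dYD) !(evM, evB, evD) /halfp !evC; ring.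
- apply: eq_sum_edges => i a j b ij s; rewrite /eterm.
  apply: (@edge_term i a (fun x =>
      let cv := average (cof (hess (cell i)° v x)) (cof (hess (cell j)° v x)) in
      scal (jump (outward_normal i a) (outward_normal j b)
        (cv *m grad (cell i)° w x) (cv *m grad (cell j)° w x)) * phi x)) => t t01.
  set x := segpt _ _ _.
  have ci : cell i x := edge_cell hT i a t01.
  have cj : cell j x := partner_cell hT s t01.
  move=> /=; rewrite (partner_normal hT ij s) /scal jump_opp !mulmx2.
  have [-> -> -> ->] := average_cof_hess vV ci cj.
  rewrite (grad_ev wW ci) (grad_ev wW cj) !mxE /dpoly /= (pF _ _ ci).
  rewrite /cof1 /cof2 !(evM, evB, dXB, dYB); ring.
Qed.

End DiscreteForms.

(** * Stability of the linearised form *)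

Section IntegralBounds.
Context {R : realType}.
Implicit Types (P : {poly {poly R}}) (q : {poly R}).
Local Notation mu := (@lebesgue_measure R).

Lemma poly_primitive n q : (size q <= n)%N -> exists2 Q : {poly R}, (size Q <= n.+1)%N & Q^`() = q.
Proof.
move=> sq; exists (\poly_(i < n.+1) (q`_i.-1 / i%:R)); first exact: size_poly.
apply/polyP => i; rewrite coef_deriv coef_poly ltnS /=.
have [ni|ni] := leqP n i; first by rewrite mul0rn nth_default// (leq_trans sq).
by rewrite -[LHS]mulr_natr divfK// pnatr_eq0.
Qed.

Lemma integral_horner (Q : {poly R}) (l r : R) : l <= r ->
  (\int[mu]_(t in `[l, r]) (Q^`().[t])%:E = (Q.[r] - Q.[l])%:E)%E.
Proof.
move=> lr; have := integral_derive_line Q%:P 0 1 0 0 lr.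
have E (p : {poly R}) t : ev p%:P (line 0 1 0 0 t) = p.[t].
  by rewrite /ev /line /= hornerC add0r mul1r.
rewrite !E EFinB => <-; apply: eq_integral => t _.
by rewrite dXC E mul1r mul0r addr0.
Qed.

(** The primitive vanishing at the left end is nondecreasing, hence bounded by its final value, the
    integral of q. The Markov bound for this primitive then bounds its derivative q. *)
Lemma poly_le_integral n : exists2 C : R, 0 < C & forall q (c r : R),
  (size q <= n)%N -> 0 < r -> (forall t, `|t - c| <= r -> 0 <= q.[t]) ->
  forall t, `|t - c| <= r ->
  ((q.[t])%:E <= (C / r)%:E * \int[mu]_(s in `[(c - r)%R, (c + r)%R]) (q.[s])%:E)%E.
Proof.
have [C C0 hC] := @poly_interval_bound R n.+1 1 ler01.
exists C => // q c r sq r0 q0 t ht.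
have [Q sQ Qq] := poly_primitive sq.
pose Q1 := Q - (Q.[c - r])%:P.
have sQ1 : (size Q1 <= n.+1)%N.
  by rewrite (leq_trans (size_polyD _ _))// geq_max sQ size_polyN (leq_trans (size_polyC_leq1 _)).
have dQ1 : Q1^`() = q by rewrite /Q1 derivB derivC subr0.
have mono (u w : R) : `|u - c| <= r -> `|w - c| <= r -> u <= w -> Q1.[u] <= Q1.[w].
  rewrite !ler_distl => /andP[u1 u2] /andP[w1 w2] uw.
  have := @integral_ge0 _ _ _ mu `[u, w]%classic (fun s => (q.[s])%:E).
  rewrite -{2}dQ1 integral_horner// lee_fin subr_ge0; apply => s.
  rewrite /= in_itv /= => /andP[us sw]; rewrite lee_fin; apply: q0.
  by rewrite ler_distl; apply/andP; split; lra.
have Qr : Q1.[c - r] = 0 by rewrite /Q1 !hornerE subrr.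
have cr : c - r <= c + r by lra.
rewrite -dQ1 integral_horner// Qr subr0 -EFinM lee_fin.
have c1 : `|c - r - c| <= r by rewrite ler_distl; apply/andP; split; lra.
have c2 : `|c + r - c| <= r by rewrite ler_distl; apply/andP; split; lra.
have [||_] := hC Q1 Q1.[c + r] c r sQ1 r0 _ t.
- move=> u hu; move: (hu); rewrite ler_distl => /andP[u1 u2].
  have h1 := mono _ _ c1 hu u1; rewrite Qr in h1.
  by rewrite ger0_norm//; exact: mono.
- by rewrite mul1r.
- exact: le_trans (ler_norm _).
Qed.

Lemma sqE (c : R * R) (r : R) : sq c r = `[c.1 - r, c.1 + r]%classic `*` `[c.2 - r, c.2 + r]%classic.
Proof.
by apply/seteqP; split=> x; rewrite /sq /= !in_itv /= !ler_distl.
Qed.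

Lemma measurable_sq (c : R * R) (r : R) : measurable (sq c r).
Proof. by rewrite sqE; apply: measurableX; exact: measurable_itv. Qed.

Lemma leb2_sq (c : R * R) (r : R) : 0 < r -> (leb2 (sq c r) = (4 * r ^+ 2)%:E)%E.
Proof.
move=> r0; pose I (a : R) : set R := `[a - r, a + r]%classic.
have -> : leb2 (sq c r) = (mu (I c.1) * mu (I c.2))%E.
  by rewrite sqE /leb2 product_measure1E.
have E a : mu (I a) = (2 * r)%:E.
  rewrite /I lebesgue_measure_itv /= lte_fin.
  have -> : a - r < a + r by lra.
  by rewrite -EFinB; congr EFin; ring.
by rewrite !E -EFinM; congr EFin; ring.
Qed.

(** The one-dimensional bound along the row through x and then along each column, joined by Tonelli;
    each pass contributes C/r. *)
Lemma ev_le_integral_sq n : exists2 C : R, 0 < C & forall P (c : R * R) (r : R),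
  bsize n P -> 0 < r -> (forall x, sq c r x -> 0 <= ev P x) ->
  forall x, sq c r x -> ((ev P x)%:E <= (C / r ^+ 2)%:E * \int[leb2]_(y in sq c r) (ev P y)%:E)%E.
Proof.
have [C C0 hC] := poly_le_integral n.
exists (C ^+ 2); first exact: exprn_gt0.
move=> P c r sP r0 P0 [x1 x2] [/= h1 h2].
pose g := (EFin \o ev P) \_ (sq c r).
have mg : measurable_fun setT g.
  apply/(measurable_restrictT _ (measurable_sq c r)); apply/measurable_EFinP.
  by apply: measurable_funTS; exact: measurable_ev.
have g0 y : (0 <= g y)%E.
  by rewrite /g patchE; case: ifPn => //; rewrite inE => /P0; rewrite lee_fin.
have mF := measurable_fun_fubini_tonelli_F (m2 := mu) _ mg g0.
have gE s t : `|s - c.1| <= r -> g (s, t) = ((fun t => (ev P (s, t))%:E) \_ `[(c.2 - r)%R, (c.2 + r)%R]) t.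
  move=> hs; rewrite /g !patchE mem_setE in_itv /= -ler_distl.
  case: ifPn => [|/negP ns]; first by rewrite inE => -[_ /= ->].
  by case: ifPn => // ht; exfalso; apply: ns; rewrite inE.
have FE s : `|s - c.1| <= r -> fubini_F mu g s = (\int[mu]_(t in `[(c.2 - r)%R, (c.2 + r)%R]) (ev P (s, t))%:E)%E.
  by move=> hs; rewrite /fubini_F [RHS]integral_mkcond; apply: eq_integral => t _; exact: gE.
have Cr0 : 0 <= C / r by rewrite divr_ge0 ?ltW.
have [q sizeq [qE _]] := @ev_row R P x2 n sP.
have S1 : ((ev P (x1, x2))%:E <= (C / r)%:E * \int[mu]_(s in `[(c.1 - r)%R, (c.1 + r)%R]) (ev P (s, x2))%:E)%E.
  rewrite qE; under eq_integral => s _ do rewrite qE.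
  by apply: hC => // t ht; rewrite -qE; exact: P0.
apply: (le_trans S1).
have -> : (C ^+ 2 / r ^+ 2)%:E = ((C / r)%:E * (C / r)%:E)%E.
  by rewrite -EFinM -expr2 expr_div_n.
rewrite -[leRHS]muleA; apply: lee_wpmul2l; first by rewrite lee_fin.
have -> : (\int[leb2]_(y in sq c r) (ev P y)%:E = \int[mu]_s fubini_F mu g s)%E.
  rewrite integral_mkcond /leb2; exact: (@fubini_tonelli1 _ _ _ _ _ mu mu g mg g0).
rewrite -(ge0_integralZl mu measurableT mF); last 2 first.
- by move=> s _; apply: integral_ge0 => t _; exact: g0.
- by rewrite lee_fin.
apply: (@le_trans _ _ (\int[mu]_(s in `[(c.1 - r)%R, (c.1 + r)%R]) ((C / r)%:E * fubini_F mu g s))%E); last first.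
  apply: ge0_subset_integral => //.
    by apply: measurable_funeM; exact: mF.
  by move=> s _; apply: mule_ge0; rewrite ?lee_fin//; apply: integral_ge0 => t _; exact: g0.
apply: ge0_le_integral => //.
- by move=> s; rewrite /= in_itv /= -ler_distl lee_fin => hs; exact: P0.
- apply/measurable_EFinP/measurable_funTS.
  under eq_fun do rewrite qE; apply: continuous_measurable_fun; exact: continuous_horner.
- by apply: measurable_funTS; apply: measurable_funeM; exact: mF.
- move=> s; rewrite /= in_itv /= -ler_distl => hs; rewrite FE//.
  have [p sizep [pE _]] := @ev_col R P s n sP.
  rewrite pE; under eq_integral => t _ do rewrite pE.
  by apply: hC => // t ht; rewrite -pE; exact: P0.
Qed.

End IntegralBounds.

Section SegmentBound.
Context {R : realType}.
Implicit Types (P : {poly {poly R}}).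

Lemma ev_line_poly n P (a b c d : R) : bsize n P ->
  exists2 q : {poly R}, (size q <= n + n)%N & forall t, ev P (line a b c d t) = q.[t].
Proof.
pose l (u w : R) : {poly R} := u%:P * 'X + w%:P.
move=> [P1 P2]; exists (\sum_(i < n) (P`_i \Po l b a) * l d c ^+ i).
  have S (u w : R) : (size (l u w) <= 2)%N.
    rewrite (leq_trans (size_polyD _ _))// geq_max (leq_trans (size_polyC_leq1 _)) ?andbT//.
    by rewrite mul_polyC (leq_trans (size_scale_leq _ _))// size_polyX.
  rewrite (leq_trans (size_sum _ _ _))//; apply/bigmax_leqP => i _.
  have n0 : (0 < n)%N by exact: leq_ltn_trans (ltn_ord i).
  have s1 : (size ((P`_i)%R \Po l b a) <= n)%N.
    have [->|q0] := eqVneq (P`_i) 0; first by rewrite comp_poly0 size_poly0.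
    rewrite (leq_trans (size_comp_poly_leq _ _))// (leq_trans _ (P2 i))//.
    have := size_poly_gt0 (P`_i); rewrite q0; case: (size (P`_i)) => // m _ /=.
    by rewrite ltnS -[leqRHS]muln1 leq_mul2l; case: (size _) (S b a) => [|[|[|]]]//; rewrite orbT.
  have s2 : (size (l d c ^+ i)%R <= n)%N.
    rewrite (leq_trans (size_poly_exp_leq _ _))// (leq_ltn_trans _ (ltn_ord i))//.
    by rewrite -[leqRHS]mul1n leq_mul2r; case: (size _) (S d c) => [|[|[|]]]//; rewrite orbT.
  by rewrite (leq_trans (size_polyMleq _ _))// (leq_trans (leq_pred _))// leq_add.
move=> t; rewrite /ev (horner_coef_wide _ P1) !horner_sum; apply: eq_bigr => i _.
rewrite !hornerM horner_comp !horner_exp /l !hornerE /line /=.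
by congr (_.[_] * _ ^+ _); rewrite addrC.
Qed.

(** Differentiation is with respect to the parameter in [0, 1], that is along the unnormalised edge
    vector, so no negative power of the edge length appears. *)
Lemma line_derive_bound n : exists2 C : R, 0 < C & forall P (a b c d m : R), bsize n P ->
  (forall t, 0 <= t <= 1 -> `|ev P (line a b c d t)| <= m) ->
  forall t, 0 <= t <= 1 ->
  `|b * ev (dX P) (line a b c d t) + d * ev (dY P) (line a b c d t)| <= C * m.
Proof.
have [C C0 hC] := @poly_extension_bound R (n + n) 1 ler01.
exists C => // P a b c d m sP hm t t01.
have [q sq qE] := ev_line_poly a b c d sP.
have -> : b * ev (dX P) (line a b c d t) + d * ev (dY P) (line a b c d t) = q^`().[t].
  have [_ <-] := is_derive_line P a b c d t.
  have -> : (fun t => ev P (line a b c d t)) = horner q by apply/funext.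
  by rewrite derivE derive1E.
have [||_ //] := hC q m sq _ t; first by move=> s s01; rewrite -qE; exact: hm.
by move/andP: t01 => [t0 t1]; rewrite ger0_norm.
Qed.

End SegmentBound.

(** * Inverse inequalities on cells *)

Section CellBounds.
Context {R : realType}.
Implicit Types (P : {poly {poly R}}).

(** Shape regularity and quasi-uniformity in one condition: with the same r for all cells, each cell
    lies between two concentric squares of ratio L. Inverse inequalities then need no map to a
    reference triangle. *)
Definition inscribed (T : mesh R) (c : 'I_(ntri T) -> pt R) (r L : R) :=
  forall i, sq (c i) r `<=` (cell i)° /\ cell i `<=` sq (c i) (L * r).

Lemma cell_bernstein n (L : R) : 1 <= L -> exists2 C : R, 0 < C &
  forall (T : mesh R) c (r : R), 0 < r -> @inscribed T c r L ->
  forall i P (m : R), bsize n P -> (forall x, sq (c i) r x -> `|ev P x| <= m) ->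
  forall x, cell i x -> `|ev P x| <= C * m /\ forall k, `|ev (dpoly k P) x| <= C / r * m.
Proof.
move=> L1; have [C C0 hC] := @bernstein_square R n L L1; exists C => // T c r r0 ins i P m sP hm x cx.
have [||A B D] := hC P m (c i) r sP r0 _ x; [exact: hm|exact: (ins i).2|].
by split=> // k; rewrite /dpoly; case: ifP.
Qed.

(** On the inscribed square the maximum is bounded by the integral over that square, hence over the
    cell; [cell_bernstein] then extends the bound to the whole cell. *)
Lemma cell_integral_bound n (L : R) : 1 <= L -> exists2 C : R, 0 < C &
  forall Omega (T : mesh R) c (r : R), conforming_triangulation Omega T -> 0 < r -> @inscribed T c r L ->
  forall (i : 'I_(ntri T)) P, bsize n P -> (forall x, cell i x -> 0 <= ev P x) ->
  forall x, cell i x -> ev P x <= C / r ^+ 2 * cint i P.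
Proof.
move=> L1; have [C C0 hC] := cell_bernstein n L1.
have [C' C'0 hC'] := @ev_le_integral_sq R n.
exists (C * C'); first exact: mulr_gt0.
move=> Omega T c r hT r0 ins i P sP P0 x cx.
have Scell y : sq (c i) r y -> cell i y by move=> /(ins i).1 /interior_subset.
have b y : sq (c i) r y -> `|ev P y| <= C' / r ^+ 2 * cint i P.
  move=> sy; rewrite ger0_norm; last by apply: P0; exact: Scell.
  rewrite -lee_fin; apply: (le_trans (hC' P (c i) r sP r0 _ y sy)).
    by move=> z sz; apply: P0; exact: Scell.
  rewrite (EFinM (C' / r ^+ 2)); apply: lee_wpmul2l.
    by rewrite lee_fin divr_ge0 ?sqr_ge0// ltW.
  rewrite /cint /Rintegral fineK; last first.
    apply: integrable_fin_num; first exact: (measurable_cell hT).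
    exact: (cell_integrable hT).
  apply: ge0_subset_integral => //.
  - exact: measurable_sq.
  - exact: (measurable_cell hT).
  - by apply/measurable_EFinP/measurable_funTS; exact: measurable_ev.
have [h _] := hC T c r r0 ins i P _ sP b x cx.
apply: (le_trans (ler_norm _)); apply: (le_trans h).
by rewrite !mulrA.
Qed.

(** Comparison of areas: the inscribed squares are disjoint, have area 4 r^2 each, and lie in a box
    of area 4 M^2. *)
Lemma card_cells Omega (T : mesh R) c (r L M : R) : conforming_triangulation Omega T ->
  0 < r -> 0 <= M -> @inscribed T c r L -> (forall i : 'I_(ntri T), cell i `<=` box M) ->
  (ntri T)%:R * r ^+ 2 <= M ^+ 2.
Proof.
move=> hT r0 M0 ins bM.
have tI : trivIset setT (fun i => sq (c i) r).
  apply/trivIsetP => i j _ _ ij; apply/seteqP; split=> // x [xi xj].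
  apply: (cell_interior_disjoint hT ij ((ins i).1 _ xi)).
  exact: interior_subset ((ins j).1 _ xj).
have H : (leb2 (\big[setU/set0]_(i < ntri T) sq (c i) r) <= leb2 (box M))%E.
  apply: le_measure; rewrite ?inE.
  - by apply: bigsetU_measurable => i _; exact: measurable_sq.
  - exact: measurable_box.
  - elim/big_ind: _ => [//|A B hA hB x [/hA|/hB]//|i _ x xi].
    by apply: (bM i); apply: interior_subset; exact: ((ins i).1 _ xi).
have mS i : measurable (sq (c i) r) by exact: measurable_sq.
have E := measure_bigsetU_ord ((@lebesgue_measure R) \x (@lebesgue_measure R))%E xpredT mS tI.
move: H; rewrite leb2_box// /leb2 E (eq_bigr (fun=> (4 * r ^+ 2)%:E)); last by move=> i _; exact: leb2_sq.
rewrite sumEFin lee_fin sumr_const card_ord -mulr_natl; nra.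
Qed.

End CellBounds.

Section EdgeTermBounds.
Context {R : realType} (T : mesh R).
Implicit Types (x y : pt R) (i j : 'I_(ntri T)) (a b : 'I_3) (P Q X Y F : {poly {poly R}}).

Lemma normr_sg_le1 (z : R) : `|Num.sg z| <= 1.
Proof. by rewrite normr_sg; case: (z != 0). Qed.

Lemma eflux_le i a P Q (m : R) : (forall t, 0 <= t <= 1 ->
    `|ev (nupoly (edge_src i a) (edge_tgt i a) P Q) (segpt (edge_src i a) (edge_tgt i a) t)| <= m) ->
  `|eflux i a P Q| <= m.
Proof.
move=> h; rewrite /eflux normrM -[leRHS]mul1r ler_pM ?normr_sg_le1//.
exact: eint_le.
Qed.

(** The factor 4 counts two components of the normal, each multiplied by a sum of two products. *)
Lemma eterm_le i a X Y F (z al be ga : R) :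
  `|(edge_tgt i a).1 - (edge_src i a).1| <= z -> `|(edge_tgt i a).2 - (edge_src i a).2| <= z ->
  (forall t, 0 <= t <= 1 -> let x := segpt (edge_src i a) (edge_tgt i a) t in
     [/\ forall k l, `|ev (dpoly k (dpoly l Y)) x| <= al,
         forall k, `|ev (dpoly k X) x| <= be & `|ev F x| <= ga]) ->
  `|eterm i a Y X F| <= 4 * z * al * be * ga.
Proof.
move=> z1 z2 h; apply: eflux_le => t t01.
have [/= hY hX hF] := h t t01; set x := segpt _ _ _ in hY hX hF *.
have [[Y1 Y2] Y3] := (hY ord0 ord0, hY ord0 ord_max, hY ord_max ord_max).
have [X1 X2] := (hX ord0, hX ord_max).
rewrite /dpoly /= in Y1 Y2 Y3 X1 X2.
have E (a1 a2 b1 b2 : R) : `|a1| <= al -> `|b1| <= be -> `|a2| <= al -> `|b2| <= be ->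
    `|a1 * b1 - a2 * b2| <= 2 * al * be.
  move=> A1 B1 A2 B2; rewrite (le_trans (ler_normB _ _))// !normrM.
  have := ler_pM (normr_ge0 _) (normr_ge0 _) A1 B1.
  by have := ler_pM (normr_ge0 _) (normr_ge0 _) A2 B2; lra.
have C1 : `|ev (cof1 Y X) x| <= 2 * al * be by rewrite /cof1 evB !evM; exact: E.
have C2 : `|ev (cof2 Y X) x| <= 2 * al * be by rewrite /cof2 evB !evM; exact: E.
have D (u w : R) : `|u| <= z -> `|w| <= 2 * al * be -> `|u * (w * ev F x)| <= 2 * z * al * be * ga.
  move=> hu hw; rewrite mulrA normrM.
  have -> : 2 * z * al * be * ga = (z * (2 * al * be)) * ga by ring.
  by rewrite ler_pM// normrM ler_pM.
rewrite /nupoly evD !(evM, evC) (le_trans (ler_normD _ _))//.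
have -> : 4 * z * al * be * ga = 2 * z * al * be * ga + 2 * z * al * be * ga by ring.
rewrite lerD//; apply: D => //.
by rewrite distrC.
Qed.

End EdgeTermBounds.

Section Stability.
Context {R : realType}.
Implicit Types (P : {poly {poly R}}).

(* The normal component of the cofactor of D^2 X is the tangential derivative of
   the rotated gradient of X, so a one-dimensional Markov inequality along the
   edge bounds it by DX alone. *)
Lemma eterm_tangential n : exists2 C : R, 0 < C &
  forall (T : mesh R) (i : 'I_(ntri T)) (a : 'I_3) (X Y F : {poly {poly R}}) (be et ga : R), bsize n X ->
  (forall t, 0 <= t <= 1 -> let x := segpt (edge_src i a) (edge_tgt i a) t in
     [/\ forall k, `|ev (dpoly k X) x| <= be,
         forall k, `|ev (dpoly k Y) x| <= et & `|ev F x| <= ga]) ->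
  `|eterm i a X Y F| <= 2 * C * be * et * ga.
Proof.
have [C C0 hC] := @line_derive_bound R n; exists C => // T i a X Y F be et ga sX h.
apply: eflux_le => t t01; have [/= hX hY hF] := h t t01; set x := segpt _ _ _ in hX hY hF *.
set p := edge_src i a in x hX hY hF *; set q := edge_tgt i a in x hX hY hF *.
have T1 k : `|(q.1 - p.1) * ev (dX (dpoly k X)) x + (q.2 - p.2) * ev (dY (dpoly k X)) x| <= C * be.
  rewrite /x segpt_line; apply: hC t01; first exact: bsize_dpoly.
  by move=> s s01; rewrite -segpt_line; have [/= /(_ k)] := h s s01.
have T2 := T1 ord0; have {}T1 := T1 ord_max; rewrite /dpoly /= in T1 T2.
have [Y1 Y2] := (hY ord0, hY ord_max); rewrite /dpoly /= in Y1 Y2.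
have -> : ev (nupoly p q (cof1 X Y * F) (cof2 X Y * F)) x =
  (ev (dX Y) x * ((q.1 - p.1) * ev (dX (dY X)) x + (q.2 - p.2) * ev (dY (dY X)) x) -
   ev (dY Y) x * ((q.1 - p.1) * ev (dX (dX X)) x + (q.2 - p.2) * ev (dY (dX X)) x)) * ev F x.
  by rewrite /nupoly /cof1 /cof2 !(evB, evD, evM, evC) -dXY; ring.
have -> : 2 * C * be * et * ga = (et * (C * be) + et * (C * be)) * ga by ring.
rewrite normrM ler_pM// (le_trans (ler_normB _ _))// !normrM lerD// ler_pM//.
Qed.

Definition h1poly P : {poly {poly R}} := P * P + (dX P * dX P + dY P * dY P).

Lemma h1poly_ge0 P x : 0 <= ev (h1poly P) x.
Proof. by rewrite /h1poly !evD !evM -!expr2 !addr_ge0 ?sqr_ge0. Qed.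

Lemma bsize_h1poly n P : bsize n P -> bsize (n + n) (h1poly P).
Proof.
move=> sP; have sX := bsize_dX sP; have sY := bsize_dY sP.
by apply: bsizeD; [exact: bsizeM|apply: bsizeD; exact: bsizeM].
Qed.

Definition continuous_across (T : mesh R) (W : 'I_(ntri T) -> {poly {poly R}}) :=
  forall i j x, cell i x -> cell j x -> ev (W i) x = ev (W j) x.

Definition vanishing_trace Omega (T : mesh R) (W : 'I_(ntri T) -> {poly {poly R}}) :=
  forall i x, cell i x -> bdry Omega x -> ev (W i) x = 0.

Lemma sum_edges0 (T : mesh R) : sum_edges (fun (i : 'I_(ntri T)) a j b => 0 : R) = 0.
Proof.
by rewrite /sum_edges big1// => i _; rewrite big1// => j _; rewrite big1// => a _; rewrite big1.
Qed.

(* The divergence theorem applied to the field (x1 W^2, 0). *)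
Lemma poincare Omega (T : mesh R) (M : R) (W : 'I_(ntri T) -> {poly {poly R}}) :
  conforming_triangulation Omega T -> (forall i : 'I_(ntri T), cell i `<=` box M) ->
  continuous_across W -> vanishing_trace Omega W ->
  \sum_i cint i (h1poly (W i)) <=
  (1 + 4 * M ^+ 2) * \sum_i cint i (dX (W i) * dX (W i) + dY (W i) * dY (W i)).
Proof.
move=> hT bM Wc W0.
have D := @divergence_mesh R Omega T hT (fun i => 'X%:P * (W i * W i)) (fun=> 0).
have {}D : \sum_i cint i (W i * W i) + \sum_i cint i (2%:P%:P * ('X%:P * (W i * dX (W i)))) = 0.
  rewrite -big_split -[RHS](sum_edges0 T).
  transitivity (sum_edges (fun (i : 'I_(ntri T)) a j b =>
     eflux i a ('X%:P * (W i * W i) - 'X%:P * (W j * W j)) (0 - 0))).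
    rewrite -D; last by move=> i x cx bx; rewrite !evM (W0 i x)// ev0 !mul0r mulr0.
    apply: eq_bigr => i _ /=; rewrite -(cintD hT) /cint; apply: eq_Rintegral => x _.
    by rewrite !(dXM, dXC, dY0, derivX) !(evD, evM, evC, ev0); ring.
  apply: eq_sum_edges => i a j b ij s; rewrite -(eflux0 i a); apply: eflux_eq => t t01 /=.
  rewrite !(evB, evM, ev0) (Wc i j) ?subrr//; first exact: (edge_cell hT).
  exact: (partner_cell hT s).
have H : \sum_i cint i (W i * W i) <= 4 * M ^+ 2 *
    \sum_i cint i (dX (W i) * dX (W i) + dY (W i) * dY (W i)).
  (* Young's inequality, in the form (w + 2 x g)^2 >= 0; the weight 1/2 on W^2 lets that term be
     absorbed by the left-hand side. *)
  have E : - (\sum_i cint i (2%:P%:P * ('X%:P * (W i * dX (W i))))) <=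
     2^-1 * (\sum_i cint i (W i * W i)) + 2 * M ^+ 2 *
      \sum_i cint i (dX (W i) * dX (W i) + dY (W i) * dY (W i)).
    rewrite !mulr_sumr -sumrN -big_split; apply: ler_sum => i _ /=.
    rewrite -!(cintZ hT) -(cintN hT) -(cintD hT); apply: (le_cint hT) => x cx.
    have /boxP[x1 _] := bM i x cx.
    rewrite !(evD, evN, evM, evC, evX1).
    have x2 : x.1 ^+ 2 <= M ^+ 2 by rewrite -[x.1 ^+ 2]real_normK ?num_real// lerXn2r// nnegrE (le_trans _ x1).
    set w := ev (W i) x; set g := ev (dX (W i)) x; set g' := ev (dY (W i)) x.
    have g2 : x.1 ^+ 2 * g ^+ 2 <= M ^+ 2 * g ^+ 2 by rewrite ler_wpM2r ?sqr_ge0.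
    have g3 : 0 <= M ^+ 2 * g' ^+ 2 by rewrite mulr_ge0 ?sqr_ge0.
    have sq0 : 0 <= (w + 2 * x.1 * g) ^+ 2 by rewrite sqr_ge0.
    nra.
  by move: E D; lra.
have -> : \sum_i cint i (h1poly (W i)) = \sum_i cint i (W i * W i) +
   \sum_i cint i (dX (W i) * dX (W i) + dY (W i) * dY (W i)).
  by rewrite -big_split; apply: eq_bigr => i _; rewrite /h1poly (cintD hT).
lra.
Qed.

End Stability.

Section DiscreteStability.
Context {R : realType}.

Lemma eq_ler (a b : R) : a = b -> a <= b.
Proof. by move=> ->. Qed.

Lemma sqr_le_norm (a b : R) : 0 <= b -> a * a <= b ^+ 2 -> `|a| <= b.
Proof.
by move=> b0 h; rewrite -(@ler_pXn2r _ 2%N) ?nnegrE// real_normK ?num_real// expr2.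
Qed.

Lemma dpolyD k (P Q : {poly {poly R}}) : dpoly k (P + Q) = dpoly k P + dpoly k Q.
Proof. by rewrite /dpoly; case: ifP => _; rewrite ?dXD ?dYD. Qed.
Lemma dpolyB k (P Q : {poly {poly R}}) : dpoly k (P - Q) = dpoly k P - dpoly k Q.
Proof. by rewrite /dpoly; case: ifP => _; rewrite ?dXB ?dYB. Qed.
Lemma dpoly_half k (P : {poly {poly R}}) : dpoly k (halfp * P) = halfp * dpoly k P.
Proof. by rewrite /dpoly; case: ifP => _; rewrite ?dX_half ?dY_half. Qed.

Lemma edge_src_cell Omega (T : mesh R) (hT : conforming_triangulation Omega T)
  (i : 'I_(ntri T)) a : cell i (edge_src i a).
Proof.
have -> : edge_src i a = segpt (edge_src i a) (edge_tgt i a) 0.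
  by rewrite /segpt !subr0 !mul1r !mul0r !addr0 -surjective_pairing.
by apply: (edge_cell hT); rewrite lexx ler01.
Qed.

Lemma edge_tgt_cell Omega (T : mesh R) (hT : conforming_triangulation Omega T)
  (i : 'I_(ntri T)) a : cell i (edge_tgt i a).
Proof.
have -> : edge_tgt i a = segpt (edge_src i a) (edge_tgt i a) 1.
  by rewrite /segpt !subrr !mul1r !mul0r !add0r -surjective_pairing.
by apply: (edge_cell hT); rewrite lexx ler01.
Qed.

Lemma edge_vector_le Omega (T : mesh R) c (r L : R) (i : 'I_(ntri T)) a :
  conforming_triangulation Omega T -> @inscribed R T c r L ->
  `|(edge_tgt i a).1 - (edge_src i a).1| <= 2 * (L * r) /\
  `|(edge_tgt i a).2 - (edge_src i a).2| <= 2 * (L * r).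
Proof.
move=> hT ins.
have [s1 s2] := (ins i).2 _ (edge_src_cell hT i a).
have [t1 t2] := (ins i).2 _ (edge_tgt_cell hT i a).
have E (u v w m : R) : `|u - w| <= m -> `|v - w| <= m -> `|v - u| <= 2 * m.
  by rewrite !ler_norml => /andP[? ?] /andP[? ?]; apply/andP; split; lra.
by split; [exact: (E _ _ _ _ s1 t1)|exact: (E _ _ _ _ s2 t2)].
Qed.

Lemma cint_le_cst Omega (T : mesh R) c (r L m : R) (i : 'I_(ntri T)) P :
  conforming_triangulation Omega T -> 0 < L * r -> @inscribed R T c r L -> 0 <= m ->
  (forall x, cell i x -> ev P x <= m) -> cint i P <= 4 * (L * r) ^+ 2 * m.
Proof.
move=> hT r0 ins m0 h.
apply: (@le_trans _ _ (cint i m%:P%:P)); first by apply: (le_cint hT) => x cx; rewrite evC h.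
rewrite /cint.
have -> : \int[leb2]_(x in cell i) ev m%:P%:P x = \int[leb2]_(x in cell i) cst m x.
  by apply: eq_Rintegral => x _; rewrite evC.
rewrite /leb2 Rintegral_cst; last exact: (measurable_cell hT).
rewrite mulrC ler_wpM2r//.
have lc : (leb2 (cell i) <= (4 * (L * r) ^+ 2)%:E)%E.
  rewrite -(leb2_sq (c i) r0); apply: le_measure; rewrite ?inE.
  - exact: (measurable_cell hT).
  - exact: measurable_sq.
  - exact: (ins i).2.
have l0 : (0 <= leb2 (cell i))%E by rewrite /leb2 measure_ge0.
by rewrite -lee_fin fineK ?ge0_fin_numE//; exact: le_lt_trans lc (ltry _).
Qed.

Lemma norm_avg_le (m m' y y' : R) : `|y| <= m -> `|y'| <= m' -> `|(y + y') / 2| <= (m + m') / 2.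
Proof. by rewrite !ler_norml => /andP[? ?] /andP[? ?]; apply/andP; split; lra. Qed.

Lemma norm_diff_le (m m' y y' : R) : `|y| <= m -> `|y'| <= m' -> `|y - y'| <= m + m'.
Proof. by rewrite !ler_norml => /andP[? ?] /andP[? ?]; apply/andP; split; lra. Qed.

Lemma edge_product_le (z a b : R) : 0 <= z -> z * ((a + b) * a) <= z * (2 * (a ^+ 2 + b ^+ 2)).
Proof.
move=> z0; apply: ler_wpM2l => //.
have := sqr_ge0 (a - b); have := sqr_ge0 b; have := sqr_ge0 a; nra.
Qed.

(** A substitute for dividing by the square root of N, which might be zero: s = 2 B / b makes the
    term in N on the right equal to half of the left side. *)
Lemma ler_quadratic_root (N b B c : R) : 0 < b -> 0 < B -> 0 < c ->
  (forall s, 0 < s -> b * N <= B * (c ^+ 2 * s + N / s)) -> 0 <= N -> N <= 4 * (B * c / b) ^+ 2.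
Proof.
move=> b0 B0 c0 h N0; have s0 : 0 < 2 * B / b by rewrite divr_gt0// mulr_gt0.
have := h _ s0.
have -> : B * (c ^+ 2 * (2 * B / b) + N / (2 * B / b)) = 2 * (B * c) ^+ 2 / b + b * N / 2.
  by field; rewrite !gt_eqF.
move=> hh; rewrite -(ler_pM2l b0).
have -> : b * (4 * (B * c / b) ^+ 2) = 2 * (2 * (B * c) ^+ 2 / b) by field; rewrite gt_eqF.
lra.
Qed.

Lemma young_le (a b : R) : a * b <= b ^+ 2 + a ^+ 2.
Proof. by have := sqr_ge0 (a - b); have := sqr_ge0 b; have := sqr_ge0 a; nra. Qed.

(** An energy argument with test function W. The field [G] is a single-valued gradient close to that
    of U on every cell, which makes the jumps of DU small. The constants [K] and [kap] are chosen
    before the mesh. *)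
Lemma discrete_stability n (L M al : R) : 1 <= L -> 0 < M -> 0 < al ->
  exists K kap : R, [/\ 0 < K, 0 < kap &
    forall Omega (T : mesh R) c (r : R), conforming_triangulation Omega T -> 0 < r ->
    @inscribed R T c r L -> (forall i : 'I_(ntri T), cell i `<=` box M) ->
    forall (U E W : 'I_(ntri T) -> {poly {poly R}}) (G : 'I_2 -> pt R -> R) (del del' : R),
    (forall i, [/\ bsize n (U i), bsize n (E i) & bsize n (W i)]) ->
    continuous_across W -> vanishing_trace Omega W ->
    (forall i x k, cell i x -> `|ev (dpoly k (U i)) x - G k x| <= del) ->
    (forall i x k, cell i x -> `|ev (dpoly k (E i)) x| <= del') ->
    (forall i x s t, cell i x -> al * (s ^+ 2 + t ^+ 2) <=
       ev (dY (dY (U i))) x * s ^+ 2 - 2 * ev (dX (dY (U i))) x * s * t + ev (dX (dX (U i))) x * t ^+ 2) ->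
    0 <= del -> 0 < del' -> del <= kap * r ^+ 2 ->
    dMApoly U W W = MAremainder E W ->
    \sum_i cint i (h1poly (W i)) <= (K * (del' ^+ 2 / r ^+ 2)) ^+ 2].
Proof.
move=> L1 M0 al0; have L0 : 0 < L by lra.
have [C1 C10 hC1] := @cell_integral_bound R (n + n) L L1.
have [C2 C20 hC2] := @cell_bernstein R n L L1.
have [C3 C30 hC3] := @eterm_tangential R n.
pose Cp : R := 1 + 4 * M ^+ 2.
have Cp0 : 0 < Cp by rewrite /Cp; have := sqr_ge0 M; lra.
(* Coercivity and the Poincare inequality give 2 * [bet] times the squared H^1 norm; half of this is
   spent on the edge terms. *)
pose bet := al / (2 * Cp).
have bet0 : 0 < bet by rewrite divr_gt0// mulr_gt0.
(* The coefficients of the two indefinite edge terms, [edge1] and [edge2] below. *)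
pose K1 := 12 * C3 + 48 * L * C2.
have LC20 : 0 < L * C2 by exact: mulr_gt0.
have K10 : 0 < K1 by rewrite /K1 -mulrA; lra.
(* The edge part and the determinant part of the remainder. *)
pose K2 := 48 * L * C2 + 8 * L ^+ 2 * C2 ^+ 2.
have K20 : 0 < K2.
  by rewrite /K2 -!mulrA; have := mulr_ge0 (sqr_ge0 L) (sqr_ge0 C2); lra.
(* The second constant is what K1 * del * S <= bet * N2 requires, since S = C1 * N2 / r^2. The first
   is the output of [ler_quadratic_root] with c = M * (1 + C1). *)
exists (2 * K2 * M * (1 + C1) / bet), (bet / (K1 * C1)); split.
- by rewrite divr_gt0// !mulr_gt0//; lra.
- by rewrite divr_gt0// mulr_gt0.
move=> Omega T c r hT r0 ins bM U E W G del del' sz Wc W0 hU hE coer del0 del'0 small eqn.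
have r2 : 0 < r ^+ 2 by rewrite exprn_gt0.
have N0 i : 0 <= cint i (h1poly (W i)) by apply: cint_ge0 => x _; exact: h1poly_ge0.
(* [sg i] bounds |W| and its first derivatives on cell i: the inverse inequality is applied to the
   polynomial W^2 + |DW|^2, which is nonnegative. *)
have [sg [s0 s2]] : exists sg : 'I_(ntri T) -> R, (forall i, 0 <= sg i) /\
    forall i, sg i ^+ 2 = C1 / r ^+ 2 * cint i (h1poly (W i)).
  exists (fun i => Num.sqrt (C1 / r ^+ 2 * cint i (h1poly (W i)))).
  by split=> i; rewrite ?sqrtr_ge0// sqr_sqrtr// mulr_ge0// divr_ge0 ?ltW.
have sqcell i x : sq (c i) r x -> cell i x by move=> /(ins i).1 /interior_subset.
have nodeH i x : cell i x -> ev (h1poly (W i)) x <= sg i ^+ 2.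
  move=> cx; rewrite s2; apply: (hC1 Omega T c r hT r0 ins i _ _ _ x cx).
    by apply: bsize_h1poly; have [] := sz i.
  by move=> y _; exact: h1poly_ge0.
have nodeW i x : cell i x -> `|ev (W i) x| <= sg i.
  move=> cx; apply: sqr_le_norm => //; apply: le_trans (nodeH i x cx).
  by rewrite /h1poly !evD !evM lerDl -!expr2 addr_ge0// sqr_ge0.
have nodeD i x k : cell i x -> `|ev (dpoly k (W i)) x| <= sg i.
  move=> cx; apply: sqr_le_norm => //; apply: le_trans (nodeH i x cx).
  rewrite /h1poly !evD !evM /dpoly; case: ifP => _.
    by rewrite addrCA lerDl -!expr2 addr_ge0 ?sqr_ge0.
  by rewrite addrA lerDr -!expr2 addr_ge0 ?sqr_ge0.
have nodeD2 i x k l : cell i x -> `|ev (dpoly k (dpoly l (W i))) x| <= C2 / r * sg i.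
  move=> cx; have [_ _ sW] := sz i.
  have [_ h] := hC2 T c r r0 ins i (dpoly l (W i)) (sg i) (bsize_dpoly _ sW)
    (fun y sy => nodeD i y l (sqcell i y sy)) x cx.
  exact: h.
have nodeE2 i x k l : cell i x -> `|ev (dpoly k (dpoly l (E i))) x| <= C2 / r * del'.
  move=> cx; have [_ sE _] := sz i.
  have [_ h] := hC2 T c r r0 ins i (dpoly l (E i)) del' (bsize_dpoly _ sE)
    (fun y sy => hE i y l (sqcell i y sy)) x cx.
  exact: h.
have jumpU i j x k : cell i x -> cell j x -> `|ev (dpoly k (U i - U j)) x| <= del + del.
  move=> ci cj; rewrite dpolyB evB.
  have -> : ev (dpoly k (U i)) x - ev (dpoly k (U j)) x =
    (ev (dpoly k (U i)) x - G k x) - (ev (dpoly k (U j)) x - G k x) by ring.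
  by apply: norm_diff_le; exact: hU.
(* The factor 1/r of a second derivative is compensated by the length of the edge. *)
have CL : C2 / r * (L * r) = C2 * L by field; rewrite gt_eqF.
pose S := \sum_i sg i ^+ 2.
(* The jump of DU is known to be small only on the edge itself, so its second derivatives must be
   reached by tangential differentiation. *)
have edge1 : `|sum_edges (fun i a j b => eterm i a (U i - U j) (halfp * (W i + W j)) (W i))| <= 12 * C3 * del * S.
  apply: (le_trans (norm_sum_edges _)).
  apply: (@le_trans _ _ (sum_edges (fun (i : 'I_(ntri T)) a j b => 4 * C3 * del * (sg i ^+ 2 + sg j ^+ 2)))).
    apply: le_sum_edges => i a j b ij s.
    have sU : bsize n (U i - U j).
      by have [? _ _] := sz i; have [? _ _] := sz j; exact: bsizeB.
    apply: (le_trans (hC3 T i a _ _ _ (del + del) ((sg i + sg j) / 2) (sg i) sU _)).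
      move=> t t01 x; have ci : cell i x := edge_cell hT i a t01.
      have cj : cell j x := partner_cell hT s t01.
      split=> [k|k|]; [exact: jumpU| |exact: nodeW].
      by rewrite dpoly_half dpolyD ev_half evD; apply: norm_avg_le; exact: nodeD.
    have -> : 2 * C3 * (del + del) * ((sg i + sg j) / 2) * sg i = 2 * (C3 * del) * ((sg i + sg j) * sg i) by field.
    have -> : 4 * C3 * del * (sg i ^+ 2 + sg j ^+ 2) = 2 * (C3 * del) * (2 * (sg i ^+ 2 + sg j ^+ 2)) by ring.
    by apply: edge_product_le; rewrite mulr_ge0// mulr_ge0// ltW.
  rewrite sum_edgesZ.
  have -> : 12 * C3 * del * S = 4 * C3 * del * (3 * S) by ring.
  apply: ler_wpM2l; first by rewrite !mulr_ge0// ltW.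
  by apply: (sum_edges_cells hT) => i; exact: sqr_ge0.
have edge2 : `|sum_edges (fun i a j b => eterm i a (halfp * (W i + W j)) (U i - U j) (W i))| <= 48 * L * C2 * del * S.
  apply: (le_trans (norm_sum_edges _)).
  apply: (@le_trans _ _ (sum_edges (fun (i : 'I_(ntri T)) a j b => 16 * (L * C2) * del * (sg i ^+ 2 + sg j ^+ 2)))).
    apply: le_sum_edges => i a j b ij s.
    have [z1 z2] := edge_vector_le i a hT ins.
    apply: (le_trans (eterm_le (al := C2 / r * ((sg i + sg j) / 2)) (be := del + del) (ga := sg i) z1 z2 _)).
      move=> t t01 x; have ci : cell i x := edge_cell hT i a t01.
      have cj : cell j x := partner_cell hT s t01.
      split=> [k l|k|]; [|exact: jumpU|exact: nodeW].
      rewrite !dpoly_half !dpolyD ev_half evD mulrA mulrDr.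
      by apply: norm_avg_le; exact: nodeD2.
    have -> : 4 * (2 * (L * r)) * (C2 / r * ((sg i + sg j) / 2)) * (del + del) * sg i =
       8 * ((C2 / r * (L * r)) * del) * ((sg i + sg j) * sg i) by field; rewrite gt_eqF.
    have -> : 16 * (L * C2) * del * (sg i ^+ 2 + sg j ^+ 2) =
      8 * ((C2 / r * (L * r)) * del) * (2 * (sg i ^+ 2 + sg j ^+ 2)) by rewrite CL; ring.
    by apply: edge_product_le; rewrite CL !mulr_ge0// ltW.
  rewrite sum_edgesZ.
  have -> : 48 * L * C2 * del * S = 16 * (L * C2) * del * (3 * S) by ring.
  apply: ler_wpM2l; first by rewrite !mulr_ge0// ltW.
  by apply: (sum_edges_cells hT) => i; exact: sqr_ge0.
pose N2 := \sum_i cint i (h1poly (W i)).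
pose D2 := \sum_i cint i (dX (W i) * dX (W i) + dY (W i) * dY (W i)).
have SN : S = C1 / r ^+ 2 * N2 by rewrite /S /N2 mulr_sumr; apply: eq_bigr => i _; exact: s2.
have N20 : 0 <= N2 by apply: sumr_ge0 => i _; exact: N0.
have vol : al * D2 <= \sum_i cint i (cof1 (U i) (W i) * dX (W i) + cof2 (U i) (W i) * dY (W i)).
  rewrite /D2 mulr_sumr; apply: ler_sum => i _; rewrite -(cintZ hT).
  apply: (le_cint hT) => x cx; rewrite /cof1 /cof2 !(evB, evD, evM, evC).
  have := coer i x (ev (dX (W i)) x) (ev (dY (W i)) x) cx.
  rewrite !expr2 => h; apply: (le_trans h).
  by apply: eq_ler; ring.
have pc : N2 <= Cp * D2 by exact: (poincare hT bM Wc W0).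
have rem : MAremainder E W <= K2 * del' ^+ 2 * \sum_i sg i.
  rewrite /MAremainder.
  have e1 : sum_edges (fun i a j b => eterm i a (halfp * (E i + E j)) (E i - E j) (W i)) <=
      48 * L * C2 * del' ^+ 2 * \sum_i sg i.
    apply: (le_trans (ler_norm _)); apply: (le_trans (norm_sum_edges _)).
    apply: (@le_trans _ _ (sum_edges (fun (i : 'I_(ntri T)) a j b => 16 * (L * C2) * del' ^+ 2 * (sg i + sg j)))).
      apply: le_sum_edges => i a j b ij s.
      have [z1 z2] := edge_vector_le i a hT ins.
      apply: (le_trans (eterm_le (al := C2 / r * del') (be := del' + del') (ga := sg i) z1 z2 _)).
        move=> t t01 x; have ci : cell i x := edge_cell hT i a t01.
        have cj : cell j x := partner_cell hT s t01.
        split=> [k l|k|]; last exact: nodeW.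
          rewrite !dpoly_half !dpolyD ev_half evD.
          have := norm_avg_le (nodeE2 i x k l ci) (nodeE2 j x k l cj).
          by rewrite (_ : (C2 / r * del' + C2 / r * del') / 2 = C2 / r * del')//; field; rewrite gt_eqF.
        by rewrite dpolyB evB; apply: norm_diff_le; exact: hE.
      have -> : 4 * (2 * (L * r)) * (C2 / r * del') * (del' + del') * sg i =
        16 * (C2 / r * (L * r)) * del' ^+ 2 * sg i by ring.
      rewrite CL (mulrC C2); apply: ler_wpM2l; last by rewrite lerDl.
      by rewrite !mulr_ge0 ?sqr_ge0// ltW.
    rewrite sum_edgesZ.
    have -> : 48 * L * C2 * del' ^+ 2 * \sum_i sg i = 16 * (L * C2) * del' ^+ 2 * (3 * \sum_i sg i) by ring.
    apply: ler_wpM2l; first by rewrite !mulr_ge0 ?sqr_ge0// ltW.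
    exact: (sum_edges_cells hT).
  (* The two factors 1/r of the second derivatives are compensated by the area of the cell. *)
  have e2 : - \sum_i cint i (detH (E i) * W i) <= 8 * L ^+ 2 * C2 ^+ 2 * del' ^+ 2 * \sum_i sg i.
    rewrite -sumrN mulr_sumr; apply: ler_sum => i _; rewrite -(cintN hT).
    have Lr0 : 0 < L * r by exact: mulr_gt0.
    have m0 : 0 <= 2 * (C2 / r * del') ^+ 2 * sg i by rewrite mulr_ge0// mulr_ge0// sqr_ge0.
    apply: (le_trans (cint_le_cst hT Lr0 ins m0 _)).
      move=> x cx; rewrite evN evM; apply: (le_trans (ler_norm _)); rewrite normrN normrM.
      apply: ler_pM => //; last exact: nodeW.
      have [[a1 a2] a3] := (nodeE2 i x ord0 ord0 cx, nodeE2 i x ord0 ord_max cx, nodeE2 i x ord_max ord_max cx).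
      rewrite /dpoly /= in a1 a2 a3.
      rewrite /detH evB !evM (le_trans (ler_normB _ _))// !normrM.
      have b1 := ler_pM (normr_ge0 _) (normr_ge0 _) a1 a3.
      have b2 := ler_pM (normr_ge0 _) (normr_ge0 _) a2 a2.
      move: b1 b2; set z := C2 / r * del' => b1 b2.
      have -> : 2 * z ^+ 2 = z * z + z * z by ring.
      by rewrite lerD.
    have -> : 4 * (L * r) ^+ 2 * (2 * (C2 / r * del') ^+ 2 * sg i) =
       8 * ((C2 / r * (L * r)) ^+ 2 * del' ^+ 2) * sg i by ring.
    by rewrite CL; apply: eq_ler; ring.
  have -> : K2 * del' ^+ 2 * \sum_i sg i = 48 * L * C2 * del' ^+ 2 * \sum_i sg i +
     8 * L ^+ 2 * C2 ^+ 2 * del' ^+ 2 * \sum_i sg i by rewrite /K2; ring.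
  by rewrite lerD.
have card : (ntri T)%:R * r ^+ 2 <= M ^+ 2 := card_cells hT r0 (ltW M0) ins bM.
(* Cauchy-Schwarz over the at most M^2 / r^2 cells, in additive form with a free weight s, as
   [ler_quadratic_root] expects it. *)
have sums s : 0 < s -> \sum_i sg i <= (M ^+ 2 * s + C1 * N2 / s) / r ^+ 2.
  move=> sp; apply: (@le_trans _ _ (\sum_i (s + sg i ^+ 2 / s))).
    apply: ler_sum => i _; rewrite -(ler_pM2r sp) mulrDl divfK ?gt_eqF// -!expr2.
    exact: young_le.
  rewrite big_split /= sumr_const card_ord -mulr_suml -/S SN -mulr_natl ler_pdivlMr// mulrDl.
  apply: lerD; first by rewrite mulrAC ler_wpM2r// ltW.
  by apply: eq_ler; field; rewrite !gt_eqF.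
have main : bet * N2 <= K2 * del' ^+ 2 * \sum_i sg i.
  apply: le_trans rem; rewrite -eqn /dMApoly.
  have k1 : K1 * del * S <= bet * N2.
    rewrite SN.
    have -> : K1 * del * (C1 / r ^+ 2 * N2) = (K1 * C1) * del / r ^+ 2 * N2 by field; rewrite gt_eqF.
    apply: ler_wpM2r => //; rewrite ler_pdivrMr// mulrC -ler_pdivlMr ?mulr_gt0//.
    by rewrite mulrAC.
  have k2 : 2 * bet * N2 <= al * D2.
    have -> : 2 * bet = al / Cp by rewrite /bet; field; rewrite gt_eqF.
    by rewrite mulrAC ler_pdivrMr// -mulrA (mulrC D2) ler_wpM2l// ltW.
  have K1E : K1 * del * S = 12 * C3 * del * S + 48 * L * C2 * del * S by rewrite /K1; ring.
  move: edge1 edge2 vol; rewrite !ler_norml => /andP[_ u1] /andP[u2 _] vol.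
  rewrite K1E in k1; clear -u1 u2 vol k1 k2.
  move: u1 u2 vol k1 k2; set t1 := sum_edges _; set t2 := sum_edges _; set t3 := \sum_i cint i (_ + _).
  by move: t1 t2 t3 => t1 t2 t3; lra.
have B0 : 0 < K2 * del' ^+ 2 / r ^+ 2 by rewrite divr_gt0// mulr_gt0// exprn_gt0.
have C11 : 0 < 1 + C1 by rewrite addr_gt0.
apply: le_trans (_ : 4 * (K2 * del' ^+ 2 / r ^+ 2 * (M * (1 + C1)) / bet) ^+ 2 <= _); last first.
  by apply: eq_ler; field; rewrite !gt_eqF.
apply: ler_quadratic_root => //; first by rewrite mulr_gt0.
move=> s sp; apply: (le_trans main).
(* Rescaling the weight by 1 + C1 removes the factor C1 from the term in N2, because C1 / (1 + C1)
   <= 1. *)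
have sp1 : 0 < (1 + C1) * s by rewrite mulr_gt0.
have -> : K2 * del' ^+ 2 / r ^+ 2 * ((M * (1 + C1)) ^+ 2 * s + N2 / s) =
  K2 * del' ^+ 2 * (((M * (1 + C1)) ^+ 2 * s + N2 / s) / r ^+ 2) by ring.
apply: ler_wpM2l; first by rewrite mulr_ge0 ?sqr_ge0// ltW.
apply: (le_trans (sums _ sp1)); apply: ler_wpM2r; first by rewrite invr_ge0 ltW.
apply: lerD.
  have -> : (M * (1 + C1)) ^+ 2 * s = M ^+ 2 * ((1 + C1) * ((1 + C1) * s)) by ring.
  by apply: ler_wpM2l; rewrite ?sqr_ge0// ler_peMl ?lerDl ?mulr_ge0 ?ltW.
have -> : C1 * N2 / ((1 + C1) * s) = C1 / (1 + C1) * (N2 / s) by field; rewrite !gt_eqF.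
rewrite ler_piMl//; first by rewrite divr_ge0// ltW.
by rewrite ler_pdivrMr// mul1r lerDr ler01.
Qed.

End DiscreteStability.

(** * Regular meshes *)

Section MeshRegularity.
Context {R : realType}.
Implicit Types (c x y : pt R).

Lemma edist_ge x y : `|x.1 - y.1| <= Defs.edist x y /\ `|x.2 - y.2| <= Defs.edist x y.
Proof.
by rewrite /Defs.edist /eucl /=; split; rewrite -sqrtr_sqr ler_sqrt ?addr_ge0 ?sqr_ge0//
  ?lerDl ?lerDr sqr_ge0.
Qed.

Lemma edist_le x y (a : R) : 0 <= a -> `|x.1 - y.1| <= a / 2 -> `|x.2 - y.2| <= a / 2 ->
  Defs.edist x y <= a.
Proof.
move=> a0 h1 h2; rewrite /Defs.edist /eucl /= -(ger0_norm a0) -sqrtr_sqr ler_sqrt ?sqr_ge0//.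
have e (z : R) : `|z| <= a / 2 -> z ^+ 2 <= a ^+ 2 / 4.
  move=> hz; have -> : a ^+ 2 / 4 = (a / 2) ^+ 2 by field.
  by rewrite -(real_normK (num_real z)) ler_pXn2r ?nnegrE// divr_ge0.
by have := e _ h1; have := e _ h2; have := sqr_ge0 a; lra.
Qed.

Lemma edist_box (M : R) x y : box M x -> box M y -> Defs.edist x y <= 4 * M.
Proof.
move=> /boxP[x1 x2] /boxP[y1 y2]; have M0 : 0 <= M by exact: le_trans x1.
have e (a b : R) : `|a| <= M -> `|b| <= M -> `|a - b| <= 4 * M / 2.
  by move=> ha hb; apply: (le_trans (ler_normB _ _)); lra.
by apply: edist_le; [lra|exact: e|exact: e].
Qed.

Lemma edist_le_diam (A : set (pt R)) (M : R) x y : A `<=` box M -> A x -> A y ->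
  Defs.edist x y <= diam A.
Proof.
move=> AM Ax Ay; apply: ub_le_sup; last by exists x, y.
by exists (4 * M) => _ [z [w [Az Aw ->]]]; apply: edist_box; exact: AM.
Qed.

Lemma diam_mesh_size (T : mesh R) (i : 'I_(ntri T)) : diam (cell i) <= mesh_size T.
Proof. exact: (le_bigmax _ (fun i : 'I_(ntri T) => diam (cell i)) i). Qed.

(** The inradius is a supremum, so only a disc with more than half of that radius is extracted. *)
Lemma inradius_disc (A : set (pt R)) : A !=set0 -> 0 < inradius A ->
  exists c (r : R), [/\ 0 < r, inradius A < 2 * r & forall x, Defs.edist x c <= r -> A x].
Proof.
move=> [a Aa] r0; have S0 : [set r | 0 <= r /\ exists c, [set x | Defs.edist x c <= r] `<=` A] !=set0.
  exists 0; split=> //; exists a => x /=.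
  have [h1 h2] := edist_ge x a => h.
  move: (le_trans h1 h) (le_trans h2 h); rewrite !normr_le0 !subr_eq0 => /eqP e1 /eqP e2.
  by rewrite (surjective_pairing x) e1 e2 -surjective_pairing.
have [|r [_ [c cA]] hr] := @sup_gt _ _ (inradius A / 2) S0; first by rewrite -/(inradius A) ltr_pdivrMr// ltr_pMr// ltr1n.
by exists c, r; split; [lra|lra|exact: cA].
Qed.

Lemma sq_interior (A : set (pt R)) c (r0 r : R) : 0 < r -> r < r0 / 2 ->
  (forall x, Defs.edist x c <= r0 -> A x) -> sq c r `<=` A°.
Proof.
move=> r_0 rr dA x [h1 h2]; rewrite /interior; apply/nbhs_ballP; exists (r0 / 2 - r).
  by rewrite /= subr_gt0.
move=> y [/= y1 y2]; apply: dA; apply: edist_le; first by lra.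
  rewrite -ball_normE/= in y1; move: y1 h1; rewrite ltr_norml !ler_norml => /andP[? ?] /andP[? ?].
  by apply/andP; split; lra.
rewrite -ball_normE/= in y2; move: y2 h2; rewrite ltr_norml !ler_norml => /andP[? ?] /andP[? ?].
by apply/andP; split; lra.
Qed.

Lemma mesh_size_gt0 Omega (T : mesh R) : conforming_triangulation Omega T -> Omega !=set0 ->
  0 < mesh_size T.
Proof.
move=> hT [x Ox]; have [_ cov _] := hT; have : closure Omega x by exact: subset_closure.
rewrite cov => -[i _ _]; apply: lt_le_trans (diam_mesh_size i).
apply: lt_le_trans (edist_le_diam (@cell_boxP _ T i) (edge_src_cell hT i ord0) (edge_tgt_cell hT i ord0)).
exact: (edge_length_gt0 hT).
Qed.

(** The mesh size is at most tau * sg times the inradius, hence less than 2 * tau * sg times the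
    radius r of a disc in the cell; L >= 4 * tau * sg puts the square of half-side h / L inside that
    disc. Its centre belongs to the cell, so the cell lies within distance h = L * (h / L) of it. *)
Lemma regular_inscribed (Th : set (mesh R)) : shape_regular Th -> quasi_uniform Th ->
  exists2 L : R, 1 <= L & forall Omega T, Th T -> conforming_triangulation Omega T ->
    0 < mesh_size T -> exists d, @inscribed R T d (mesh_size T / L) L.
Proof.
move=> [sg sg0 hs] [tau tau0 ht]; exists (Num.max 1 (4 * (tau * sg))); first by rewrite le_max lexx.
set L := Num.max _ _ => Omega T TT hT h0.
have L0 : 0 < L by rewrite lt_max ltr01.
have L4 : 4 * (tau * sg) <= L by rewrite le_max lexx orbT.
have ts0 : 0 < tau * sg by rewrite mulr_gt0.
have disc (i : 'I_(ntri T)) : exists c, sq c (mesh_size T / L) `<=` (cell i)° /\ cell i `<=` sq c (mesh_size T).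
  have cn : cell i !=set0 by exists (edge_src i ord0); exact: (edge_src_cell hT).
  have hi : mesh_size T <= tau * sg * inradius (cell i).
    by rewrite -mulrA; apply: (le_trans (ht T TT i)); rewrite ler_pM2l// hs.
  have in0 : 0 < inradius (cell i).
    by rewrite -(pmulr_rgt0 _ ts0); exact: lt_le_trans hi.
  have [c [r [r0 ir rc]]] := inradius_disc cn in0.
  have cc : cell i c.
    by apply: rc; rewrite /Defs.edist !subrr /eucl /= expr0n /= addr0 sqrtr0 ltW.
  exists c; split.
    apply: sq_interior rc; rewrite ?divr_gt0// ltr_pdivrMr//.
    apply: (le_lt_trans hi).
    apply: (@lt_le_trans _ _ (tau * sg * (2 * r))); first by rewrite ltr_pM2l.
    apply: (@le_trans _ _ (r / 2 * (4 * (tau * sg)))); first by apply: eq_ler; field.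
    by rewrite ler_pM2l// divr_gt0.
  move=> x cx; have := le_trans (edist_le_diam (@cell_boxP _ T i) cx cc) (diam_mesh_size i).
  by have [h1 h2] := edist_ge x c => h; split; [exact: le_trans h1 h|exact: le_trans h2 h].
have [d hd] := choice disc; exists d => i.
have -> : L * (mesh_size T / L) = mesh_size T by rewrite mulrC divfK ?gt_eqF.
exact: hd.
Qed.

(** The hull is the image of the compact simplex of weights under a continuous map. *)
Lemma compact_hull n (p : 'I_n -> pt R) : compact (hull p).
Proof.
pose S : set 'rV[R]_n := [set w | forall i, `[0, 1]%classic (w ord0 i)] `&` [set w | \sum_i w ord0 i = 1].
have csum (F : 'rV[R]_n -> 'I_n -> R) : (forall i, continuous (F ^~ i)) -> continuous (fun w => \sum_i F w i).
  move=> cF; apply: (@continuous_big R _ +%R 0 xpredT _ _ _ (fun i w => F w i)) => [|i _]; last exact: cF.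
  exact: (@add_continuous R).
have cS : compact S.
  apply: compact_closedI.
    by apply: (@rV_compact R n (fun=> `[0, 1]%classic)) => _; exact: segment_compact.
  apply: (@preimage_closed _ _ (fun w : 'rV[R]_n => \sum_i w ord0 i) [set r | r = 1]); last exact: closed_eq.
  by move=> w _; apply: csum => i; exact: coord_continuous.
have -> : hull p = (fun w : 'rV[R]_n => lincomb (w ord0) p) @` S.
  apply/seteqP; split=> x.
    move=> [w [w0 w1 ->]]; exists (\row_i w i).
      split=> /= [i|]; last by rewrite -w1; apply: eq_bigr => i _; rewrite mxE.
      rewrite mxE in_itv /= w0 /= -w1 (bigD1 i) //= lerDl.
      by apply: sumr_ge0 => j _; exact: w0.
    by rewrite /lincomb; congr pair; apply: eq_bigr => i _; rewrite mxE.
  move=> [w [w01 w1] <-]; exists (w ord0); split=> // i.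
  by have := w01 i; rewrite /= in_itv /= => /andP[].
apply: continuous_compact => //; apply: continuous_subspaceT => w.
have cl (q : 'I_n -> R) : continuous (fun w : 'rV[R]_n => \sum_i w ord0 i * q i).
  apply: csum => i v; have h := @coord_continuous R 1 n ord0 i v. exact: cvgM h (cvg_cst (q i)).
exact: cvg_pair (cl (fun i => (p i).1) w) (cl (fun i => (p i).2) w).
Qed.

Lemma closure_interior_hull_sub n (p : 'I_n -> pt R) : closure (hull p)° `<=` hull p.
Proof.
have cH : closed (hull p) by apply: compact_closed; [exact: norm_hausdorff|exact: compact_hull].
by rewrite [X in _ `<=` X](iffLR (closure_id _) cH); exact: closureS (@interior_subset _ _).
Qed.

(** The second part ensures that the interiors of the cells, which are subsets of the closure of the
    domain, lie in the domain itself. *)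
Lemma closed_domain_interior n (p : 'I_n -> pt R) :
  compact (closure (hull p)°) /\ (closure (hull p)°)° `<=` (hull p)°.
Proof.
have sub := @closure_interior_hull_sub n p.
split; last exact: interiorS.
by apply: subclosed_compact sub; [exact: closed_closure|exact: compact_hull].
Qed.

End MeshRegularity.

(** * Pointwise consequences of the Sobolev bounds *)

Section Pointwise.
Context {R : realType}.
Implicit Types (x y z : pt R) (P : {poly {poly R}}).
Local Notation mu := (@lebesgue_measure R).

Lemma compact_uniform_continuity (K : set (pt R)) (F : pt R -> R) (e : R) :
  compact K -> {within K, continuous F} -> 0 < e ->
  exists2 r : R, 0 < r & forall x y, K x -> K y -> `|x.1 - y.1| <= r -> `|x.2 - y.2| <= r ->
    `|F x - F y| <= e.
Proof.
move=> /compact_near_coveringP cK cF e0.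
have key : forall x, K x -> \forall x' \near x & r \near (0 : R)^'+, K x' -> forall y, K y ->
    `|x'.1 - y.1| <= r -> `|x'.2 - y.2| <= r -> `|F x' - F y| <= e.
  move=> x Kx; have /subspace_continuousP /(_ x Kx) c := cF.
  have e2 : 0 < e / 2 by rewrite divr_gt0.
  have : nbhs x (fun y => K y -> ball (F x) (e / 2) (F y)) by exact: (c _ (nbhsx_ballx _ _ e2)).
  move=> /nbhs_ballP[d /= d0 hd]; have d2 : 0 < d / 2 by rewrite divr_gt0.
  exists (ball x (d / 2), [set r : R | r < d / 2]) => /=.
    split; first exact: nbhsx_ballx.
    by apply: nbhs_right_lt.
  move=> [x' r] /= [bx' rd] Kx' y Ky y1 y2.
  have bx : ball x d x' by apply: le_ball bx'; rewrite ler_pdivrMr// ler_pMr// ler1n.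
  have by' : ball x d y.
    have s (u v w : R) : ball u (d / 2) v -> `|v - w| <= r -> ball u d w.
      rewrite -!ball_normE /= ltr_norml ler_norml ltr_norml => /andP[? ?] /andP[? ?].
      by apply/andP; split; lra.
    by case: bx' => bx1 bx2; split; [exact: s bx1 y1|exact: s bx2 y2].
  have := hd _ bx Kx'; have := hd _ by' Ky; rewrite -!ball_normE /= => h1 h2.
  by move: h1 h2; rewrite !ltr_norml ler_norml => /andP[? ?] /andP[? ?]; apply/andP; split; lra.
have := cK R (0 : R)^'+ (fun r x => K x -> forall y, K y -> `|x.1 - y.1| <= r ->
   `|x.2 - y.2| <= r -> `|F x - F y| <= e) _ key.
move=> h; have : \forall r \near (0 : R)^'+, 0 < r /\ (K `<=` fun x => K x -> forall y, K y -> `|x.1 - y.1| <= r ->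
   `|x.2 - y.2| <= r -> `|F x - F y| <= e).
  by near=> r; split; [near: r; exact: nbhs_right_gt|near: r; exact: h].
by move=> /filter_ex[r [r0 hr]]; exists r => // x y Kx Ky; exact: hr.
Unshelve. all: by end_near. Qed.

Lemma sq_ball x (r : R) : 0 < r -> sq x (r / 2) `<=` ball x r.
Proof.
move=> r0 y [h1 h2]; split; rewrite /= -ball_normE /= distrC.
  by apply: (le_lt_trans h1); rewrite ltr_pdivrMr// ltr_pMr// ltr1n.
by apply: (le_lt_trans h2); rewrite ltr_pdivrMr// ltr_pMr// ltr1n.
Qed.

Lemma leb2_setT_gt0 : (0 < (mu \x mu)%E [set: R * R])%E.
Proof.
apply: (@lt_le_trans _ _ (leb2 (sq ((0, 0) : R * R) 1))).
  by rewrite leb2_sq// lte_fin; lra.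
by apply: le_measure; rewrite ?inE//; exact: measurable_sq.
Qed.

(** A nonempty open set contains a square of positive area, which a null set cannot cover. *)
Lemma ae_dense (Q : pt R -> Prop) (U : set (pt R)) : {ae leb2, forall x, Q x} -> open U ->
  U !=set0 -> exists2 x, U x & Q x.
Proof.
move=> [N [mN N0 QN]] oU [x Ux]; apply: contrapT => h.
have /nbhs_ballP[r /= r0 rU] := oU _ Ux.
have sub : sq x (r / 2) `<=` N.
  by move=> y /(sq_ball r0)/rU Uy; apply: QN => /= Qy; apply: h; exists y.
have r20 : 0 < r / 2 by rewrite divr_gt0.
have : (leb2 (sq x (r / 2)) <= leb2 N)%E by apply: le_measure; rewrite ?inE//; exact: measurable_sq.
rewrite leb2_sq// [leb2 N]N0 lee_fin leNgt => /negP; apply.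
by rewrite mulr_gt0// exprn_gt0.
Qed.

Lemma Linf_norm_ae (Omega : set (pt R)) v (del : R) : (Linf_norm Omega v <= del%:E)%E ->
  {ae leb2, forall x, Omega x -> `|v x| <= del}.
Proof.
rewrite /Linf_norm unlock leb2_setT_gt0 => /ess_supP.
apply: filterS => x /= + Ox; rewrite patchE mem_set//.
Qed.

(** If |F x| exceeded del, continuity would make it do so on a nonempty open part of U, where the
    essential bound holds at some point. The closure of U gives the bound for traces on edges as
    well. *)
Lemma Linf_norm_dense (Omega U : set (pt R)) (F v : pt R -> R) x (del : R) :
  (Linf_norm Omega v <= del%:E)%E -> open U -> U `<=` Omega -> closure U x ->
  {within closure U, continuous F} -> (forall y, U y -> v y = F y) -> `|F x| <= del.
Proof.
move=> /Linf_norm_ae vd oU UO cx cF vF; rewrite leNgt; apply/negP => h.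
have /subspace_continuousP /(_ x cx) c := cF.
have A : nbhs (F x) [set t : R | del < `|t|].
  apply/nbhs_ballP; exists (`|F x| - del); first by rewrite /= subr_gt0.
  move=> t; rewrite -ball_normE /= => ht; have := ler_distD t (F x) 0; rewrite !subr0; lra.
have : nbhs x (fun y => closure U y -> del < `|F y|) by exact: c _ A.
rewrite nbhsE => -[V [oV Vx] VF].
have [] := ae_dense vd (openI oV oU).
  by have [y [Uy Vy]] := cx _ (open_nbhs_nbhs (conj oV Vx)); exists y.
move=> y [Vy Uy] hy; have := VF y Vy (subset_closure Uy).
by rewrite -vF// ltNge hy//; exact: UO.
Qed.

Lemma W1inf_norm_Linf (Omega : set (pt R)) v (del : R) k : (W1inf_norm Omega v <= del%:E)%E ->
  (Linf_norm Omega (dpar [:: k] v) <= del%:E)%E.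
Proof.
rewrite /W1inf_norm !ge_max => /and3P[_ h0 h1].
by case: (ord2P k) => ->; [exact: h0|exact: h1].
Qed.

Lemma W1inf_pointwise Omega (T : mesh R) (i : 'I_(ntri T)) u v (D : 'I_2 -> pt R -> R) A x k (del : R) :
  conforming_triangulation Omega T ->
  (W1inf_norm Omega (fun x => v x - u x)%R <= del%:E)%E -> represents v A ->
  (cell i)° `<=` Omega ->
  (forall y, Omega y -> derivable u y (basis_vec k)) ->
  {within closure Omega, continuous (D k)} ->
  (forall y, Omega y -> D k y = dpar [:: k] u y) ->
  cell i x -> `|ev (dpoly k (A i)) x - D k x| <= del.
Proof.
move=> hT /(@W1inf_norm_Linf _ _ _ k) h rep iO du cD DE cx.
have oU : open (cell i)° by exact: open_interior.
apply: (@Linf_norm_dense Omega (cell i)° (fun x => ev (dpoly k (A i)) x - D k x)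
  (dpar [:: k] (fun x => v x - u x)) x del h oU iO).
- exact: (cell_closure hT).
- have cD' : {within closure (cell i)°, continuous (D k)}.
    by apply: continuous_subspaceW cD; exact: closureS.
  have cP : {within closure (cell i)°, continuous (ev (dpoly k (A i)))}.
    by apply: continuous_subspaceT; exact: continuous_ev.
  by move=> y; apply: cvgB; [exact: cP|exact: cD'].
- move=> y Uy /=; have Oy := iO y Uy.
  rewrite (@near_eq_derive _ _ _ _ (fun z => ev (A i) z - u z)); last first.
    have : nbhs y (cell i)° by exact: oU.
    by apply: filterS => z /interior_subset cz; rewrite (rep i).
  have dP : derivable (ev (A i)) y (basis_vec k) by have [] := is_derive_ev (A i) y k.
  rewrite (deriveB dP (du y Oy)).
  by rewrite DE//; congr (_ - _); have [_ ->] := is_derive_ev (A i) y k.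
Qed.

End Pointwise.

(** * From gradient bounds to second derivative bounds *)

Section Taylor.
Context {R : realType}.
Implicit Types (x y z c : pt R) (P : {poly {poly R}}).

Lemma first_order_bound (g dg : R -> R) (a e r t0 t : R) :
  (forall s, `|s - t0| <= r -> is_derive s (1 : R) g (dg s)) ->
  (forall s, `|s - t0| <= r -> `|dg s - a| <= e) -> `|t - t0| <= r ->
  `|g t - g t0 - a * (t - t0)| <= e * r.
Proof.
move=> hd ha tr; have r0 : 0 <= r := le_trans (normr_ge0 _) tr.
have e0 : 0 <= e by apply: le_trans (normr_ge0 _) (ha t0 _); rewrite subrr normr0.
have key l u : l <= u -> (forall s, l <= s <= u -> `|s - t0| <= r) ->
    `|g u - g l - a * (u - l)| <= e * (u - l).
  move=> lu hs; have [||d] := @MVT_segment R g dg l u lu.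
  - by move=> s; rewrite in_itv /= => /andP[ls su]; apply: hd; apply: hs; rewrite !ltW.
  - apply: derivable_within_continuous => s; rewrite in_itv /= => lsu.
    by have [] := hd s (hs s lsu).
  rewrite in_itv /= => ldu ->; rewrite -mulrBl normrM (ger0_norm (_ : 0 <= u - l)) ?subr_ge0//.
  by rewrite ler_wpM2r ?subr_ge0//; apply: ha; exact: hs.
case: (leP t0 t) => h.
  apply: le_trans (key t0 t h _) _; last by rewrite ler_wpM2l// (le_trans _ tr)// ler_norm.
  move=> s /andP[h1 h2]; apply: le_trans tr; rewrite !ger0_norm ?subr_ge0//; lra.
have -> : g t - g t0 - a * (t - t0) = - (g t0 - g t - a * (t0 - t)) by ring.
rewrite normrN.
apply: le_trans (key t t0 (ltW h) _) _.
  move=> s /andP[h1 h2]; apply: le_trans tr; rewrite distrC (distrC t) !ger0_norm ?subr_ge0//; lra.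
by rewrite ler_wpM2l// (le_trans _ tr)// distrC ler_norm.
Qed.

(** The path from c to y runs along two axis-parallel segments inside the square, so partial
    derivatives suffice; each segment contributes e * r. *)
Lemma taylor_sq (F : pt R -> R) (D : 'I_2 -> pt R -> R) (a : 'I_2 -> R) c (e r : R) y :
  (forall x k, sq c r x -> is_derive x (basis_vec k) F (D k x)) ->
  (forall x k, sq c r x -> `|D k x - a k| <= e) -> sq c r y ->
  `|F y - (F c + a ord0 * (y.1 - c.1) + a ord_max * (y.2 - c.2))| <= 2 * (r * e).
Proof.
move=> hd ha [y1 y2]; have r0 : 0 <= r := le_trans (normr_ge0 _) y1.
have dir k x t : (forall s, `|s| <= r -> sq c r (shift_pt x (basis_vec k) s)) -> `|t| <= r ->
    `|F (shift_pt x (basis_vec k) t) - F x - a k * t| <= e * r.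
  move=> hs ht; have := @first_order_bound (fun s => F (shift_pt x (basis_vec k) s))
    (fun s => D k (shift_pt x (basis_vec k) s)) (a k) e r 0 t.
  rewrite /= shift_pt0 subr0; apply=> // s; rewrite subr0 => hsr.
    by apply/is_derive_shift_pt; apply: hd; exact: hs.
  by apply: ha; exact: hs.
have E1 : shift_pt c (basis_vec ord0) (y.1 - c.1) = (y.1, c.2).
  by rewrite /shift_pt /basis_vec /= mulr1 mulr0 addr0 addrC subrK.
have E2 : shift_pt (y.1, c.2) (basis_vec ord_max) (y.2 - c.2) = y.
  by rewrite /shift_pt /basis_vec /= mulr1 mulr0 addr0 addrC subrK -surjective_pairing.
have h1 := dir ord0 c (y.1 - c.1) _ y1; have h2 := dir ord_max (y.1, c.2) (y.2 - c.2) _ y2.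
rewrite E1 in h1; rewrite E2 in h2.
have {}h1 : `|F (y.1, c.2) - F c - a ord0 * (y.1 - c.1)| <= e * r.
  apply: h1 => s hs; rewrite /sq /shift_pt /basis_vec /= mulr1 mulr0 addr0 subrr normr0.
  by rewrite (addrC c.1) addrK.
have {}h2 : `|F y - F (y.1, c.2) - a ord_max * (y.2 - c.2)| <= e * r.
  apply: h2 => s hs; rewrite /sq /shift_pt /basis_vec /= mulr1 mulr0 addr0.
  by rewrite (addrC c.2) addrK.
have -> : F y - (F c + a ord0 * (y.1 - c.1) + a ord_max * (y.2 - c.2)) =
  (F (y.1, c.2) - F c - a ord0 * (y.1 - c.1)) + (F y - F (y.1, c.2) - a ord_max * (y.2 - c.2)) by ring.
by apply: le_trans (ler_normD _ _) _; rewrite (_ : 2 * (r * e) = e * r + e * r) ?lerD//; ring.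
Qed.

Lemma bsizeC (a : R) : bsize 1 a%:P%:P.
Proof.
split; first by rewrite size_polyC leq_b1.
by move=> i; rewrite coefC; case: ifP => _; rewrite ?size_poly0// size_polyC leq_b1.
Qed.

Lemma bsizeX1 : bsize 2 ('X%:P : {poly {poly R}}).
Proof.
split; first by rewrite size_polyC; case: eqP.
by move=> i; rewrite coefC; case: ifP => _; rewrite ?size_poly0// size_polyX.
Qed.

Lemma bsizeX2 : bsize 2 ('X : {poly {poly R}}).
Proof. by split; [rewrite size_polyX|move=> i; rewrite coefX; case: (_ == _); rewrite ?size_poly1 ?size_poly0]. Qed.

(* The inverse inequality is applied to P minus the affine Taylor polynomial of F
   at the centre of the inscribed square. *)
Lemma derivative_approximation n (L : R) : 1 <= L -> exists2 C : R, 0 < C &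
  forall (T : mesh R) d (r : R), 0 < r -> @inscribed R T d r L ->
  forall i P (F : pt R -> R) (D : 'I_2 -> pt R -> R) (del e : R), bsize n P ->
  (forall x, cell i x -> `|ev P x - F x| <= del) ->
  (forall x k, (cell i)° x -> is_derive x (basis_vec k) F (D k x)) ->
  (forall x k, cell i x -> `|D k x - D k (d i)| <= e) ->
  forall x k, cell i x -> `|ev (dpoly k P) x - D k x| <= C / r * del + (2 * C + 1) * e.
Proof.
move=> L1; have [C C0 hC] := @cell_bernstein R (n + 3) L L1; exists C => //.
move=> T d r r0 ins i P F D del e sP hP hd he x k cx.
have cc : cell i (d i).
  apply: interior_subset; apply: (ins i).1; rewrite /sq /= !subrr normr0; lra.
pose a k := D k (d i).
pose A : {poly {poly R}} := (F (d i))%:P%:P + (a ord0)%:P%:P * ('X%:P - (d i).1%:P%:P) +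
  (a ord_max)%:P%:P * ('X - (d i).2%:P%:P).
have evA y : ev A y = F (d i) + a ord0 * (y.1 - (d i).1) + a ord_max * (y.2 - (d i).2).
  by rewrite /A !(evB, evD, evM, evC, evX1, evX2).
have sA : bsize 3 A.
  apply: bsizeD; first apply: bsizeD.
  - by apply: bsizeW (bsizeC _).
  - apply: (@bsizeM _ 1 2); first exact: bsizeC.
    by apply: bsizeB; [exact: bsizeX1|apply: bsizeW (bsizeC _)].
  - apply: (@bsizeM _ 1 2); first exact: bsizeC.
    by apply: bsizeB; [exact: bsizeX2|apply: bsizeW (bsizeC _)].
have dA y : ev (dpoly k A) y = a k.
  suff -> : dpoly k A = (a k)%:P%:P by rewrite evC.
  rewrite /A !dpolyD /dpoly; case: (ord2P k) => -> /=.
    by rewrite !(dXB, dXM, dXC, dXX) !derivC derivX !polyC0; ring.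
  by rewrite !(dYB, dYM, dYC, dYX); ring.
have sPA : bsize (n + 3) (P - A).
  by apply: bsizeB; [apply: bsizeW sP; rewrite leq_addr|apply: bsizeW sA; rewrite leq_addl].
have hPA y : sq (d i) r y -> `|ev (P - A) y| <= del + 2 * (r * e).
  move=> sy; have cy := (ins i).1 _ sy; rewrite evB evA.
  have h1 := hP y (interior_subset cy).
  have h2 := @taylor_sq F D a (d i) e r y (fun z k sz => hd z k ((ins i).1 z sz))
     (fun z k sz => he z k (interior_subset ((ins i).1 z sz))) sy.
  have -> (z : R) : ev P y - z = (ev P y - F y) + (F y - z) by ring.
  by apply: le_trans (ler_normD _ _) _; rewrite lerD.
have [_ /(_ k)] := hC T d r r0 ins i _ _ sPA hPA x cx.
rewrite dpolyB evB dA => h1; have h2 := he x k cx; rewrite distrC in h2.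
have -> : C / r * del + (2 * C + 1) * e = C / r * (del + 2 * (r * e)) + e by field; rewrite gt_eqF.
have -> : ev (dpoly k P) x - D k x = (ev (dpoly k P) x - a k) + (a k - D k x) by ring.
by apply: le_trans (ler_normD _ _) _; rewrite lerD.
Qed.

End Taylor.

(** * The energy norm *)

Section PlaneMeasure.
Context {R : realType}.
Implicit Types (x y z : pt R) (P : {poly {poly R}}).
Local Notation mu := (@lebesgue_measure R).
Local Notation o1 := (inord 1 : 'I_3).
Local Notation o2 := (inord 2 : 'I_3).

(** An open set is the union of the countably many squares with rational data that it contains, and
    these are products of intervals. *)
Lemma open_measurable2 (U : set (R * R)) : open U -> measurable U.
Proof.
move=> oU.
pose S (q : rat * rat * rat) : set (R * R) := sq (ratr q.1.1, ratr q.1.2) (ratr q.2).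
have -> : U = \bigcup_q (if `[< S q `<=` U >] then S q else set0).
  apply/seteqP; split=> x; last by case=> q _; case: asboolP => // h; exact: h.
  move=> Ux; have /nbhs_ballP[r /= r0 rU] := oU _ Ux.
  have [e] := @rat_in_itvoo R 0 (r / 2) (divr_gt0 r0 (ltr0n _ 2)).
  rewrite in_itv /= => /andP[e0 er].
  have near (t : R) : exists a : rat, `|t - ratr a| <= ratr e.
    have [a] := @rat_in_itvoo R (t - ratr e) (t + ratr e) ltac:(lra).
    rewrite in_itv /= => /andP[h1 h2]; exists a; rewrite ler_norml; apply/andP; split; lra.
  have [a ha] := near x.1; have [b hb] := near x.2; exists (a, b, e) => //.
  rewrite asboolT; first by split.
  move=> y [/= y1 y2]; apply: rU.
  have h (s t u : R) : `|s - u| <= ratr e -> `|t - u| <= ratr e -> ball s r t.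
    rewrite -ball_normE /= !ler_norml ltr_norml => /andP[? ?] /andP[? ?].
    by apply/andP; split; lra.
  by split; [exact: h ha y1|exact: h hb y2].
apply: countable_bigcupT_measurable => [|q]; first exact: countableP.
by case: asboolP => _ //; exact: measurable_sq.
Qed.

Lemma within_continuous_measurable (K : set (R * R)) (f : R * R -> R) : measurable K ->
  {within K, continuous f} -> measurable_fun K f.
Proof.
move=> mK /continuousP cf; apply: (measurability _ (RGenOpens.measurableE R)).
move=> _ [_ [a [b ->] <-]].
have /open_subspaceP[V oV VK] : open (f @^-1` `]a, b[%classic : set (subspace K)).
  by apply: cf; exact: interval_open.
by rewrite setIC -VK; apply: measurableI => //; exact: open_measurable2.
Qed.

(** If c is nonzero, every vertical section is a single point; otherwise the line is vertical and
    lies in the product of a point and the real line. *)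
Lemma line_null (a b c : R) : (b != 0) || (c != 0) ->
  leb2 [set x : R * R | a + b * x.1 + c * x.2 = 0] = 0%E.
Proof.
have mf : measurable_fun [set: R * R] (fun x : R * R => a + b * x.1 + c * x.2).
  apply: measurable_funD; first apply: measurable_funD => //.
    by apply: measurable_funM => //; exact: measurable_fst.
  by apply: measurable_funM => //; exact: measurable_snd.
have mA : measurable [set x : R * R | a + b * x.1 + c * x.2 = 0].
  rewrite -[X in measurable X]setTI; exact: (mf measurableT [set 0] (measurable_set1 _)).
have [c0|c0 _] := eqVneq c 0; last first.
  rewrite /leb2 /= /product_measure1; apply: integral0_eq => s _ /=.
  have -> : xsection [set x : R * R | a + b * x.1 + c * x.2 = 0] s = [set - (a + b * s) / c].
    apply/seteqP; split=> t; rewrite /xsection /= inE /=.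
      by move=> h; rewrite -[t](mulKf c0) mulrC; congr (_ / _); lra.
    by move=> ->; field.
  exact: lebesgue_measure_set1.
rewrite orbF => b0; apply/eqP; rewrite eq_le measure_ge0 andbT.
have -> : 0%E = leb2 ([set - a / b] `*` [set: R]).
  rewrite /leb2 product_measure1E// [X in _ = (X * _)%E](_ : _ = 0%E) ?mul0e//.
  exact: lebesgue_measure_set1.
have mX : measurable ([set - a / b] `*` [set: R] : set (R * R)) by apply: measurableX.
apply: le_measure; rewrite ?inE//.
by move=> x /=; rewrite c0 mul0r addr0 => h; split=> //=; rewrite -[x.1](mulKf b0) mulrC; congr (_ / _); lra.
Qed.

Lemma bary_null (p : 'I_3 -> pt R) a : Defs.nondegenerate p ->
  leb2 [set x : R * R | bary p a x = 0] = 0%E.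
Proof.
move=> /nondegenerateE p0; pose q := p (ordS a); pose s := p (ord_pred a).
have -> : [set x | bary p a x = 0] = [set x | det2 q s + (q.2 - s.2) * x.1 + (s.1 - q.1) * x.2 = 0].
  apply/seteqP; split=> x /=; rewrite /bary.
    move=> /eqP; rewrite mulf_eq0 invr_eq0 (negbTE p0) orbF => /eqP <-.
    by rewrite -/q -/s /det2 /=; ring.
  move=> h; rewrite (_ : det2 _ _ = 0) ?mul0r// -{}h -/q -/s /det2 /=; ring.
apply: line_null; rewrite !subr_eq0; apply: contraNT p0; rewrite negb_or !negbK => /andP[/eqP e2 /eqP e1].
by rewrite -(area2_rot p a) -/q -/s /det2 /= e2 e1; apply/eqP; ring.
Qed.

Lemma boundary_hull_null (p : 'I_3 -> pt R) : Defs.nondegenerate p ->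
  leb2 (hull p `\` (hull p)°) = 0%E.
Proof.
move=> p0; have m a : measurable [set x : R * R | bary p a x = 0].
  rewrite -[X in measurable X]setTI; exact: (measurable_bary p a measurableT (measurable_set1 0)).
pose Z a := [set x : R * R | bary p a x = 0].
have Z0 a : (mu \x mu)%E (Z a) = 0%E by exact: bary_null.
apply: (@subset_measure0 _ _ _ (mu \x mu)%E _ (Z ord0 `|` Z o1 `|` Z o2)).
- by apply: measurableD; [exact: measurable_hull|exact: measurable_interior_hull].
- exact: (measurableU _ _ (measurableU _ _ (m ord0) (m o1)) (m o2)).
- move=> x [hx nx]; apply: contrapT => h; apply: nx; apply/interior_hullP => // a.
  have /(hullP _ p0)/(_ a) := hx; rewrite le_eqVlt => /orP[/eqP e|//].
  by exfalso; apply: h; case: (ord3P a) e => -> e; [left; left|left; right|right].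
- have e1 := @measureU0 _ _ _ (mu \x mu)%E _ _ (measurableU _ _ (m ord0) (m o1)) (m o2) (Z0 o2).
  have e2 := @measureU0 _ _ _ (mu \x mu)%E _ _ (m ord0) (m o1) (Z0 o1).
  by rewrite /= in e1 e2 *; rewrite [LHS]e1 [LHS]e2; exact: Z0.
Qed.

End PlaneMeasure.

Section EnergyNorm.
Context {R : realType}.
Implicit Types (x y z : pt R) (P : {poly {poly R}}).
Local Notation mu := (@lebesgue_measure R).

(* Nothing is known about the elementwise gradient on the cell boundaries, so the
   integrand g may fail to be measurable; its integral is still the supremum of
   the integrals of the simple functions below it. *)
Lemma le_integral_dominated d (U : measurableType d) (m : {measure set U -> \bar R}) (D : set U)
  (g phi : U -> \bar R) : (forall t, D t -> (0 <= g t)%E) -> (forall t, (0 <= phi t)%E) ->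
  (forall t, D t -> (g t <= phi t)%E) -> (\int[m]_(t in D) g t <= \int[m]_t phi t)%E.
Proof.
move=> g0 p0 gp; rewrite ge0_integralE// ge0_integralTE//.
apply: ge_ereal_sup => _ [h /= hg <-]; apply: ereal_sup_ubound; exists h => //= t.
apply: (le_trans (hg t)); rewrite patchE; case: ifPn => [/set_mem|_]; [exact: gp|exact: p0].
Qed.

Lemma H1_norm_le Omega (T : mesh R) w (W : 'I_(ntri T) -> {poly {poly R}}) :
  conforming_triangulation Omega T -> represents w W ->
  (H1_norm Omega w <= (Num.sqrt (\sum_i cint i (h1poly (W i))))%:E)%E.
Proof.
move=> hT rep; rewrite /H1_norm.
have -> : (Num.sqrt (\sum_i cint i (h1poly (W i))))%:E = sqrte (\sum_i cint i (h1poly (W i)))%:E by [].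
rewrite lee_sqrt; last by rewrite lee_fin sumr_ge0// => i _; apply: cint_ge0 => x _; exact: h1poly_ge0.
pose B (i : 'I_(ntri T)) : set (pt R) := cell i `\` (cell i)°.
have mB i : measurable (B i : set (R * R)).
  by apply: measurableD; [exact: (measurable_cell hT)|exact: measurable_interior_hull (cell_nondegenerate hT i)].
have B0 i : (mu \x mu)%E (B i) = 0%E by exact: boundary_hull_null (cell_nondegenerate hT i).
(* The value +oo on the null set of cell boundaries makes the majorant valid there, whatever [dpar]
   is, without changing its integral. *)
pose F i x : \bar R := (((EFin \o ev (h1poly (W i))) \_ (cell i)) x + (cst +oo \_ (B i)) x)%E.
have F10 i x : (0 <= ((EFin \o ev (h1poly (W i))) \_ (cell i)) x)%E.
  by rewrite patchE; case: ifP => // _; rewrite lee_fin h1poly_ge0.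
have F20 i x : (0 <= ((cst +oo : pt R -> \bar R) \_ (B i)) x)%E.
  by rewrite patchE; case: ifP => _ //=; exact: leey.
have F0 i x : (0 <= F i x)%E by rewrite adde_ge0.
apply: (le_trans (@le_integral_dominated _ _ leb2 _ _ (fun x => \sum_i F i x)%E _ _ _)).
- move=> x _; rewrite lee_fin addr_ge0 ?sqr_ge0// sumr_ge0// => i _; exact: sqr_ge0.
- by move=> x; apply: sume_ge0.
- move=> x Ox; have [_ cov _] := hT.
  have : closure Omega x by exact: subset_closure.
  rewrite cov => -[i _ ci]; rewrite (bigD1 i)//=; apply: le_trans (leeDl _ _); last exact: sume_ge0.
  have [bi|nbi] := pselect (B i x).
    by rewrite /F [X in (_ + X)%E]patchE mem_set//= addey ?leey// gt_eqF// (lt_le_trans _ (F10 i x))// ltNye.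
  have ii : (cell i)° x by apply: contrapT => h; apply: nbi.
  have oU : open (cell i)° by exact: open_interior.
  have dE k : dpar [:: k] w x = ev (dpoly k (W i)) x.
    by rewrite (dpar_ev (P := W i) _ oU _ ii)// => y /interior_subset; exact: rep.
  have -> : (w x ^+ 2 + \sum_(k < 2) dpar [:: k] w x ^+ 2) = ev (h1poly (W i)) x.
    by rewrite sum2 !dE (rep i)// /h1poly !(evD, evM) /= !expr2.
  by rewrite /F [X in (X + _)%E]patchE mem_set// [X in (_ + X)%E]patchE memNset ?adde0// => -[].
have m1 i : measurable_fun [set: R * R] ((EFin \o ev (h1poly (W i))) \_ (cell i)).
  apply/(measurable_restrictT _ (measurable_cell hT i)); apply/measurable_EFinP.
  by apply: measurable_funTS; exact: measurable_ev.
have m2 i : measurable_fun [set: R * R] ((cst +oo%E : pt R -> \bar R) \_ (B i)).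
  by apply/(measurable_restrictT _ (mB i)); exact: measurable_cst.
have mF i : measurable_fun [set: R * R] (F i) by exact: emeasurable_funD.
rewrite -sumEFin /leb2 ge0_integral_sum//; apply: lee_sum => i _.
have e1 := @integral_mkcond _ _ _ (mu \x mu)%E (cell i) (EFin \o ev (h1poly (W i))).
have e2 : (\int[(mu \x mu)%E]_x ((cst +oo%E : pt R -> \bar R) \_ (B i)) x = 0)%E.
  rewrite -(@integral_mkcond _ _ _ (mu \x mu)%E (B i)).
  by apply: null_set_integral; [exact: mB|exact: measurable_cst|exact: B0].
rewrite /F (@ge0_integralD _ _ _ (mu \x mu)%E _ measurableT _ _ (fun x _ => F10 i x) (m1 i) (fun x _ => F20 i x) (m2 i)).
rewrite -e1 e2 adde0 /cint /leb2 /Rintegral fineK//; apply: integrable_fin_num; first exact: (measurable_cell hT).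
exact: (cell_integrable hT).
Qed.

Lemma source_integrable Omega (T : mesh R) (i : 'I_(ntri T)) (f : pt R -> R) P :
  conforming_triangulation Omega T -> compact (closure Omega) ->
  {within closure Omega, continuous f} ->
  leb2.-integrable (cell i) (EFin \o (fun x => f x * ev P x)).
Proof.
move=> hT cO cf; have [_ cov _] := hT.
have sub : cell i `<=` closure Omega by rewrite cov => x cx; exists i.
have [M [_ hM]] : bounded_set (f @` closure Omega) by exact: compact_bounded (continuous_compact cf cO).
have [B B0 hB] := ev_bounded P (cell_box i).
apply: (@bounded_integrable R _ _ (cell_box i) ((M + 1) * B)).
- exact: (measurable_cell hT).
- exact: cell_boxP.
- apply: measurable_funM; last by apply: measurable_funTS; exact: measurable_ev.
  apply: within_continuous_measurable; first exact: (measurable_cell hT).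
  exact: continuous_subspaceW cf.
- move=> x cx; rewrite normrM ler_pM//; last exact: hB (cell_boxP cx).
  by apply: hM; [rewrite ltrDl|exists x => //; exact: sub].
Qed.

End EnergyNorm.

Section Coercivity.
Context {R : realType}.
Implicit Types (x y z : pt R) (P : {poly {poly R}}).
Local Notation i0 := (ord0 : 'I_2).
Local Notation i1 := (ord_max : 'I_2).

(** Outside the domain [dpar] says nothing about u, so continuous extensions [D1] and [D2] of the
    derivatives to the closure are fixed once and used in its place. *)
Lemma C_bar_derivatives m Omega (u : pt R -> R) : C_bar m.+3 Omega u -> open Omega ->
  exists (D1 : 'I_2 -> pt R -> R) (D2 : 'I_2 -> 'I_2 -> pt R -> R),
  [/\ forall k, {within closure Omega, continuous (D1 k)} /\
        forall x, Omega x -> derivable u x (basis_vec k) /\ D1 k x = dpar [:: k] u x,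
      forall k l, {within closure Omega, continuous (D2 k l)},
      forall k l x, Omega x -> is_derive x (basis_vec k) (D1 l) (D2 k l x) &
      forall x, closure Omega x -> hess Omega u x = \matrix_(k, l) D2 k l x].
Proof.
move=> [_ hu] oO.
have /choice[D1 hD1] : forall k : 'I_2, exists F, {within closure Omega, continuous F} /\
    forall x, Omega x -> F x = dpar [:: k] u x.
  by move=> k; have [//|_ [F cF FE]] := hu [:: k]; exists F.
have /choice[D2 hD2] : forall kl : 'I_2 * 'I_2, exists F, {within closure Omega, continuous F} /\
    forall x, Omega x -> F x = dpar [:: kl.1; kl.2] u x.
  by move=> kl; have [//|_ [F cF FE]] := hu [:: kl.1; kl.2]; exists F.
exists D1, (fun k l => D2 (k, l)); split.
- move=> k; have [c1 e1] := hD1 k; split=> // x Ox; split; last exact: e1.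
  by have [//|/(_ isT) h _] := hu [::]; exact: h.
- by move=> k l; have [] := hD2 (k, l).
- move=> k l x Ox; have [_ e1] := hD1 l; have [_ ->//] := hD2 (k, l).
  have nE : \near x, D1 l x = dpar [:: l] u x.
    have : nbhs x Omega by exact: oO.
    by apply: filterS => y; exact: e1.
  have [//|/(_ isT) /(_ x k Ox) d _] := hu [:: l].
  apply: DeriveDef; last exact: near_eq_derive.
  by apply: near_eq_derivable d; apply: filterS nE => y ->.
- move=> x cx; apply/matrixP => k l; rewrite !mxE.
  have [c2 e2] := hD2 (k, l).
  by apply: (dpar_on_cvg oO cx c2) => y Oy; rewrite e2.
Qed.

Lemma cofactor_form (H : 'M[R]_2) (s t : R) :
  let r : 'cV[R]_2 := \col_k (if k == i0 then s else t) in
  scal (r^T *m cof H *m r) = H i1 i1 * s ^+ 2 - (H i0 i1 + H i1 i0) * s * t + H i0 i0 * t ^+ 2 /\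
  scal (r^T *m r) = s ^+ 2 + t ^+ 2.
Proof.
move=> r; have [e0 e1 e2 e3] := cof_2 H.
have r0 : r i0 0 = s by rewrite mxE.
have r1 : r i1 0 = t by rewrite mxE.
have t0 : r^T 0 i0 = s by rewrite !mxE.
have t1 : r^T 0 i1 = t by rewrite !mxE.
by rewrite /scal !mulmx2 e0 e1 e2 e3 t0 t1 r0 r1; split; ring.
Qed.

(** The diagonal errors cost th, and the two off-diagonal ones together another th, since |s t| <=
    (s^2 + t^2)/2. *)
Lemma form_perturbation (a th H00 H01 H10 H11 X XY YX Y s t : R) : 0 <= th ->
  `|X - H00| <= th -> `|XY - H01| <= th -> `|YX - H10| <= th -> `|Y - H11| <= th -> XY = YX ->
  a * (s ^+ 2 + t ^+ 2) <= H11 * s ^+ 2 - (H01 + H10) * s * t + H00 * t ^+ 2 ->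
  (a - 2 * th) * (s ^+ 2 + t ^+ 2) <= Y * s ^+ 2 - 2 * XY * s * t + X * t ^+ 2.
Proof.
move=> th0 h0 h1 h2 h3 e h; subst YX.
have b (p z : R) : `|p| <= th -> 0 <= z -> - (th * z) <= p * z.
  by rewrite ler_norml => /andP[p1 _] z0; rewrite -mulNr ler_wpM2r.
have b0 := b _ _ h0 (sqr_ge0 t); have b3 := b _ _ h3 (sqr_ge0 s).
have st p : `|p| <= th -> p * (s * t) <= th * ((s ^+ 2 + t ^+ 2) / 2).
  move=> hp; apply: (le_trans (ler_norm _)); rewrite normrM ler_pM//.
  rewrite ler_norml; apply/andP; split; have := sqr_ge0 (s + t); have := sqr_ge0 (s - t); nra.
have s1 := st _ h1; have s2 := st _ h2.
have -> : (a - 2 * th) * (s ^+ 2 + t ^+ 2) = a * (s ^+ 2 + t ^+ 2) - th * s ^+ 2 - th * t ^+ 2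
  - th * ((s ^+ 2 + t ^+ 2) / 2) - th * ((s ^+ 2 + t ^+ 2) / 2) by field.
have -> : Y * s ^+ 2 - 2 * XY * s * t + X * t ^+ 2 = H11 * s ^+ 2 - (H01 + H10) * s * t + H00 * t ^+ 2
  + (Y - H11) * s ^+ 2 + (X - H00) * t ^+ 2 - (XY - H01) * (s * t) - (XY - H10) * (s * t) by ring.
by lra.
Qed.

(** The second derivatives of U are kept within a/4 of those of u: a/8 is allowed for the gradient
    error del, amplified by 1/r, and a/8 for the oscillation of D^2 u over one cell. The perturbed
    form then keeps half of the constant a. *)
Lemma discrete_coercivity n Omega (u : pt R -> R) (a L : R) (D1 : 'I_2 -> pt R -> R)
    (D2 : 'I_2 -> 'I_2 -> pt R -> R) :
  1 <= L -> 0 < a -> compact (closure Omega) ->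
  (forall k l, {within closure Omega, continuous (D2 k l)}) ->
  (forall k l x, Omega x -> is_derive x (basis_vec k) (D1 l) (D2 k l x)) ->
  (forall x, closure Omega x -> hess Omega u x = \matrix_(k, l) D2 k l x) ->
  (forall x (r : 'cV[R]_2), closure Omega x ->
     a * scal (r^T *m r) <= scal (r^T *m cof (hess Omega u x) *m r)) ->
  exists rho kap : R, [/\ 0 < rho, 0 < kap &
    forall (T : mesh R) c (r : R), conforming_triangulation Omega T -> 0 < r ->
    @inscribed R T c r L -> (forall i : 'I_(ntri T), (cell i)° `<=` Omega) -> L * r <= rho ->
    forall (U : 'I_(ntri T) -> {poly {poly R}}) (del : R), (forall i, bsize n (U i)) ->
    (forall i x k, cell i x -> `|ev (dpoly k (U i)) x - D1 k x| <= del) -> del <= kap * r ->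
    forall i x s t, cell i x -> a / 2 * (s ^+ 2 + t ^+ 2) <=
       ev (dY (dY (U i))) x * s ^+ 2 - 2 * ev (dX (dY (U i))) x * s * t + ev (dX (dX (U i))) x * t ^+ 2].
Proof.
move=> L1 a0 cO cD dD hE coer.
have [C C0 hC] := @derivative_approximation R n L L1.
(* Chosen so that the oscillation term (2 * C + 1) * e of [derivative_approximation] equals a/8. *)
pose e := a / (8 * (2 * C + 1)).
have e0 : 0 < e by rewrite divr_gt0// mulr_gt0//; lra.
have /choice[rho hrho] : forall kl : 'I_2 * 'I_2, exists rho : R, 0 < rho /\
    forall x y, closure Omega x -> closure Omega y -> `|x.1 - y.1| <= rho -> `|x.2 - y.2| <= rho ->
    `|D2 kl.1 kl.2 x - D2 kl.1 kl.2 y| <= e.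
  by move=> kl; have [rho r0 h] := compact_uniform_continuity cO (cD kl.1 kl.2) e0; exists rho.
pose rm := Num.min (Num.min (rho (i0, i0)) (rho (i0, i1))) (Num.min (rho (i1, i0)) (rho (i1, i1))).
have rmE k l : rm <= rho (k, l).
  by case: (ord2P k) => ->; case: (ord2P l) => ->; rewrite /rm !ge_min lexx ?orbT.
(* [rm] serves all four second derivatives; the second constant makes C / r * del at most a/8. *)
exists rm, (a / (8 * C)); split; first by rewrite !lt_min !(hrho _).1.
  by rewrite divr_gt0// mulr_gt0.
move=> T d r hT r0 ins iO rr U del sU hU hdel i x s t cx.
have [_ cov _] := hT.
have sub y : cell i y -> closure Omega y by rewrite cov => cy; exists i.
have cd : cell i (d i).
  by apply: interior_subset; apply: (ins i).1; rewrite /sq /= !subrr normr0; split; exact: ltW.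
have th k l : `|ev (dpoly k (dpoly l (U i))) x - D2 k l x| <= a / 4.
  apply: le_trans (_ : C / r * del + (2 * C + 1) * e <= _).
    apply: (hC T d r r0 ins i (dpoly l (U i)) (D1 l) (fun k => D2 k l) del e) => //.
    - exact: bsize_dpoly.
    - by move=> y cy; exact: hU.
    - by move=> y k' /iO; exact: dD.
    - move=> y k' cy; have [y1 y2] := (ins i).2 y cy.
      apply: (hrho (k', l)).2; [exact: sub|exact: sub| |];
      by apply: le_trans (rmE k' l); apply: le_trans rr.
  have -> : (2 * C + 1) * e = a / 8 by rewrite /e; field; lra.
  have : C / r * del <= a / 8.
    rewrite mulrAC ler_pdivrMr// -ler_pdivlMl//; apply: (le_trans hdel).
    by apply: eq_ler; field; rewrite gt_eqF.
  by lra.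
have := coer x (\col_k (if k == i0 then s else t)) (sub x cx).
have [-> ->] := cofactor_form (hess Omega u x) s t; rewrite (hE x (sub x cx)) !mxE => hh.
have -> : a / 2 = a - 2 * (a / 4) by field.
apply: (form_perturbation _ (th i0 i0) (th i0 i1) (th i1 i0) (th i1 i1) _ hh); first by rewrite divr_ge0// ltW.
by rewrite /dpoly /= dXY.
Qed.

End Coercivity.

(** * The two-grid estimate *)

Section MeshSizes.
Context {R : realType}.

(* Writing [h = expR (- a)], the factor [|ln h|] is absorbed by [h `^ (eps / 2)]. *)
Lemma log_power_bound (a e : R) : 0 < e -> a * expR (- (a * e)) <= e^-1.
Proof.
move=> e0; have h := expR_ge1Dx (a * e).
have -> : a * expR (- (a * e)) = a * e / expR (a * e) * e^-1 by rewrite expRN; field; rewrite !gt_eqF ?expR_gt0.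
by rewrite ler_piMl ?invr_ge0 ?(ltW e0)// ler_pdivrMr ?expR_gt0// mul1r; lra.
Qed.

(** q = h^(k/2 + 1) is the gradient error for which q^2 / h^2 = h^k. The last bound is h^(5/2),
    where k >= 3 enters; the extra h^(1/2) over h^2 later beats the edge terms. *)
Lemma coarse_mesh_error (k : nat) (eps lam h : R) : (3 <= k)%N -> 0 < eps < 1 ->
  2^-1 + (2 + eps) / (2 * k%:R) < lam < 1 -> 0 < h <= 1 ->
  let q := Num.sqrt (h ^+ k * h ^+ 2) in
  [/\ h ^+ k * `|ln h| <= 2 / eps * q,
      (h `^ lam) ^+ k * `|ln (h `^ lam)| <= 2 / eps * q,
      q ^+ 2 = h ^+ k * h ^+ 2 & q <= h ^+ 2 * Num.sqrt h].
Proof.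
move=> k3 /andP[e0 e1] /andP[l0 l1] /andP[h0 h1] q.
have kR : 3 <= k%:R :> R by rewrite (ler_nat R 3).
pose a := - ln h.
have a0 : 0 <= a by rewrite oppr_ge0 ln_le0.
have hE : h = expR (- a) by rewrite opprK lnK.
have pE n : h ^+ n = expR (- (a * n%:R)) by rewrite {1}hE -expRM_natr mulNr.
have qE : q = expR (- (a * (k%:R / 2 + 1))).
  have E : h ^+ k * h ^+ 2 = expR (- (a * (k%:R / 2 + 1))) ^+ 2.
    by rewrite !pE -expRM_natr -expRD; congr expR; field.
  by rewrite /q E sqrtr_sqr ger0_norm ?expR_ge0.
have q0 : 0 <= q by exact: sqrtr_ge0.
have qq : q ^+ 2 = h ^+ k * h ^+ 2 by rewrite sqr_sqrtr// mulr_ge0// exprn_ge0// ltW.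
have lnE : `|ln h| = a by rewrite /a -normrN ger0_norm.
(* The threshold on s is k/2 + 1 + eps/2, and the part eps/2 pays for the logarithm a. The fine mesh
   has s = k, the coarse one s = lam * k. *)
have bound s : (2^-1 + (2 + eps) / (2 * k%:R)) * k%:R <= s -> expR (- (a * s)) * a <= 2 / eps * q.
  have -> : (2^-1 + (2 + eps) / (2 * k%:R)) * k%:R = k%:R / 2 + 1 + eps / 2 by field; rewrite gt_eqF//; lra.
  move=> hs; apply: (@le_trans _ _ (expR (- (a * (k%:R / 2 + 1 + eps / 2))) * a)).
    by rewrite ler_wpM2r// ler_expR lerN2 ler_wpM2l.
  rewrite mulrDr opprD expRD -qE -mulrA mulrC ler_wpM2r// mulrC.
  apply: (le_trans (log_power_bound a _)); first by rewrite divr_gt0.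
  by rewrite invf_div.
split=> //.
- rewrite lnE pE; apply: bound; rewrite -[leRHS]mul1r; apply: ler_wpM2r => //.
  exact: ltW (lt_trans l0 l1).
- have HE : h `^ lam = expR (- (a * lam)) by rewrite /powR gt_eqF// mulNr opprK mulrC.
  rewrite ln_powR normrM lnE HE -expRM_natr.
  have -> : - (a * lam) * k%:R = - (a * (lam * k%:R)) by ring.
  have l2 : 0 <= lam by apply: le_trans (ltW l0); rewrite addr_ge0// divr_ge0//; lra.
  rewrite (ger0_norm l2); apply: (@le_trans _ _ (expR (- (a * (lam * k%:R))) * a)).
    by rewrite ler_wpM2l ?expR_ge0// ler_piMl// ltW.
  by apply: bound; apply: ler_wpM2r => //; exact: ltW.
- have hs : 0 <= h ^+ 2 * Num.sqrt h by rewrite mulr_ge0 ?sqrtr_ge0// exprn_ge0// ltW.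
  rewrite -(@ler_pXn2r _ 2%N)// qq exprMn sqr_sqrtr ?(ltW h0)// -exprM -exprSr -exprD.
  by apply: ler_wiXn2l => //; [exact: ltW|rewrite addn2 !ltnS].
Qed.

End MeshSizes.

Section FiniteElementSpace.
Context {R : realType}.
Implicit Types (x y z : pt R) (v w f : pt R -> R).

Lemma poly_deg_leB k v w : poly_deg_le k v -> poly_deg_le k w -> poly_deg_le k (fun x => v x - w x).
Proof.
move=> [c hc] [d hd]; exists (fun i j => c i j - d i j) => x; rewrite hc hd -sumrB.
by apply: eq_bigr => i _; rewrite -sumrB; apply: eq_bigr => j _; rewrite !mulrBl.
Qed.

Lemma VhB k Omega (T : mesh R) v w : Vh k Omega T v -> Vh k Omega T w ->
  Vh k Omega T (fun x => v x - w x).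
Proof.
move=> [cv pv] [cw pw]; split; first by move=> x; apply: cvgB; [exact: cv|exact: cw].
move=> i; have [p hp vp] := pv i; have [q hq wq] := pw i.
by exists (fun x => p x - q x); [exact: poly_deg_leB|move=> x cx; rewrite vp// wq].
Qed.

Lemma Vh_refines k Omega (T TH : mesh R) v : refines T TH -> Vh k Omega TH v -> Vh k Omega T v.
Proof.
move=> ref [cv pv]; split=> // i; have [j ij] := ref i; have [p hp vp] := pv j.
by exists p => // x /ij; exact: vp.
Qed.

Lemma boundary_match_Vh0 k Omega (T : mesh R) G v w : Vh k Omega T v -> Vh k Omega T w ->
  boundary_match k Omega T G v -> boundary_match k Omega T G w -> Vh0 k Omega T (fun x => v x - w x).
Proof. by move=> hv hw bv bw; split; [exact: VhB|move=> x bx; rewrite bv// bw// subrr]. Qed.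

End FiniteElementSpace.

Section NewtonStep.
Context {R : realType} (Omega : set (pt R)) (T : mesh R).
Context (hT : conforming_triangulation Omega T).
Implicit Types (A E V W F : 'I_(ntri T) -> {poly {poly R}}).

Lemma dMApolyD W V E F : dMApoly W (fun i => V i + E i) F = dMApoly W V F + dMApoly W E F.
Proof.
have cV (X Y Z : {poly {poly R}}) : cof1 X (Y + Z) = cof1 X Y + cof1 X Z /\ cof2 X (Y + Z) = cof2 X Y + cof2 X Z.
  by rewrite /cof1 /cof2 !(dXD, dYD); split; ring.
have cX (X Y Z : {poly {poly R}}) : cof1 (X + Y) Z = cof1 X Z + cof1 Y Z /\ cof2 (X + Y) Z = cof2 X Z + cof2 Y Z.
  by rewrite /cof1 /cof2 !(dXD, dYD); split; ring.
have tV (i : 'I_(ntri T)) a X Y Z P : eterm i a X (Y + Z) P = eterm i a X Y P + eterm i a X Z P.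
  by rewrite /eterm (cV X Y Z).1 (cV X Y Z).2 !mulrDl efluxD.
have tX (i : 'I_(ntri T)) a X Y Z P : eterm i a (X + Y) Z P = eterm i a X Z P + eterm i a Y Z P.
  by rewrite /eterm (cX X Y Z).1 (cX X Y Z).2 !mulrDl efluxD.
have hD i j : halfp * (V i + E i + (V j + E j)) = halfp * (V i + V j) + halfp * (E i + E j) by ring.
have e1 : \sum_i cint i (cof1 (W i) (V i + E i) * dX (F i) + cof2 (W i) (V i + E i) * dY (F i)) =
    \sum_i cint i (cof1 (W i) (V i) * dX (F i) + cof2 (W i) (V i) * dY (F i)) +
    \sum_i cint i (cof1 (W i) (E i) * dX (F i) + cof2 (W i) (E i) * dY (F i)).
  rewrite -big_split; apply: eq_bigr => i _ /=; rewrite -(cintD hT); congr cint.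
  by rewrite (cV _ _ _).1 (cV _ _ _).2; ring.
have e2 : sum_edges (fun i a j b => eterm i a (W i - W j) (halfp * (V i + E i + (V j + E j))) (F i)) =
    sum_edges (fun i a j b => eterm i a (W i - W j) (halfp * (V i + V j)) (F i)) +
    sum_edges (fun i a j b => eterm i a (W i - W j) (halfp * (E i + E j)) (F i)).
  by rewrite -sum_edgesD; apply: eq_sum_edges => i a j b _ _; rewrite hD tV.
have e3 : sum_edges (fun i a j b => eterm i a (halfp * (V i + E i + (V j + E j))) (W i - W j) (F i)) =
    sum_edges (fun i a j b => eterm i a (halfp * (V i + V j)) (W i - W j) (F i)) +
    sum_edges (fun i a j b => eterm i a (halfp * (E i + E j)) (W i - W j) (F i)).
  by rewrite -sum_edgesD; apply: eq_sum_edges => i a j b _ _; rewrite hD tX.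
have arith (a b c d e g : R) : a + b - (c + d) + (e + g) = a - c + e + (b - d + g) by ring.
rewrite /dMApoly [X in X - _ + _ = _]e1.
rewrite [X in _ - X + _ = _]e2.
rewrite [X in _ + X = _]e3.
exact: arith.
Qed.

(** The Newton equation for E + W is subtracted from the exact expansion of A at u_H + E; A(u_H, .)
    and A'(u_H; E, .) cancel. *)
Lemma newton_residual k f G uH u_h uh : compact (closure Omega) -> {within closure Omega, continuous f} ->
  Vh k Omega T uH -> discrete_solution k Omega T f G u_h -> newton_step k Omega T f G uH uh ->
  exists U E W : 'I_(ntri T) -> {poly {poly R}},
  [/\ (forall i, [/\ bsize k.+1 (U i), bsize k.+1 (E i) & bsize k.+1 (W i)]),
      represents uH U, represents (fun x => u_h x - uH x) E, represents (fun x => uh x - u_h x) W &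
      dMApoly U W W = MAremainder E W].
Proof.
move=> cO cf hH [hh bh sh] [hN bN sN].
have [U sU rU] := Vh_represents hH; have [A sA rA] := Vh_represents hh.
have [B sB rB] := Vh_represents hN.
pose E i := A i - U i; pose W i := B i - A i.
have rW : represents (fun x => uh x - u_h x) W := representsB rB rA.
have rE : represents (fun x => u_h x - uH x) E := representsB rA rU.
exists U, E, W; split=> //; first by move=> i; split=> //; exact: bsizeB.
(* The error is an admissible test function because both functions match the same boundary
   interpolant. *)
have w0 : Vh0 k Omega T (fun x => uh x - u_h x) := boundary_match_Vh0 hN hh bN bh.
have := sN _ w0; rewrite (MAformE hT _ rU rW) (dMAformE hT rU (representsB rB rU) rW).
have := sh _ w0; rewrite (MAformE hT _ rA rW).
have -> : A = (fun i => U i + E i) by apply/funext => i; rewrite /E addrC subrK.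
rewrite (MApoly_expansion hT).
have -> : (fun i => B i - U i) = (fun i => E i + W i).
  by apply/funext => i; rewrite /E /W [RHS]addrC addrA subrK.
rewrite dMApolyD => e1 e2.
apply: (addrI (dMApoly U E W)); rewrite e2; apply/eqP; rewrite eq_sym -subr_eq0 opprK addrC addrA.
by apply/eqP.
- by move=> i; exact: (source_integrable i _ hT cO cf).
- by move=> i j x ci cj; rewrite -(rW i)// -(rW j).
- by move=> i x ci bx; rewrite -(rW i)//; have [_ /(_ x bx)] := w0.
Qed.

End NewtonStep.

Theorem theorem4p1 (R : realType) (Omega : set (pt R)) (f g G u : pt R -> R)
  (c0 alpha0 alpha1 : R) (k : nat) (Th : set (mesh R))
  (C1 C2 C3 eps lambda : R)
  (hOmega : convex_polygonal_domain Omega)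
  (hf : C_bar 1 Omega f)
  (hc0 : 0 < c0)
  (hfc0 : forall x, closure Omega x -> c0 <= f x)
  (hg : {within bdry Omega, continuous g})
  (hG : C_bar 3 Omega G)
  (hGg : forall x, bdry Omega x -> G x = g x)
  (hu : C_bar 3 Omega u)
  (hconv : strictly_convex Omega u)
  (hMA : forall x, Omega x -> \det (hess Omega u x) = f x)
  (hbc : forall x, bdry Omega x -> u x = g x)
  (halpha0 : 0 < alpha0)
  (halpha1 : 0 < alpha1)
  (hcof : forall x (r : 'cV[R]_2), closure Omega x ->
     alpha0 * scal (r^T *m r) <= scal (r^T *m cof (hess Omega u x) *m r)
       <= alpha1 * scal (r^T *m r))
  (huW : in_Winf k.+1 Omega u)
  (hGW : in_Winf k.+1 Omega G)
  (hTh : forall T, Th T -> conforming_triangulation Omega T /\ mesh_size T <= 1)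
  (hreg : shape_regular Th)
  (hqu : quasi_uniform Th)
  (hC1 : 0 < C1)
  (hC2 : 0 < C2)
  (hC3 : 0 < C3)
  (hC : exists2 h1 : R, 0 < h1 & forall T, Th T -> mesh_size T <= h1 ->
     stability_bounds k Omega u G C1 C2 C3 T)
  (hk : (3 <= k)%N)
  (heps : 0 < eps < 1)
  (hlambda : 2^-1 + (2 + eps) / (2 * k%:R) < lambda < 1) :
  let C4 := Num.max C1 (Num.max C2 C3) in
  exists h0 C : R, [/\ 0 < h0, 0 < C &
    forall TH T : mesh R, Th TH -> Th T -> refines T TH ->
      mesh_size TH = mesh_size T `^ lambda ->
      mesh_size T <= h0 ->
      forall u_h uH uh : pt R -> R,
        discrete_solution k Omega T f G u_h ->
        Bh k Omega T u G C4 u_h ->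
        discrete_solution k Omega TH f G uH ->
        Bh k Omega TH u G C4 uH ->
        newton_step k Omega T f G uH uh ->
        (H1_norm Omega (fun x => uh x - u_h x)%R <= (C * mesh_size T ^+ k)%:E)%E].
Proof.
move=> C4.
have C40 : 0 < C4 by rewrite lt_max hC1.
have [On [m [p OE]]] := hOmega.
have [cO iO] : compact (closure Omega) /\ (closure Omega)° `<=` Omega.
  by rewrite OE; exact: closed_domain_interior.
have oO : open Omega by rewrite OE; exact: open_interior.
have [D1 [D2 [hD1 cD2 dD hE]]] := C_bar_derivatives hu oO.
have [L L1 hL] := regular_inscribed hreg hqu.
have L0 : 0 < L by apply: lt_le_trans L1.
have [M0 clM0] : exists M0 : R, closure Omega `<=` box M0.
  exists (\sum_i (`|(p i).1| + `|(p i).2|)); apply: subset_trans (@hull_box _ _ p).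
  by rewrite OE; exact: closure_interior_hull_sub.
pose M := 1 + `|M0|.
have M_0 : 0 < M by rewrite /M ltr_pwDl.
have clM : closure Omega `<=` box M.
  move=> x /clM0/boxP[x1 x2]; have hM := ler_norm M0; apply/boxP; split; rewrite /M; lra.
have al0 : 0 < alpha0 / 2 by rewrite divr_gt0.
have [K [kap [K0 kap0 stab]]] := @discrete_stability R k.+1 L M (alpha0 / 2) L1 M_0 al0.
have coer x (r : 'cV[R]_2) : closure Omega x ->
    alpha0 * scal (r^T *m r) <= scal (r^T *m cof (hess Omega u x) *m r).
  by move=> cx; have /andP[] := hcof x r cx.
have [rho [kap2 [rho0 kap20 coerc]]] :=
  @discrete_coercivity R k.+1 Omega u alpha0 L D1 D2 L1 halpha0 cO cD2 dD hE coer.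
have [eps0 _] := andP heps.
(* The factor 3 * C4 is the one in the radius of B_h, and 2 / eps comes from absorbing the
   logarithm; D * q then bounds the gradient errors of both discrete solutions. *)
pose D := 3 * C4 * (2 / eps).
have D0 : 0 < D by rewrite !mulr_gt0// invr_gt0.
(* Thresholds for the square root of h: since q <= h^2 sqrt(h), they give D * q <= kap * r^2 for
   stability and D * q <= kap2 * r for coercivity, with r = h / L. *)
pose m1 := kap / (L ^+ 2 * D); pose m2 := kap2 / (L * D).
have m10 : 0 < m1 by rewrite divr_gt0// mulr_gt0// exprn_gt0.
have m20 : 0 < m2 by rewrite divr_gt0// mulr_gt0.
(* The constant is K * (2 * D * q)^2 / r^2 with q^2 = h^k * h^2 and r = h / L; the 2 arises because
   u_h - u_H is bounded through u. *)
exists (Num.min rho (Num.min (m1 ^+ 2) (m2 ^+ 2))), (K * (4 * D ^+ 2 * L ^+ 2)); split.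
- by rewrite !lt_min rho0 !exprn_gt0.
- by apply: mulr_gt0 => //; apply: mulr_gt0; [apply: mulr_gt0|]; rewrite ?exprn_gt0.
move=> TH T hTH hTT ref HE hh u_h uH uh sh [_ _ wh] sH [vH _ wH] nw.
have [hT hle1] := hTh _ hTT.
set h := mesh_size T in HE hh hle1 wh wH *.
have h0 : 0 < h by exact: mesh_size_gt0 hT On.
have h01 : 0 < h <= 1 by rewrite h0.
move: hh; rewrite !le_min => /and3P[hrho hm1 hm2].
have sq_le (a : R) : 0 < a -> h <= a ^+ 2 -> Num.sqrt h <= a.
  by move=> a0 ha; rewrite -(ger0_norm (ltW a0)) -sqrtr_sqr ler_sqrt// exprn_ge0// ltW.
have [dh dH qq qh] := coarse_mesh_error hk heps hlambda h01.
set q := Num.sqrt _ in dh dH qq qh.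
have q0 : 0 < q by rewrite sqrtr_gt0 mulr_gt0// exprn_gt0.
have [c ins] := hL Omega T hTT hT h0.
set r := h / L in ins.
have r0 : 0 < r by rewrite divr_gt0.
have Lr : L * r = h by rewrite /r mulrC divfK ?gt_eqF.
have [_ cov _] := hT.
have sub (i : 'I_(ntri T)) : cell i `<=` closure Omega by rewrite cov => x cx; exists i.
have iOm (i : 'I_(ntri T)) : (cell i)° `<=` Omega by apply: subset_trans iO; exact: interiorS (sub i).
have [U [E [W [sz rU rE rW eqn]]]] := newton_residual hT cO hf.1 (Vh_refines ref vH) sh nw.
(* u_H is treated as a function on the fine mesh, so its error, of the size of the coarse mesh, is
   evaluated on fine cells. *)
have pU i x l : cell i x -> `|ev (dpoly l (U i)) x - D1 l x| <= D * q.
  have [c1 e1] := hD1 l.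
  apply: (W1inf_pointwise hT _ rU (iOm i) (fun y Oy => (e1 y Oy).1) c1 (fun y Oy => (e1 y Oy).2)).
  apply: (le_trans wH); rewrite HE lee_fin -mulrA /D -[leRHS]mulrA.
  by rewrite ler_wpM2l// mulr_ge0// ltW.
have pA i x l : cell i x -> `|ev (dpoly l (U i + E i)) x - D1 l x| <= D * q.
  have [c1 e1] := hD1 l.
  have rA : represents u_h (fun i => U i + E i).
    move=> j y cy; have -> : u_h y = uH y + (u_h y - uH y) by rewrite addrC subrK.
    by rewrite evD -rU// -rE.
  apply: (W1inf_pointwise hT _ rA (iOm i) (fun y Oy => (e1 y Oy).1) c1 (fun y Oy => (e1 y Oy).2)).
  apply: (le_trans wh); rewrite lee_fin -mulrA /D -[leRHS]mulrA.
  by rewrite ler_wpM2l// mulr_ge0// ltW.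
have pE i x l : cell i x -> `|ev (dpoly l (E i)) x| <= 2 * (D * q).
  move=> cx; have := norm_diff_le (pA i x l cx) (pU i x l cx).
  by rewrite dpolyD evD; congr (`|_| <= _); ring.
have qr : D * q <= kap * r ^+ 2.
  apply: (@le_trans _ _ (D * (h ^+ 2 * m1))).
    by rewrite ler_pM2l//; apply: (le_trans qh); rewrite ler_wpM2l ?exprn_ge0 ?(ltW h0)// sq_le.
  by apply: eq_ler; rewrite /m1 /r; field; rewrite !gt_eqF.
have qr2 : D * q <= kap2 * r.
  apply: (@le_trans _ _ (D * (h * m2))).
    rewrite ler_pM2l//; apply: (le_trans qh); apply: ler_pM; rewrite ?exprn_ge0 ?sqrtr_ge0 ?(ltW h0)//.
      by rewrite expr2 ler_piMl// ltW.
    exact: sq_le.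
  by apply: eq_ler; rewrite /m2 /r; field; rewrite !gt_eqF.
have Lrho : L * r <= rho by rewrite Lr.
have co := coerc T c r hT r0 ins iOm Lrho U (D * q) (fun i => let: And3 a _ _ := sz i in a) pU qr2.
have Wc : continuous_across W by move=> i j x ci cj; rewrite -(rW i)// -(rW j).
have W0 : vanishing_trace Omega W.
  have [_ bN _] := nw; have [_ bh _] := sh.
  by move=> i x ci bx; rewrite -(rW i)// bN// bh// subrr.
have Dq0 : 0 < D * q by exact: mulr_gt0.
have := stab Omega T c r hT r0 ins (fun i => subset_trans (sub i) clM) U E W D1 (D * q) (2 * (D * q))
  sz Wc W0 pU pE co (ltW Dq0) (mulr_gt0 (ltr0n _ 2) Dq0) qr eqn.
have -> : K * ((2 * (D * q)) ^+ 2 / r ^+ 2) = K * (4 * D ^+ 2 * L ^+ 2) * h ^+ k.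
  have -> : (2 * (D * q)) ^+ 2 = 4 * D ^+ 2 * q ^+ 2 by ring.
  by rewrite qq /r; field; rewrite !gt_eqF.
move=> hS; apply: (le_trans (H1_norm_le hT rW)); rewrite lee_fin.
have C0 : 0 <= K * (4 * D ^+ 2 * L ^+ 2) * h ^+ k.
  apply: mulr_ge0; last exact: exprn_ge0 (ltW h0).
  by apply: mulr_ge0; [exact: ltW|rewrite mulr_ge0 ?sqr_ge0// mulr_ge0 ?sqr_ge0].
by rewrite -(ger0_norm C0) -sqrtr_sqr ler_sqrt// exprn_ge0.
Qed.
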